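(* Let $k \geqslant 4$ be an even integer. Then every zero of $E_{k,2}^{*}(z)$ in $\mathbb{F}^{*}(2)$ lies on the arc $$\overline{A_2^{*}} = \{z \in \mathbb{C} : |z| = 1/\sqrt{2},\ \pi/2 \leqslant \mathrm{Arg}(z) \leqslant 3\pi/4\}.$$
   Context: Let $\mathbb{H} = \{z \in \mathbb{C} : \mathrm{Im}(z) > 0\}$. For an even integer $k \geqslant 4$ and $z \in \mathbb{H}$, define the Eisenstein series $$E_k(z) := \frac{1}{2} \sum_{(c,d)=1} (cz+d)^{-k},$$ the sum being over all pairs of coprime integers $(c,d)$, and $$E_{k,2}^{*}(z) := \frac{1}{2^{k/2}+1}\left(2^{k/2} E_k(2z) + E_k(z)\right),$$ the Eisenstein series associated with the Fricke group $\Gamma_0^{*}(2) = \Gamma_0(2) \cup \Gamma_0(2) W_2$, $W_2 = \begin{pmatrix} 0 & -1/\sqrt{2} \\ \sqrt{2} & 0 \end{pmatrix}$. The following set is a fundamental domain for $\Gamma_0^{*}(2)$: $$\mathbb{F}^{*}(2) := \{z\in\mathbb{H} : |z| \geqslant 1/\sqrt{2},\ -1/2 \leqslant \mathrm{Re}(z) \leqslant 0\} \cup \{z\in\mathbb{H} : |z| > 1/\sqrt{2},\ 0 \leqslant \mathrm{Re}(z) < 1/2\}.$$ *)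

(* Defs.v *)
From Stdlib Require Import Reals ZArith List Lra Lia Classical ClassicalEpsilon.
From Coquelicot Require Import Coquelicot.
Open Scope R_scope.

(* Unordered summation: a list without repetition stands for a finite set, and
   [finite_subsets D] is the filter of finite subsets of [D] directed by
   inclusion. *)
Definition finite_subsets {T : Type} (D : T -> Prop) (P : list T -> Prop) : Prop :=
  exists l0 : list T, List.Forall D l0 /\
    forall l : list T, NoDup l -> List.Forall D l -> incl l0 l -> P l.

Definition partial_sum {T : Type} (f : T -> C) (l : list T) : C :=
  fold_right Cplus (RtoC 0) (map f l).

Definition is_sum_over {T : Type} (D : T -> Prop) (f : T -> C) (s : C) : Prop :=
  filterlim (partial_sum f) (finite_subsets D) (locally s).

(* Total version: the sum of the family when it is summable (see
   [is_sum_over_unique]), an unspecified complex number otherwise. *)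
Definition sum_over {T : Type} (D : T -> Prop) (f : T -> C) : C :=
  @lim C_CompleteNormedModule (filtermap (partial_sum f) (finite_subsets D)).

Lemma finite_subsets_proper {T : Type} (D : T -> Prop) :
  ProperFilter (finite_subsets D).
Proof.
assert (dec : forall x y : T, {x = y} + {x <> y}).
{ intros x y; apply excluded_middle_informative. }
constructor.
- intros P [l0 [D0 H]].
  exists (nodup dec l0); apply H.
  + apply NoDup_nodup.
  + rewrite List.Forall_forall in *; intros x Hx; apply D0.
    now apply (nodup_In dec).
  + intros x Hx; now apply (nodup_In dec).
- constructor.
  + exists nil; split; [constructor | auto].
  + intros P Q [l1 [D1 H1]] [l2 [D2 H2]].
    exists (l1 ++ l2); split; [now apply List.Forall_app |].
    intros l Hl Dl Hi; split; [apply H1 | apply H2]; auto;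
      intros x Hx; apply Hi, in_or_app; auto.
  + intros P Q HPQ [l0 [D0 H]]; exists l0; split; auto.
Qed.

Lemma is_sum_over_unique {T : Type} (D : T -> Prop) (f : T -> C) (s : C) :
  is_sum_over D f s -> sum_over D f = s.
Proof.
intros Hs.
assert (PF := finite_subsets_proper D).
set (F := filtermap (partial_sum f) (finite_subsets D)).
assert (PF' : ProperFilter F) by (apply filtermap_proper_filter; exact PF).
assert (HF : forall e : posreal, F (ball (s : C_UniformSpace) e)).
{ intros e; apply Hs; now exists e. }
assert (HL := @complete_cauchy C_CompleteNormedModule F PF'
  (fun e => ex_intro _ s (HF e))).
symmetry; apply (@eq_close _ C_NormedModule); intros e.
assert (He : F (fun x => ball (s : C_UniformSpace) (pos_div_2 e) x /\
   ball (@lim C_CompleteNormedModule F : C_UniformSpace) (pos_div_2 e) x)).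
{ apply filter_and; [apply HF | apply HL]. }
destruct (filter_ex _ He) as [x [H1 H2]].
replace (pos e) with (pos_div_2 e + pos_div_2 e) by (simpl; lra).
apply (@ball_triangle C_UniformSpace) with x; auto.
now apply (@ball_sym C_UniformSpace).
Qed.

Definition Eisenstein (k : nat) (z : C) : C :=
  (/ 2 * sum_over (fun p : Z * Z => Z.gcd (fst p) (snd p) = 1%Z)
           (fun p => / (RtoC (IZR (fst p)) * z + RtoC (IZR (snd p))) ^ k))%C.

(* [k / 2] is natural-number division, exact for the even weights considered. *)
Definition Estar2 (k : nat) (z : C) : C :=
  (/ (RtoC 2 ^ (k / 2) + 1) * (RtoC 2 ^ (k / 2) * Eisenstein k (RtoC 2 * z) + Eisenstein k z))%C.

Definition upper_half_plane (z : C) : Prop := 0 < Im z.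

Definition Fstar2 (z : C) : Prop :=
  (upper_half_plane z /\ Cmod z >= 1 / sqrt 2 /\ - 1 / 2 <= Re z <= 0) \/
  (upper_half_plane z /\ Cmod z > 1 / sqrt 2 /\ 0 <= Re z < 1 / 2).

(* Principal argument, with values in (-PI, PI]; meaningful for z <> 0. *)
Definition Arg (z : C) : R :=
  if Rle_dec 0 (Im z) then acos (Re z / Cmod z) else - acos (Re z / Cmod z).

Lemma Arg_correct (z : C) : z <> RtoC 0 ->
  - PI < Arg z <= PI /\
  Re z = Cmod z * cos (Arg z) /\ Im z = Cmod z * sin (Arg z).
Proof.
intros Hz.
assert (Hm : 0 < Cmod z) by now apply Cmod_gt_0.
assert (H2 := Cmod2_alt z).
set (t := Re z / Cmod z).
assert (Ht : Re z = Cmod z * t) by (unfold t; field; lra).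
assert (Hs : Im z ^ 2 = Cmod z ^ 2 * (1 - t²)).
{ unfold Rsqr; rewrite Ht in H2; nra. }
assert (Hb : 0 <= 1 - t²).
{ apply Rmult_le_reg_l with (Cmod z ^ 2); [nra |]. rewrite Rmult_0_r, <- Hs. nra. }
assert (Hb' : -1 <= t <= 1) by (unfold Rsqr in Hb; nra).
assert (Hr : Cmod z * sqrt (1 - t²) = Rabs (Im z)).
{ rewrite <- (sqrt_Rsqr_abs (Im z)), <- (sqrt_Rsqr (Cmod z)) at 1 by lra.
  rewrite <- sqrt_mult_alt by apply Rle_0_sqr.
  f_equal; unfold Rsqr in *; lra. }
assert (Hacos := acos_bound t).
unfold Arg; fold t; destruct (Rle_dec 0 (Im z)) as [Hi | Hi].
- rewrite cos_acos, sin_acos by lra.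
  rewrite Hr, Rabs_pos_eq by lra.
  assert (HP := PI_RGT_0); repeat split; lra.
- rewrite cos_neg, sin_neg, cos_acos, sin_acos by lra.
  rewrite Ropp_mult_distr_r_reverse, Hr, Rabs_left by lra.
  assert (HP := PI_RGT_0).
  assert (acos t <> PI).
  { intros He.
    assert (t = -1) by (rewrite <- (cos_acos t), He by lra; apply cos_PI).
    replace t with (-1) in Hs by lra; unfold Rsqr in Hs; nra. }
  repeat split; lra.
Qed.

Definition closed_arc_A2 (z : C) : Prop :=
  Cmod z = 1 / sqrt 2 /\ PI / 2 <= Arg z <= 3 * PI / 4.

(* Main.v *)
(** Let k = 2 p and E be twice E*_{k,2}: it is the sum, over coprime (b, d) with d odd, of the
    pairs (2 b z + d)^(-k) + 2^(-p) (d z + b)^(-k). The antiholomorphic reflection z -> 1/(2 conj z)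
    in the circle |z| = 1/sqrt 2 exchanges, up to automorphy factors, the two members of each pair.
    No valence formula is used: E is shown not to vanish for |z| > 1/sqrt 2 and |Re z| <= 1/2 by
    exhibiting F with Re (E conj F) > 0, and by z -> - conj z one may take Re z <= 0.

    If |z| is large, F = 1 works since the constant term dominates. Near the circle but away from
    the corner (-1+i)/2, take F = 1 - (sqrt 2 z)^(-k), the difference of the two dominant terms,
    which the reflection changes into its negative. The pair (0, +-1) contributes 1 - beta^k,
    where beta = 1/(2 |z|^2), and every other pair contributes at most w (1 - beta^k), with weights
    w of small sum; the pair (+-1, +-1), which is not small near the line Re z = -1/2, is
    controlled by Chebyshev's sum inequality.

    Near the corner four terms have comparable size. In the Cayley coordinate t at the corner,
    summing a row over the stabiliser of order 4 and over complex conjugation yields a real power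
    series in t supported on exponents n = n0 (mod 4), with coefficients close to those of
    (1 - t)^(-k). With F = t^(n0 + 2) and s = t^2, the term of exponent n0 + 4 i contributes a
    multiple of Re (s^(2 i - 1)), and |Re (s^(2 m + 1))| <= (2 m + 1) |s|^(2 m) Re s, so the
    first two terms win. For k = 4 and k = 6 this disc covers everything that is not far from the
    circle. *)

Require Import Defs.
From Stdlib Require Import Reals ZArith Lra Lia Classical ClassicalEpsilon.
From Coquelicot Require Import Coquelicot.
From Stdlib Require Import List Permutation.
Open Scope R_scope.

(* E may vanish on the circle, so no fixed positive lower bound survives there: every estimate must
   carry a factor that vanishes on the circle to the same order as Re (E conj F). Near the arc this
   factor is 1 - beta^k, which is why the bounds are products of 1 - beta with polynomials (P^k -
   Q^k) / (P - Q). This fails near the corner, where |2 z + 1| tends to 1 and the weight found for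
   the rows +-(1, 1), of size 1 / (k (|2 z + 1| - 1)), blows up. The cut is made at k (|2 z + 1| -
   1) = 4, and what is left is a set where |t| is O(1 / k). There the factor is Re (t^2): the circle
   and its mirror image |z + 1| = 1/sqrt 2 in the line Re z = -1/2 meet at a right angle in the
   corner, and in the coordinate t they become the two lines Re (t^2) = 0. The exponent n0 is the
   residue of -p modulo 4, the order of vanishing at the corner forced by the stabiliser; the extra
   t^2 in F turns the leading term into a positive multiple of Re (t^2). *)
#[local] Existing Instance finite_subsets_proper.

(** * Unordered sums *)

Definition rsum {T : Type} (f : T -> R) (l : list T) : R := fold_right Rplus 0 (map f l).

Lemma rsum_app {T : Type} (f : T -> R) l1 l2 : rsum f (l1 ++ l2) = rsum f l1 + rsum f l2.
Proof.
unfold rsum; induction l1 as [|a l IH]; simpl; [lra | rewrite IH; lra].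
Qed.

Lemma rsum_perm {T : Type} (f : T -> R) l1 l2 : Permutation l1 l2 -> rsum f l1 = rsum f l2.
Proof. unfold rsum; induction 1; simpl; lra. Qed.

Lemma rsum_le {T : Type} (f g : T -> R) l :
  (forall x, In x l -> f x <= g x) -> rsum f l <= rsum g l.
Proof.
unfold rsum; induction l as [|a l IH]; simpl; intros H; [lra |].
assert (f a <= g a) by auto. assert (H1 := IH (fun x Hx => H x (or_intror Hx))). lra.
Qed.

Lemma rsum_ge0 {T : Type} (f : T -> R) l : (forall x, In x l -> 0 <= f x) -> 0 <= rsum f l.
Proof.
unfold rsum; induction l as [|a l IH]; simpl; intros H; [lra |].
assert (0 <= f a) by auto. assert (H1 := IH (fun x Hx => H x (or_intror Hx))). lra.
Qed.

Lemma rsum_scal {T : Type} (c : R) (f : T -> R) l : rsum (fun x => c * f x) l = c * rsum f l.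
Proof. unfold rsum; induction l as [|a l IH]; simpl; [lra | rewrite IH; lra]. Qed.

Lemma rsum_plus {T : Type} (f g : T -> R) l :
  rsum (fun x => f x + g x) l = rsum f l + rsum g l.
Proof. unfold rsum; induction l as [|a l IH]; simpl; [lra | rewrite IH; lra]. Qed.

Lemma rsum_map {T U : Type} (h : T -> U) (f : U -> R) l :
  rsum f (map h l) = rsum (fun x => f (h x)) l.
Proof. unfold rsum; now rewrite map_map. Qed.

Lemma eq_dec_classic {T : Type} (x y : T) : {x = y} + {x <> y}.
Proof. apply excluded_middle_informative. Qed.

Lemma permutation_filter {T : Type} (g : T -> bool) (l : list T) :
  Permutation l (filter g l ++ filter (fun x => negb (g x)) l).
Proof.
induction l as [|a l IH]; simpl; auto.
destruct (g a); simpl; [now constructor |].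
eapply perm_trans; [constructor; exact IH | apply Permutation_middle].
Qed.

Lemma sublist_complement {T : Type} (l0 l : list T) : NoDup l0 -> NoDup l -> incl l0 l ->
  exists r, Permutation l (l0 ++ r) /\ NoDup r /\ (forall x, In x r -> In x l /\ ~ In x l0).
Proof.
intros H0 H1 Hi.
set (g := fun x => if in_dec eq_dec_classic x l0 then false else true).
assert (Hg : forall x, In x (filter g l) <-> In x l /\ ~ In x l0).
{ intros x; rewrite filter_In; unfold g; destruct (in_dec _ x l0); intuition congruence. }
exists (filter g l); split; [|split].
- apply NoDup_Permutation; auto.
  + apply NoDup_app; auto using NoDup_filter.
    intros x Hx Hx'; apply Hg in Hx'; tauto.
  + intros x; rewrite in_app_iff, Hg; split; [|intuition].
    intros Hx; destruct (in_dec eq_dec_classic x l0); auto.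
- now apply NoDup_filter.
- intros x Hx; now apply Hg.
Qed.

Lemma rsum_incl {T : Type} (f : T -> R) l l' : NoDup l -> NoDup l' -> incl l l' ->
  (forall x, In x l' -> 0 <= f x) -> rsum f l <= rsum f l'.
Proof.
intros H0 H1 Hi Hf.
destruct (sublist_complement l l' H0 H1 Hi) as [r [Hp [_ Hr]]].
rewrite (rsum_perm f _ _ Hp), rsum_app.
assert (0 <= rsum f r); [|lra].
apply rsum_ge0; intros x Hx; now apply Hf, Hr.
Qed.

Lemma partial_sum_app {T : Type} (f : T -> C) l1 l2 :
  partial_sum f (l1 ++ l2) = (partial_sum f l1 + partial_sum f l2)%C.
Proof.
unfold partial_sum; induction l1 as [|a l IH]; simpl; [now rewrite Cplus_0_l |].
rewrite IH; ring.
Qed.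

Lemma partial_sum_perm {T : Type} (f : T -> C) l1 l2 :
  Permutation l1 l2 -> partial_sum f l1 = partial_sum f l2.
Proof.
unfold partial_sum; induction 1; simpl; try congruence; ring.
Qed.

Lemma Cmod_partial_sum {T : Type} (f : T -> C) l :
  Cmod (partial_sum f l) <= rsum (fun x => Cmod (f x)) l.
Proof.
unfold partial_sum, rsum; induction l as [|a l IH]; simpl; [rewrite Cmod_0; lra |].
eapply Rle_trans; [apply Cmod_triangle | lra].
Qed.

Lemma Re_partial_sum {T : Type} (f : T -> C) l :
  Re (partial_sum f l) = rsum (fun x => Re (f x)) l.
Proof.
unfold partial_sum, rsum; induction l as [|a l IH]; [reflexivity |].
cbn [map fold_right]; now rewrite re_plus, IH.
Qed.

Lemma is_sum_over_eps {T : Type} (D : T -> Prop) (f : T -> C) (s : C) :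
  is_sum_over D f s <->
  forall eps, 0 < eps -> exists l0, Forall D l0 /\
    forall l, NoDup l -> Forall D l -> incl l0 l -> Cmod (partial_sum f l - s) < eps.
Proof.
split.
- intros H eps He.
  (* The uniform structure of C is that of a product, so a ball of radius r only bounds the modulus
     by sqrt 2 * r; halving [eps] absorbs sqrt 2 < 2. *)
  assert (He' : 0 < eps / 2) by lra.
  destruct (proj1 (filterlim_locally (partial_sum f) (s : C_UniformSpace)) H
     (mkposreal _ He')) as [l0 [D0 Hl]].
  exists l0; split; [exact D0 |]; intros l Hn Dl Hi.
  assert (Hb := Hl l Hn Dl Hi).
  apply C_NormedModule_mixin_compat2 in Hb; simpl in Hb.
  assert (Hq : sqrt 2 < 2).
  { rewrite <- (sqrt_square 2) at 2 by lra. apply sqrt_lt_1; lra. }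
  eapply Rlt_trans; [exact Hb |]. nra.
- intros H; apply (proj2 (filterlim_locally (partial_sum f) (s : C_UniformSpace))).
  intros eps; destruct (H eps (cond_pos eps)) as [l0 [D0 Hl]].
  exists l0; split; [exact D0 |]; intros l Hn Dl Hi.
  apply C_NormedModule_mixin_compat1; now apply Hl.
Qed.

(** The absolute finite sums have a supremum m. Once a finite set comes within eps / 2 of m,
    whatever is added to it has absolute sum below eps, so the filter of partial sums is Cauchy. *)
Lemma is_sum_over_summable {T : Type} (D : T -> Prop) (f : T -> C) (B : R) :
  (forall l, NoDup l -> Forall D l -> rsum (fun x => Cmod (f x)) l <= B) ->
  exists s, is_sum_over D f s.
Proof.
intros HB.
assert (PF := finite_subsets_proper D).
set (F := filtermap (partial_sum f) (finite_subsets D)).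
assert (PF' : ProperFilter F) by (apply filtermap_proper_filter; exact PF).
destruct (completeness (fun r => exists l, NoDup l /\ Forall D l /\
    r = rsum (fun x => Cmod (f x)) l)) as [m [Hm1 Hm2]].
{ exists B; intros r [l [H1 [H2 ->]]]; auto. }
{ exists 0, nil; repeat split; auto; constructor. }
assert (Hc : @cauchy C_UniformSpace F).
{ intros eps.
  assert (He := cond_pos eps).
  assert (Hl0 : exists l0, NoDup l0 /\ Forall D l0 /\
     m - eps / 2 < rsum (fun x => Cmod (f x)) l0).
  { apply NNPP; intros Hn.
    assert (m <= m - eps / 2); [|lra].
    apply Hm2; intros r [l [H1 [H2 ->]]].
    apply Rnot_lt_le; intros H3; apply Hn; exists l; auto. }
  destruct Hl0 as [l0 [N0 [D0 H0]]].
  exists (partial_sum f l0), l0; split; [exact D0 |]; intros l Hn Dl Hi.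
  apply C_NormedModule_mixin_compat1.
  destruct (sublist_complement l0 l N0 Hn Hi) as [r [Hp _]].
  rewrite (partial_sum_perm f _ _ Hp), partial_sum_app.
  change (Cmod ((partial_sum f l0 + partial_sum f r) - partial_sum f l0) < eps).
  replace ((partial_sum f l0 + partial_sum f r) - partial_sum f l0)%C
    with (partial_sum f r) by ring.
  eapply Rle_lt_trans; [apply Cmod_partial_sum |].
  assert (rsum (fun x => Cmod (f x)) l <= m) by (apply Hm1; exists l; auto).
  rewrite (rsum_perm _ _ _ Hp), rsum_app in H. lra. }
exists (@lim C_CompleteNormedModule F).
apply (proj2 (filterlim_locally (partial_sum f)
   (@lim C_CompleteNormedModule F : C_UniformSpace))).
intros eps; exact (@complete_cauchy C_CompleteNormedModule F PF' Hc eps).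
Qed.

Lemma is_sum_over_ext {T : Type} (D : T -> Prop) (f g : T -> C) (s : C) :
  (forall x, D x -> f x = g x) -> is_sum_over D f s -> is_sum_over D g s.
Proof.
rewrite !is_sum_over_eps; intros Hfg H eps He.
destruct (H eps He) as [l0 [D0 Hl]]; exists l0; split; [exact D0 |].
intros l Hn Dl Hi; replace (partial_sum g l) with (partial_sum f l); [now apply Hl |].
clear Hn Hi; unfold partial_sum; induction Dl; simpl; [easy |].
rewrite Hfg, IHDl; auto.
Qed.

(** The inverse [psi] is given explicitly because it pulls the finite set that controls the sum over
    [D'] back to [D]. *)
Lemma is_sum_over_bij {T U : Type} (D : T -> Prop) (D' : U -> Prop)
  (phi : T -> U) (psi : U -> T) (f : U -> C) (s : C) :
  (forall x, D x -> D' (phi x) /\ psi (phi x) = x) ->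
  (forall y, D' y -> D (psi y) /\ phi (psi y) = y) ->
  is_sum_over D' f s -> is_sum_over D (fun x => f (phi x)) s.
Proof.
rewrite !is_sum_over_eps; intros H1 H2 H eps He.
destruct (H eps He) as [l0 [D0 Hl]].
exists (map psi l0); split.
{ apply Forall_map; eapply Forall_impl; [| exact D0]; intros y Hy; now apply H2. }
intros l Hn Dl Hi.
replace (partial_sum (fun x => f (phi x)) l) with (partial_sum f (map phi l))
  by (unfold partial_sum; now rewrite map_map).
rewrite Forall_forall in D0, Dl.
apply Hl.
- clear Hi; induction Hn as [|a l Ha Hn IH]; simpl; constructor; auto.
  + intros Hin; apply in_map_iff in Hin; destruct Hin as [b [E Hb]].
    apply Ha; replace a with b; auto.
    rewrite <- (proj2 (H1 a (Dl a (or_introl eq_refl)))), <- E.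
    symmetry; apply H1; apply Dl; now right.
  + apply IH; intros x Hx; apply Dl; now right.
- apply Forall_map, Forall_forall; intros x Hx; now apply H1, Dl.
- intros y Hy.
  rewrite <- (proj2 (H2 y (D0 y Hy))); apply in_map, Hi, in_map, Hy.
Qed.

Lemma partial_sum_plus {T : Type} (f g : T -> C) l :
  partial_sum (fun x => (f x + g x)%C) l = (partial_sum f l + partial_sum g l)%C.
Proof.
unfold partial_sum; induction l as [|a l IH]; simpl; [ring | rewrite IH; ring].
Qed.

Lemma partial_sum_scal {T : Type} (c : C) (f : T -> C) l :
  partial_sum (fun x => (c * f x)%C) l = (c * partial_sum f l)%C.
Proof.
unfold partial_sum; induction l as [|a l IH]; simpl; [ring | rewrite IH; ring].
Qed.

Lemma partial_sum_conj {T : Type} (f : T -> C) l :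
  partial_sum (fun x => Cconj (f x)) l = Cconj (partial_sum f l).
Proof.
unfold partial_sum; induction l as [|a l IH]; simpl.
- unfold Cconj; simpl; now rewrite Ropp_0.
- now rewrite IH, Cplus_conj.
Qed.

Lemma is_sum_over_plus {T : Type} (D : T -> Prop) (f g : T -> C) (s t : C) :
  is_sum_over D f s -> is_sum_over D g t ->
  is_sum_over D (fun x => (f x + g x)%C) (s + t)%C.
Proof.
rewrite !is_sum_over_eps; intros Hf Hg eps He.
destruct (Hf (eps / 2)) as [l1 [D1 H1]]; [lra |].
destruct (Hg (eps / 2)) as [l2 [D2 H2]]; [lra |].
exists (l1 ++ l2); split; [now apply Forall_app |]; intros l Hn Dl Hi.
apply incl_app_inv in Hi; destruct Hi as [Hi1 Hi2].
rewrite partial_sum_plus.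
replace (partial_sum f l + partial_sum g l - (s + t))%C
  with ((partial_sum f l - s) + (partial_sum g l - t))%C by ring.
eapply Rle_lt_trans; [apply Cmod_triangle |].
assert (A1 := H1 l Hn Dl Hi1); assert (A2 := H2 l Hn Dl Hi2); lra.
Qed.

Lemma is_sum_over_scal {T : Type} (D : T -> Prop) (c : C) (f : T -> C) (s : C) :
  is_sum_over D f s -> is_sum_over D (fun x => (c * f x)%C) (c * s)%C.
Proof.
rewrite !is_sum_over_eps; intros Hf eps He.
assert (Hc := Cmod_ge_0 c).
destruct (Hf (eps / (Cmod c + 1))) as [l1 [D1 H1]].
{ apply Rdiv_lt_0_compat; lra. }
exists l1; split; [easy |]; intros l Hn Dl Hi.
rewrite partial_sum_scal.
replace (c * partial_sum f l - c * s)%C with (c * (partial_sum f l - s))%C by ring.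
rewrite Cmod_mult.
assert (A := H1 l Hn Dl Hi).
apply (Rmult_lt_compat_l (Cmod c + 1)) in A; [|lra].
replace ((Cmod c + 1) * (eps / (Cmod c + 1))) with eps in A by (field; lra).
assert (A2 := Cmod_ge_0 (partial_sum f l - s)); nra.
Qed.

Lemma is_sum_over_conj {T : Type} (D : T -> Prop) (f : T -> C) (s : C) :
  is_sum_over D f s -> is_sum_over D (fun x => Cconj (f x)) (Cconj s).
Proof.
rewrite !is_sum_over_eps; intros Hf eps He.
destruct (Hf eps He) as [l1 [D1 H1]].
exists l1; split; [easy |]; intros l Hn Dl Hi.
rewrite partial_sum_conj, <- Cminus_conj, Cmod_conj; auto.
Qed.

Lemma is_sum_over_union {T : Type} (D D1 D2 : T -> Prop) (f : T -> C) (s1 s2 : C) :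
  (forall x, D x <-> D1 x \/ D2 x) -> (forall x, D1 x -> D2 x -> False) ->
  is_sum_over D1 f s1 -> is_sum_over D2 f s2 -> is_sum_over D f (s1 + s2)%C.
Proof.
rewrite !is_sum_over_eps; intros HD Hdis Hf Hg eps He.
destruct (Hf (eps / 2)) as [l1 [E1 H1]]; [lra |].
destruct (Hg (eps / 2)) as [l2 [E2 H2]]; [lra |].
rewrite Forall_forall in E1, E2.
exists (l1 ++ l2); split.
{ apply Forall_app; split; apply Forall_forall; intros x Hx; apply HD; auto. }
intros l Hn Dl Hi.
rewrite Forall_forall in Dl.
set (g := fun x => if excluded_middle_informative (D1 x) then true else false).
set (r1 := filter g l); set (r2 := filter (fun x => negb (g x)) l).
assert (I1 : forall x, In x r1 <-> In x l /\ D1 x).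
{ intros x; unfold r1, g; rewrite filter_In.
  destruct (excluded_middle_informative (D1 x)); intuition congruence. }
assert (I2 : forall x, In x r2 <-> In x l /\ D2 x).
{ intros x; unfold r2, g; rewrite filter_In.
  destruct (excluded_middle_informative (D1 x)) as [d|d]; simpl; split.
  - intros [_ ?]; discriminate.
  - intros [_ d']; now destruct (Hdis x).
  - intros [Hx _]; split; auto; destruct (proj1 (HD x) (Dl x Hx)); tauto.
  - tauto. }
assert (N1 : NoDup r1) by now apply NoDup_filter.
assert (N2 : NoDup r2) by now apply NoDup_filter.
assert (Hp : Permutation l (r1 ++ r2)).
{ apply NoDup_Permutation; auto.
  - apply NoDup_app; auto.
    intros x Hx Hx'; apply I1 in Hx; apply I2 in Hx'; now apply (Hdis x).
  - intros x; rewrite in_app_iff, I1, I2; split; [|tauto].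
    intros Hx; destruct (proj1 (HD x) (Dl x Hx)); tauto. }
rewrite (partial_sum_perm f _ _ Hp), partial_sum_app.
replace (partial_sum f r1 + partial_sum f r2 - (s1 + s2))%C
  with ((partial_sum f r1 - s1) + (partial_sum f r2 - s2))%C by ring.
eapply Rle_lt_trans; [apply Cmod_triangle |].
assert (A1 : Cmod (partial_sum f r1 - s1) < eps / 2).
{ apply H1; auto.
  - apply Forall_forall; intros x Hx; now apply I1.
  - intros x Hx; apply I1; split; auto; apply Hi, in_or_app; auto. }
assert (A2 : Cmod (partial_sum f r2 - s2) < eps / 2).
{ apply H2; auto.
  - apply Forall_forall; intros x Hx; now apply I2.
  - intros x Hx; apply I2; split; auto; apply Hi, in_or_app; auto. }
lra.
Qed.

(** All three regions end here: the terms of [l0] are kept, the others are bounded below by weights.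
    Only finite sums of weights have to be bounded, so the weights themselves never form a
    series. *)
Lemma Re_sum_ge {T : Type} (D : T -> Prop) (f : T -> C) (s : C) (l0 : list T)
  (w : T -> R) (W : R) :
  is_sum_over D f s -> NoDup l0 -> Forall D l0 ->
  (forall x, D x -> ~ In x l0 -> - w x <= Re (f x)) ->
  (forall l, NoDup l -> Forall (fun x => D x /\ ~ In x l0) l -> rsum w l <= W) ->
  rsum (fun x => Re (f x)) l0 - W <= Re s.
Proof.
rewrite is_sum_over_eps; intros Hs N0 D0 Hw HW.
apply Rnot_lt_le; intros Hlt.
set (eps := rsum (fun x => Re (f x)) l0 - W - Re s).
destruct (Hs eps) as [l1 [D1 H1]]; [unfold eps; lra |].
set (l := nodup eq_dec_classic (l0 ++ l1)).
assert (Hn : NoDup l) by apply NoDup_nodup.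
assert (Dl : Forall D l).
{ rewrite Forall_forall in *; intros x Hx; apply nodup_In, in_app_iff in Hx.
  destruct Hx; auto. }
assert (Hi0 : incl l0 l) by (intros x Hx; apply nodup_In, in_app_iff; auto).
assert (Hi1 : incl l1 l) by (intros x Hx; apply nodup_In, in_app_iff; auto).
assert (A := H1 l Hn Dl Hi1).
destruct (sublist_complement l0 l N0 Hn Hi0) as [r [Hp [Nr Hr]]].
assert (B : Re (partial_sum f l) >= rsum (fun x => Re (f x)) l0 - W).
{ rewrite Re_partial_sum, (rsum_perm _ _ _ Hp), rsum_app.
  rewrite Forall_forall in Dl.
  assert (rsum w r <= W).
  { apply HW; auto; apply Forall_forall; intros x Hx; split; [apply Dl|]; now apply Hr. }
  assert (rsum (fun x => -1 * w x) r <= rsum (fun x => Re (f x)) r).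
  { apply rsum_le; intros x Hx; replace (-1 * w x) with (- w x) by ring.
    apply Hw; [apply Dl |]; now apply Hr. }
  rewrite rsum_scal in H0; lra. }
assert (E := re_le_Cmod (partial_sum f l - s)).
unfold Cminus in E; rewrite re_plus, re_opp in E.
apply Rabs_le_between in E; unfold Cminus in A; unfold eps in A; lra.
Qed.

(** * Sums of inverse squares *)

Lemma rsum_seq_S (f : nat -> R) m K : rsum f (seq m (S K)) = rsum f (seq m K) + f (m + K)%nat.
Proof. rewrite seq_S, rsum_app; unfold rsum at 2; simpl; lra. Qed.

(** A rational substitute for pi^2 / 6: for n >= 2 the term is at most 1 / (n - 1/2) - 1 / (n +
    1/2), which telescopes to 2/3, and the term n = 1 adds 1. *)
Lemma inv_sq_sum_nat (l : list nat) : NoDup l -> (forall n, In n l -> (1 <= n)%nat) ->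
  rsum (fun n => / INR n ^ 2) l <= 5 / 3.
Proof.
intros Hn Hl.
assert (Hseq : forall K, rsum (fun n => / INR n ^ 2) (seq 1 (S K)) <= 5/3 - / (INR K + 3/2)).
{ induction K as [|K IH].
  - unfold rsum; simpl; lra.
  - rewrite rsum_seq_S. replace (1 + S K)%nat with (S (S K)) by lia.
    rewrite !S_INR. assert (HK := pos_INR K).
    assert (/ (INR K + 1 + 1) ^ 2 <= / (INR K + 3/2) - / (INR K + 1 + 3 / 2)); [|lra].
    replace (/ (INR K + 3/2) - / (INR K + 1 + 3 / 2))
      with (/ ((INR K + 3/2) * (INR K + 1 + 3 / 2))) by (field; lra).
    apply Rinv_le_contravar; nra. }
set (K := list_max l).
eapply Rle_trans; [apply rsum_incl with (l' := seq 1 (S K)) |]; auto.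
- apply seq_NoDup.
- intros n Hi; apply in_seq; split; [auto |].
  assert (n <= K)%nat; [|lia].
  assert (HF := proj1 (list_max_le l K) (le_n K)). rewrite Forall_forall in HF; auto.
- intros n Hi; apply in_seq in Hi; left; apply Rinv_0_lt_compat, pow_lt, lt_0_INR; lia.
- eapply Rle_trans; [apply Hseq |].
  assert (0 < / (INR K + 3/2)); [|lra].
  apply Rinv_0_lt_compat; assert (HK := pos_INR K); lra.
Qed.

(** A rational substitute for pi^2 / 8: since (2 i + 3)^2 exceeds 4 (i + 1) (i + 2) by 1, the terms
    after the first telescope to at most 1/4. *)
Lemma inv_sq_sum_nat_odd (l : list nat) : NoDup l -> (forall n, In n l -> Nat.Odd n) ->
  rsum (fun n => / INR n ^ 2) l <= 5 / 4.
Proof.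
intros Hn Hl.
assert (Hseq : forall K, rsum (fun i => / INR (2 * i + 1) ^ 2) (seq 0 (S K))
   <= 5/4 - / (4 * (INR K + 1))).
{ induction K as [|K IH].
  - unfold rsum; simpl; lra.
  - rewrite rsum_seq_S. replace (0 + S K)%nat with (S K) by lia.
    replace (INR (2 * S K + 1)) with (2 * INR K + 3)
      by (rewrite plus_INR, mult_INR, (S_INR K); simpl INR; lra).
    rewrite !S_INR. assert (HK := pos_INR K).
    assert (/ (2 * INR K + 3) ^ 2 <= / (4 * (INR K + 1)) - / (4 * (INR K + 1 + 1))); [|lra].
    replace (/ (4 * (INR K + 1)) - / (4 * (INR K + 1 + 1)))
      with (/ (4 * (INR K + 1) * (INR K + 1 + 1))) by (field; lra).
    apply Rinv_le_contravar; nra. }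
set (K := list_max l).
eapply Rle_trans; [apply rsum_incl with (l' := map (fun i => 2 * i + 1)%nat (seq 0 (S K))) |]; auto.
- apply FinFun.Injective_map_NoDup; [intros a b; lia | apply seq_NoDup].
- intros n Hi; destruct (Hl n Hi) as [m ->]; apply in_map_iff; exists m; split; [lia|].
  apply in_seq.
  assert (2 * m + 1 <= K)%nat; [|lia].
  assert (HF := proj1 (list_max_le l K) (le_n K)). rewrite Forall_forall in HF; auto.
- intros n Hi; apply in_map_iff in Hi; destruct Hi as [m [<- Hi]].
  left; apply Rinv_0_lt_compat, pow_lt, lt_0_INR; lia.
- rewrite rsum_map. eapply Rle_trans; [apply Hseq |].
  assert (0 < / (4 * (INR K + 1))); [|lra].
  apply Rinv_0_lt_compat; assert (HK := pos_INR K); lra.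
Qed.

Lemma inv_sq_sum_sign (P : Z -> Prop) (S : R) :
  (forall l : list nat, NoDup l -> (forall n, In n l -> (1 <= n)%nat /\ P (Z.of_nat n)) ->
     rsum (fun n => / INR n ^ 2) l <= S) ->
  (forall b, P b -> P (- b)%Z) ->
  forall l : list Z, NoDup l -> (forall b, In b l -> b <> 0%Z /\ P b) ->
  rsum (fun b => / IZR b ^ 2) l <= 2 * S.
Proof.
intros HS HP l Hn Hl.
set (g := fun b => (0 <? b)%Z).
assert (Hp := permutation_filter g l).
assert (Hpart : forall h, (forall x y, In x (filter h l) -> In y (filter h l) ->
    Z.abs_nat x = Z.abs_nat y -> x = y) -> rsum (fun b => / IZR b ^ 2) (filter h l) <= S).
{ intros h Hh.
  eapply Rle_trans; [| apply (HS (map Z.abs_nat (filter h l)))].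
  - rewrite rsum_map; apply rsum_le; intros b _; apply Req_le; f_equal.
    rewrite INR_IZR_INZ, Zabs2Nat.id_abs, abs_IZR, pow2_abs; reflexivity.
  - apply NoDup_map_NoDup_ForallPairs; [exact Hh | now apply NoDup_filter].
  - intros n Hin; apply in_map_iff in Hin; destruct Hin as [b [<- Hb]].
    apply filter_In in Hb; destruct (Hl b (proj1 Hb)) as [H0 H1].
    split; [lia |]. rewrite Zabs2Nat.id_abs.
    destruct (Z.abs_eq_or_opp b) as [-> | ->]; auto. }
rewrite (rsum_perm _ _ _ Hp), rsum_app.
assert (A1 : rsum (fun b => / IZR b ^ 2) (filter g l) <= S).
{ apply Hpart; intros x y Hx Hy; apply filter_In in Hx, Hy; unfold g in *.
  destruct Hx as [_ Hx], Hy as [_ Hy]; apply Z.ltb_lt in Hx, Hy; lia. }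
assert (A2 : rsum (fun b => / IZR b ^ 2) (filter (fun b => negb (g b)) l) <= S).
{ apply Hpart; intros x y Hx Hy; apply filter_In in Hx, Hy; unfold g in *.
  destruct Hx as [_ Hx], Hy as [_ Hy].
  destruct (Z.ltb_spec 0 x), (Z.ltb_spec 0 y); simpl in *; try discriminate; lia. }
lra.
Qed.

Lemma inv_sq_sum_Z (l : list Z) : NoDup l -> (forall b, In b l -> b <> 0%Z) ->
  rsum (fun b => / IZR b ^ 2) l <= 10 / 3.
Proof.
intros Hn Hl; replace (10 / 3) with (2 * (5 / 3)) by lra.
apply inv_sq_sum_sign with (P := fun _ => True); auto.
intros m Hm H; apply inv_sq_sum_nat; auto; intros n Hi; now apply H.
Qed.

Lemma inv_sq_sum_odd (l : list Z) : NoDup l -> (forall b, In b l -> Z.Odd b) ->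
  rsum (fun b => / IZR b ^ 2) l <= 5 / 2.
Proof.
intros Hn Hl; replace (5 / 2) with (2 * (5 / 4)) by lra.
apply inv_sq_sum_sign with (P := Z.Odd); auto.
- intros m Hm H; apply inv_sq_sum_nat_odd; auto; intros n Hi.
  destruct (H n Hi) as [_ [j Hj]]; exists (Z.to_nat j); lia.
- intros b [j ->]; exists (- j - 1)%Z; lia.
- intros b Hb; split; auto; destruct (Hl b Hb); lia.
Qed.

Lemma inv_sq_sum_even (l : list Z) : NoDup l -> (forall b, In b l -> Z.Even b /\ b <> 0%Z) ->
  rsum (fun b => / IZR b ^ 2) l <= 5 / 6.
Proof.
intros Hn Hl.
assert (H : rsum (fun b => / IZR b ^ 2) (map (fun b => b / 2)%Z l) <= 10 / 3).
{ apply inv_sq_sum_Z.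
  - apply NoDup_map_NoDup_ForallPairs; auto; intros x y Hx Hy.
    destruct (Hl x Hx) as [[i ->] _], (Hl y Hy) as [[j ->] _].
    rewrite !(Z.mul_comm 2), !Z.div_mul by lia; lia.
  - intros c Hc; apply in_map_iff in Hc; destruct Hc as [x [<- Hx]].
    destruct (Hl x Hx) as [[i ->] Hi]; rewrite (Z.mul_comm 2), Z.div_mul; lia. }
rewrite rsum_map in H.
assert (E : rsum (fun b => / IZR b ^ 2) l <= rsum (fun b => / 4 * / IZR (b / 2) ^ 2) l).
{ apply rsum_le; intros x Hx; destruct (Hl x Hx) as [[i ->] Hi].
  rewrite (Z.mul_comm 2), Z.div_mul, mult_IZR by lia.
  assert (IZR i <> 0) by (apply not_0_IZR; lia). apply Req_le; field; auto. }
rewrite rsum_scal in E; lra.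
Qed.

Lemma NoDup_list_prod {T U : Type} (l1 : list T) (l2 : list U) :
  NoDup l1 -> NoDup l2 -> NoDup (list_prod l1 l2).
Proof.
intros H1 H2; induction H1 as [|a l Ha Hn IH]; [constructor |].
change (NoDup (map (fun y => (a, y)) l2 ++ list_prod l l2)).
apply NoDup_app; auto.
- apply FinFun.Injective_map_NoDup; auto; intros x y E; now injection E.
- intros [x y] Hx Hy; apply in_map_iff in Hx; destruct Hx as [y' [E _]].
  apply in_prod_iff in Hy; injection E as -> ->; tauto.
Qed.

Lemma rsum_list_prod (p q : Z -> R) l1 l2 :
  rsum (fun u => p (fst u) * q (snd u)) (list_prod l1 l2) = rsum p l1 * rsum q l2.
Proof.
induction l1 as [|a l IH]; [unfold rsum; simpl; ring |].
change (list_prod (a :: l) l2) with (map (fun y => (a, y)) l2 ++ list_prod l l2).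
rewrite rsum_app, IH, rsum_map; simpl.
rewrite rsum_scal; unfold rsum; simpl; ring.
Qed.

(** A finite set of pairs lies in the product of its two projections, over which the sum factors. *)
Lemma rsum_prod_le (P Q : Z -> Prop) (p q : Z -> R) (SA SB : R) :
  (forall b, P b -> 0 <= p b) -> (forall b, Q b -> 0 <= q b) ->
  (forall l, NoDup l -> (forall b, In b l -> P b) -> rsum p l <= SA) ->
  (forall l, NoDup l -> (forall b, In b l -> Q b) -> rsum q l <= SB) ->
  forall l : list (Z * Z), NoDup l -> (forall u, In u l -> P (fst u) /\ Q (snd u)) ->
  rsum (fun u => p (fst u) * q (snd u)) l <= SA * SB.
Proof.
intros Hp Hq HA HB l Hn Hl.
set (l1 := nodup Z.eq_dec (map fst l)); set (l2 := nodup Z.eq_dec (map snd l)).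
assert (I1 : forall b, In b l1 -> P b).
{ intros b Hb; apply nodup_In, in_map_iff in Hb; destruct Hb as [u [<- Hu]]; now apply Hl. }
assert (I2 : forall b, In b l2 -> Q b).
{ intros b Hb; apply nodup_In, in_map_iff in Hb; destruct Hb as [u [<- Hu]]; now apply Hl. }
eapply Rle_trans; [apply rsum_incl with (l' := list_prod l1 l2) |]; auto.
- apply NoDup_list_prod; apply NoDup_nodup.
- intros [a b] Hu; apply in_prod; apply nodup_In, in_map_iff; exists (a, b); auto.
- intros [a b] Hu; apply in_prod_iff in Hu; simpl; apply Rmult_le_pos; intuition.
- rewrite rsum_list_prod.
  apply Rmult_le_compat.
  + apply rsum_ge0; auto.
  + apply rsum_ge0; auto.
  + apply HA; auto; apply NoDup_nodup.
  + apply HB; auto; apply NoDup_nodup.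
Qed.

Lemma rsum_le_split {T : Type} (w : T -> R) (l0 : list T) (W : R) (l : list T) :
  NoDup l0 -> NoDup l -> (forall x, In x l0 -> 0 <= w x) ->
  (forall r, NoDup r -> (forall x, In x r -> In x l /\ ~ In x l0) -> rsum w r <= W) ->
  rsum w l <= rsum w l0 + W.
Proof.
intros N0 Hn Hw HW.
set (g := fun x => if in_dec eq_dec_classic x l0 then true else false).
assert (Hp := permutation_filter g l).
rewrite (rsum_perm _ _ _ Hp), rsum_app; apply Rplus_le_compat.
- apply rsum_incl; auto using NoDup_filter.
  intros x Hx; apply filter_In in Hx; unfold g in Hx.
  destruct (in_dec _ x l0); intuition congruence.
- apply HW; auto using NoDup_filter.
  intros x Hx; apply filter_In in Hx; unfold g in Hx.
  destruct (in_dec _ x l0); simpl in Hx; intuition congruence.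
Qed.

(** * The series as a sum over pairs of rows *)

Lemma Cmod2_lin (z : C) (c d : R) :
  Cmod (RtoC c * z + RtoC d) ^ 2 = c ^ 2 * Cmod z ^ 2 + 2 * c * d * Re z + d ^ 2.
Proof.
rewrite !Cmod2_alt; destruct z as [x y]; simpl; ring.
Qed.

Lemma Cmod2_lin_ge (z : C) : 0 < Im z -> exists delta, 0 < delta /\
  forall c d : R, delta * (c ^ 2 + d ^ 2) <= Cmod (RtoC c * z + RtoC d) ^ 2.
Proof.
intros Hy.
assert (HR := Cmod2_alt z).
set (r := Cmod z ^ 2) in *; set (x := Re z) in *; set (y := Im z) in *.
assert (Hr : 0 < 1 + r) by nra.
(* Determinant over trace of the form with matrix M = ((r, x), (x, 1)), a lower bound for its least
   eigenvalue. By Cayley-Hamilton the defect is the squared norm of M (c, d), the sum of squares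
   used at the end. *)
exists (y ^ 2 / (1 + r)); split.
{ apply Rdiv_lt_0_compat; nra. }
intros c d; rewrite Cmod2_lin; fold r x.
apply Rmult_le_reg_l with (1 + r); [lra |].
replace ((1 + r) * (y ^ 2 / (1 + r) * (c ^ 2 + d ^ 2))) with (y ^ 2 * (c ^ 2 + d ^ 2))
  by (field; lra).
replace ((1 + r) * (c ^ 2 * r + 2 * c * d * x + d ^ 2)) with
  (y ^ 2 * (c ^ 2 + d ^ 2) + ((c * r + d * x) ^ 2 + (c * x + d) ^ 2)) by (rewrite HR; ring).
assert (0 <= (c * r + d * x) ^ 2 + (c * x + d) ^ 2)
  by (apply Rplus_le_le_0_compat; apply pow2_ge_0).
lra.
Qed.

Definition coprime_pair (u : Z * Z) : Prop := Z.gcd (fst u) (snd u) = 1%Z.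

Definition eis_term (k : nat) (z : C) (u : Z * Z) : C :=
  (/ (RtoC (IZR (fst u)) * z + RtoC (IZR (snd u))) ^ k)%C.

Lemma coprime_pair_on_axis (u : Z * Z) : coprime_pair u -> fst u = 0%Z \/ snd u = 0%Z ->
  In u ((0, 1) :: (0, -1) :: (1, 0) :: (-1, 0) :: nil)%Z.
Proof.
destruct u as [c d]; unfold coprime_pair; simpl; intros Hg [-> | ->].
- rewrite Z.gcd_0_l in Hg; assert (d = 1 \/ d = -1)%Z as [-> | ->] by lia; auto.
- rewrite Z.gcd_0_r in Hg; assert (c = 1 \/ c = -1)%Z as [-> | ->] by lia; auto.
Qed.

Lemma Cpow2_R_neq0 (p : nat) : (RtoC 2 ^ p)%C <> 0.
Proof. apply Cpow_nz; intros E; injection E; lra. Qed.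

Lemma lin_neq0 (z : C) (c d : R) : 0 < Im z -> c <> 0 \/ d <> 0 ->
  (RtoC c * z + RtoC d)%C <> 0.
Proof.
intros Hy Hcd E.
assert (E1 := f_equal Im E); assert (E2 := f_equal Re E); destruct z as [x y]; simpl in *.
assert (c * y = 0) by lra.
destruct (Rmult_integral _ _ H) as [-> | ->]; [|lra].
destruct Hcd; lra.
Qed.

(** Since c^2 + d^2 >= 1 on coprime pairs, the exponent p can be lowered to 2, which gives the same
    majorant in every weight up to a constant. *)
Lemma eis_term_inv_le (p : nat) (z : C) (delta : R) (u : Z * Z) :
  (2 <= p)%nat -> 0 < Im z -> 0 < delta -> coprime_pair u ->
  (forall c d : R, delta * (c ^ 2 + d ^ 2) <= Cmod (RtoC c * z + RtoC d) ^ 2) ->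
  Cmod (eis_term (2 * p) z u) <= / delta ^ p * / (IZR (fst u) ^ 2 + IZR (snd u) ^ 2) ^ 2.
Proof.
intros Hp Hy Hd Hu Hdel; unfold eis_term.
set (c := IZR (fst u)); set (d := IZR (snd u)).
assert (Hcd : 1 <= c ^ 2 + d ^ 2).
{ unfold c, d; rewrite !(pow_IZR _ 2), <- plus_IZR; apply IZR_le.
  destruct u as [a b]; unfold coprime_pair in Hu; simpl in *.
  destruct (Z.eq_dec a 0) as [-> | Ha]; [|nia].
  destruct (Z.eq_dec b 0) as [-> | Hb]; [discriminate | nia]. }
assert (Hnz : (RtoC c * z + RtoC d)%C <> 0).
{ apply lin_neq0; auto.
  destruct (Req_dec c 0) as [Hc|]; auto; right; intros Hd0; rewrite Hc, Hd0 in Hcd; lra. }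
rewrite Cmod_inv, Cmod_pow, pow_mult by now apply Cpow_nz.
assert (H := Hdel c d).
assert (Hpos : 0 < delta * (c ^ 2 + d ^ 2)) by nra.
rewrite <- Rinv_mult; apply Rinv_le_contravar.
- apply Rmult_lt_0_compat; apply pow_lt; lra.
- eapply Rle_trans; [| apply pow_incr with (n := p); split; [left; exact Hpos | exact H]].
  rewrite Rpow_mult_distr; apply Rmult_le_compat_l; [apply pow_le; lra |].
  now apply Rle_pow.
Qed.

(** Off the axes (c^2 + d^2)^2 >= c^2 d^2, so the majorant splits into a product of two sums of
    inverse squares; the at most four coprime pairs on the axes are set apart. *)
Lemma eis_summable (p : nat) (z : C) (D : Z * Z -> Prop) :
  (2 <= p)%nat -> 0 < Im z -> (forall u, D u -> coprime_pair u) ->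
  exists s, is_sum_over D (eis_term (2 * p) z) s.
Proof.
intros Hp Hy HD.
destruct (Cmod2_lin_ge z Hy) as [delta [Hd Hdel]].
assert (Hdp : 0 < / delta ^ p) by now apply Rinv_0_lt_compat, pow_lt.
set (l0 := ((0, 1) :: (0, -1) :: (1, 0) :: (-1, 0) :: nil)%Z).
set (w := fun u => Cmod (eis_term (2 * p) z u)).
apply is_sum_over_summable with (rsum w l0 + / delta ^ p * (10 / 3 * (10 / 3))).
intros l Hn Dl; fold w; rewrite Forall_forall in Dl.
apply rsum_le_split; auto.
- repeat constructor; simpl; intuition congruence.
- intros x _; apply Cmod_ge_0.
- intros r Nr Hr.
  assert (Hr0 : forall u, In u r -> fst u <> 0%Z /\ snd u <> 0%Z).
  { intros u Hu; destruct (Hr u Hu) as [H1 H2].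
    split; intros E; apply H2, coprime_pair_on_axis; auto. }
  eapply Rle_trans; [apply rsum_le with
    (g := fun u => / delta ^ p * (/ IZR (fst u) ^ 2 * / IZR (snd u) ^ 2)) |].
  + intros u Hu; eapply Rle_trans;
      [apply eis_term_inv_le with (delta := delta); auto; apply HD, Dl, Hr, Hu |].
    apply Rmult_le_compat_l; [lra |]; rewrite <- Rinv_mult.
    destruct (Hr0 u Hu) as [Ha Hb]; apply not_0_IZR in Ha, Hb.
    assert (0 < IZR (fst u) ^ 2) by now apply pow2_gt_0.
    assert (0 < IZR (snd u) ^ 2) by now apply pow2_gt_0.
    apply Rinv_le_contravar; nra.
  + rewrite rsum_scal; apply Rmult_le_compat_l; [lra |].
    apply (rsum_prod_le (fun b => b <> 0%Z) (fun b => b <> 0%Z)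
      (fun b => / IZR b ^ 2) (fun b => / IZR b ^ 2)); auto using inv_sq_sum_Z.
    * intros b Hb; apply not_0_IZR in Hb; left; now apply Rinv_0_lt_compat, pow2_gt_0.
    * intros b Hb; apply not_0_IZR in Hb; left; now apply Rinv_0_lt_compat, pow2_gt_0.
Qed.

(* The rows [(2 b, d)] with [(b, d)] in [OddRight] are the coprime rows with even first entry;
   those with odd first entry form [OddLeft]. With the terms below, [Estar2 (2 p) z] is half the
   sum of both families. *)
Definition OddRight (u : Z * Z) : Prop := coprime_pair u /\ Z.Odd (snd u).
Definition OddLeft (u : Z * Z) : Prop := coprime_pair u /\ Z.Odd (fst u).

Definition even_row_term (p : nat) (z : C) (u : Z * Z) : C :=
  (/ (RtoC (2 * IZR (fst u)) * z + RtoC (IZR (snd u))) ^ (2 * p))%C.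
Definition odd_row_term (p : nat) (z : C) (u : Z * Z) : C :=
  (/ (RtoC 2 ^ p * (RtoC (IZR (fst u)) * z + RtoC (IZR (snd u))) ^ (2 * p)))%C.

Lemma gcd_double_l (b d : Z) : Z.Odd d -> Z.gcd (2 * b) d = Z.gcd b d.
Proof.
intros Hd.
assert (H2 : Z.gcd 2 d = 1%Z).
{ destruct Hd as [m ->]; apply Z.bezout_1_gcd; exists (- m)%Z, 1%Z; lia. }
apply Z.divide_antisym_nonneg; try apply Z.gcd_nonneg.
- apply Z.gcd_greatest; [|apply Z.gcd_divide_r].
  apply Z.gauss with 2%Z; [apply Z.gcd_divide_l |].
  apply Z.divide_1_r_nonneg; [apply Z.gcd_nonneg |].
  rewrite <- H2; apply Z.gcd_greatest; [apply Z.gcd_divide_r |].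
  eapply Z.divide_trans; [apply Z.gcd_divide_l | apply Z.gcd_divide_r].
- apply Z.gcd_greatest; [|apply Z.gcd_divide_r].
  apply Z.divide_mul_r, Z.gcd_divide_l.
Qed.

Lemma gcd_double_r (c d : Z) : Z.Odd c -> Z.gcd c (2 * d) = Z.gcd c d.
Proof. intros Hc; now rewrite Z.gcd_comm, gcd_double_l, Z.gcd_comm. Qed.

Lemma even_or_odd_coprime_pair (u : Z * Z) : coprime_pair u ->
  (Z.Even (fst u) -> Z.Odd (snd u)) /\ (Z.Even (snd u) -> Z.Odd (fst u)).
Proof.
destruct u as [c d]; unfold coprime_pair; simpl; intros Hg.
assert (~ (Z.Even c /\ Z.Even d)).
{ intros [[i ->] [j ->]]; rewrite Z.gcd_mul_mono_l in Hg; simpl Z.abs in Hg; lia. }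
assert (Hc := Z.Even_or_Odd c); assert (Hd := Z.Even_or_Odd d); tauto.
Qed.

Lemma half_even (d : Z) : Z.Even d -> (2 * (d / 2) = d)%Z.
Proof. intros [m ->]; rewrite (Z.mul_comm 2 m), Z.div_mul; lia. Qed.

(** Let s1 and so be the sums of (c z + d)^(-2p) over coprime rows with c even and with c odd. Then
    2 E(z) = s1 + so. In E(2 z) the rows with d odd give s1 again, and those with d even are twice a
    row with odd first entry, so 2 E(2 z) = s1 + 2^(-2p) so. In 2^p E(2 z) + E(z) the factor 2^p + 1
    comes out and leaves (s1 + 2^(-p) so) / 2. *)
Lemma Estar2_sums (p : nat) (z : C) : (2 <= p)%nat -> 0 < Im z ->
  exists s1 s2, is_sum_over OddRight (even_row_term p z) s1 /\ is_sum_over OddLeft (odd_row_term p z) s2 /\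
    Estar2 (2 * p) z = (/ 2 * (s1 + s2))%C.
Proof.
intros Hp Hy.
destruct (eis_summable p z (fun u => coprime_pair u /\ Z.Even (fst u))) as [s1 H1]; auto;
  [tauto |].
destruct (eis_summable p z OddLeft) as [so Ho]; auto; [unfold OddLeft; tauto |].
assert (N2 := Cpow2_R_neq0 p).
assert (Hs1 : is_sum_over OddRight (even_row_term p z) s1).
{ apply is_sum_over_ext with
    (f := fun u => eis_term (2 * p) z ((fun u => (2 * fst u, snd u)%Z) u)).
  { intros u _; unfold eis_term, even_row_term; cbn beta iota delta [fst snd]; now rewrite (mult_IZR 2). }
  apply (is_sum_over_bij OddRight (fun u => coprime_pair u /\ Z.Even (fst u))
    (fun u => (2 * fst u, snd u)%Z) (fun u => (fst u / 2, snd u)%Z)); [| | exact H1].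
  - intros [b d] [Hg Hd]; unfold coprime_pair in *; cbn [fst snd] in *.
    rewrite gcd_double_l, (Z.mul_comm 2 b), Z.div_mul by (auto; lia).
    repeat split; auto; exists b; lia.
  - intros [c d] [Hg He]; cbn [fst snd] in *.
    assert (Hd := proj1 (even_or_odd_coprime_pair _ Hg) He); cbn [fst snd] in Hd.
    apply half_even in He; rewrite He; unfold OddRight, coprime_pair in *; cbn [fst snd] in *.
    repeat split; auto; rewrite <- (gcd_double_l (c / 2)), He; auto. }
assert (Hs2 : is_sum_over OddLeft (odd_row_term p z) (/ RtoC 2 ^ p * so)%C).
{ apply is_sum_over_ext with (f := fun u => (/ RtoC 2 ^ p * eis_term (2 * p) z u)%C).
  { intros u [Hg [m Hm]]; unfold odd_row_term, eis_term; field; split; auto.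
    apply Cpow_nz, lin_neq0; auto; left; apply not_0_IZR; lia. }
  now apply is_sum_over_scal. }
exists s1, (/ RtoC 2 ^ p * so)%C; split; [exact Hs1 | split; [exact Hs2 |]].
assert (Hz : Eisenstein (2 * p) z = (/ 2 * (s1 + so))%C).
{ unfold Eisenstein; rewrite (is_sum_over_unique _ _ (s1 + so)%C); auto.
  apply (is_sum_over_union _ (fun u => coprime_pair u /\ Z.Even (fst u)) OddLeft); auto.
  - intros u; unfold OddLeft; change (coprime_pair u <-> (coprime_pair u /\ Z.Even (fst u) \/ coprime_pair u /\ Z.Odd (fst u))).
    destruct (Z.Even_or_Odd (fst u)); tauto.
  - intros u [_ He] [_ Hd]; now apply (Z.Even_Odd_False (fst u)). }
assert (H2z : Eisenstein (2 * p) (RtoC 2 * z) = (/ 2 * (s1 + / RtoC 2 ^ (2 * p) * so))%C).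
{ unfold Eisenstein; rewrite (is_sum_over_unique _ _ (s1 + / RtoC 2 ^ (2 * p) * so)%C); auto.
  apply (is_sum_over_union _ OddRight (fun u => coprime_pair u /\ Z.Even (snd u))); auto.
  - intros u; unfold OddRight; change (coprime_pair u <-> (coprime_pair u /\ Z.Odd (snd u) \/ coprime_pair u /\ Z.Even (snd u))).
    destruct (Z.Even_or_Odd (snd u)); tauto.
  - intros u [_ Hd] [_ He]; now apply (Z.Even_Odd_False (snd u)).
  - eapply is_sum_over_ext; [| exact Hs1].
    intros u _; unfold even_row_term; rewrite RtoC_mult; do 2 f_equal; ring.
  - apply is_sum_over_ext with (f := fun u => (/ RtoC 2 ^ (2 * p) *
       eis_term (2 * p) z ((fun u => (fst u, snd u / 2)%Z) u))%C).
    + intros [c d] [Hg He]; unfold eis_term; cbn [fst snd].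
      assert (Hc := proj2 (even_or_odd_coprime_pair _ Hg) He); cbn [fst snd] in *.
      assert (Hd2 : IZR d = 2 * IZR (d / 2))
        by (rewrite <- mult_IZR, (half_even d He); reflexivity).
      set (e := IZR (d / 2)) in *; rewrite Hd2, RtoC_mult.
      replace (RtoC (IZR c) * (RtoC 2 * z) + RtoC 2 * RtoC e)%C
        with (RtoC 2 * (RtoC (IZR c) * z + RtoC e))%C by ring.
      rewrite Cpow_mult_l; field; split; [| apply Cpow2_R_neq0].
      apply Cpow_nz, lin_neq0; auto; left; apply not_0_IZR; destruct Hc; lia.
    + apply is_sum_over_scal.
      apply (is_sum_over_bij _ OddLeft (fun u => (fst u, snd u / 2)%Z)
        (fun u => (fst u, 2 * snd u)%Z)); [| | exact Ho].
      * intros [c d] [Hg He]; cbn [fst snd] in *.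
        assert (Hc := proj2 (even_or_odd_coprime_pair _ Hg) He); cbn [fst snd] in Hc.
        apply half_even in He; rewrite He; unfold OddLeft, coprime_pair in *; cbn [fst snd] in *.
        repeat split; auto; rewrite <- (gcd_double_r c (d / 2)), He; auto.
      * intros [c d] [Hg Hc]; unfold coprime_pair in *; cbn [fst snd] in *.
        rewrite gcd_double_r, (Z.mul_comm 2 d), Z.div_mul by (auto; lia).
        repeat split; auto; exists d; lia. }
unfold Estar2; rewrite Hz, H2z.
replace (2 * p / 2)%nat with p by (rewrite Nat.mul_comm, Nat.div_mul; lia).
replace (RtoC 2 ^ (2 * p))%C with (RtoC 2 ^ p * RtoC 2 ^ p)%C
  by (rewrite <- Cpow_add_r; f_equal; lia).
field.
repeat split; auto.
rewrite <- RtoC_pow, <- RtoC_plus; intros E; injection E.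
assert (0 < 2 ^ p) by (apply pow_lt; lra); lra.
Qed.

(** * Points far from the circle *)

Definition swap (u : Z * Z) : Z * Z := (snd u, fst u).

Lemma coprime_pair_swap (u : Z * Z) : coprime_pair u -> coprime_pair (swap u).
Proof. exact (eq_trans (Z.gcd_comm _ _)). Qed.

Lemma swap_sum (p : nat) (z : C) (s1 s2 : C) :
  is_sum_over OddRight (even_row_term p z) s1 -> is_sum_over OddLeft (odd_row_term p z) s2 ->
  is_sum_over OddRight (fun u => even_row_term p z u + odd_row_term p z (swap u))%C (s1 + s2)%C.
Proof.
intros H1 H2; apply is_sum_over_plus; auto.
apply (is_sum_over_bij _ OddLeft swap swap); auto.
all: intros [a b] [Hg Ho]; repeat split; auto; now apply coprime_pair_swap.
Qed.

Definition axis_pairs : list (Z * Z) := ((0, 1) :: (0, -1) :: nil)%Z.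
Definition unit_pairs : list (Z * Z) := ((1, 1) :: (-1, -1) :: (1, -1) :: (-1, 1) :: nil)%Z.

Lemma OddRight_axis (u : Z * Z) : OddRight u -> fst u = 0%Z -> In u axis_pairs.
Proof.
intros [Hg Ho] H0; destruct u as [b d]; unfold coprime_pair in Hg; simpl in *; subst b.
rewrite Z.gcd_0_l in Hg; assert (d = 1 \/ d = -1)%Z as [-> | ->] by lia; auto.
Qed.

Lemma NoDup_small : NoDup (axis_pairs ++ unit_pairs).
Proof. repeat constructor; simpl; intuition congruence. Qed.

Lemma OddRight_small : Forall OddRight (axis_pairs ++ unit_pairs).
Proof.
repeat constructor; try reflexivity; first [now exists 0%Z | now exists (-1)%Z].
Qed.

Definition invsq (u : Z * Z) : R := / IZR (fst u) ^ 2 * / IZR (snd u) ^ 2.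

Lemma invsq_ge0 u : fst u <> 0%Z -> snd u <> 0%Z -> 0 <= invsq u.
Proof.
intros Ha Hb; apply not_0_IZR in Ha, Hb; unfold invsq.
apply Rmult_le_pos; left; now apply Rinv_0_lt_compat, pow2_gt_0.
Qed.

Lemma Odd_neq0 d : Z.Odd d -> d <> 0%Z.
Proof. intros [m Hm]; lia. Qed.

(** The four pairs (+-1, +-1) are put back before the product bound is used and their contribution 4
    is then removed: 10/3 * 5/2 - 4 = 13/3. *)
Lemma rest_sum (l : list (Z * Z)) : NoDup l ->
  Forall (fun u => OddRight u /\ ~ In u (axis_pairs ++ unit_pairs)) l -> rsum invsq l <= 13 / 3.
Proof.
intros Hn Hl; rewrite Forall_forall in Hl.
assert (H : rsum invsq (unit_pairs ++ l) <= 10 / 3 * (5 / 2)).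
{ apply (rsum_prod_le (fun b => b <> 0%Z) Z.Odd (fun b => / IZR b ^ 2) (fun b => / IZR b ^ 2)).
  - intros b Hb; apply not_0_IZR in Hb; left; now apply Rinv_0_lt_compat, pow2_gt_0.
  - intros b Hb; apply Odd_neq0, not_0_IZR in Hb; left; now apply Rinv_0_lt_compat, pow2_gt_0.
  - apply inv_sq_sum_Z.
  - apply inv_sq_sum_odd.
  - assert (N := NoDup_small); apply NoDup_app_remove_l in N.
    apply NoDup_app; auto; intros u Hu Hu'; apply (Hl u Hu'), in_app_iff; auto.
  - intros u Hu; apply in_app_iff in Hu; destruct Hu as [Hu | Hu].
    + assert (S := OddRight_small); rewrite Forall_forall in S.
      split; [|apply S, in_app_iff; auto].
      intros E; simpl in Hu; intuition subst; discriminate.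
    + destruct (Hl u Hu) as [HG Hs]; split; [|apply HG].
      intros E; apply Hs, in_app_iff; left; now apply OddRight_axis. }
rewrite rsum_app in H.
assert (E : rsum invsq unit_pairs = 4) by (unfold rsum, invsq; simpl; field).
lra.
Qed.

Lemma rest_nonzero (u : Z * Z) : OddRight u -> ~ In u (axis_pairs ++ unit_pairs) ->
  fst u <> 0%Z /\ snd u <> 0%Z.
Proof.
intros HG Hs; split; [|now apply Odd_neq0, HG].
intros E; apply Hs, in_app_iff; left; now apply OddRight_axis.
Qed.

Lemma Re_ge_Cmod (c : C) : - Cmod c <= Re c.
Proof. assert (H := re_le_Cmod c); apply Rabs_le_between in H; lra. Qed.

Lemma Rinv_pow_le (x y : R) (p : nat) : 0 < y -> y <= x -> / x ^ p <= / y ^ p.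
Proof.
intros H1 H2; apply Rinv_le_contravar; [now apply pow_lt | apply pow_incr; lra].
Qed.

Lemma Cmod_even_row_term (p : nat) (z : C) (u : Z * Z) : 0 < Im z -> fst u <> 0%Z \/ snd u <> 0%Z ->
  Cmod (even_row_term p z u) = / (Cmod (RtoC (2 * IZR (fst u)) * z + RtoC (IZR (snd u))) ^ 2) ^ p.
Proof.
intros Hy Hu; unfold even_row_term.
rewrite Cmod_inv, Cmod_pow, pow_mult; auto.
apply Cpow_nz, lin_neq0; auto.
destruct Hu as [Hu|Hu]; [left | right]; apply not_0_IZR in Hu; auto; lra.
Qed.

Lemma Cmod_odd_row_term (p : nat) (z : C) (u : Z * Z) : 0 < Im z -> fst u <> 0%Z \/ snd u <> 0%Z ->
  Cmod (odd_row_term p z u) = / (2 * Cmod (RtoC (IZR (fst u)) * z + RtoC (IZR (snd u))) ^ 2) ^ p.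
Proof.
intros Hy Hu; unfold odd_row_term.
rewrite Cmod_inv, Cmod_mult, !Cmod_pow, pow_mult, Rpow_mult_distr.
- do 2 f_equal; rewrite Cmod_R, Rabs_pos_eq; lra.
- apply Cmult_neq_0; [apply Cpow2_R_neq0 |].
  apply Cpow_nz, lin_neq0; auto.
  destruct Hu as [Hu|Hu]; [left | right]; apply not_0_IZR in Hu; auto; lra.
Qed.

Lemma far_nonzero (p : nat) (z : C) (s1 s2 : C) :
  0 < Im z -> -1/2 <= Re z <= 1/2 ->
  (p = 2%nat /\ 2 <= Cmod z ^ 2) \/ ((3 <= p)%nat /\ 1 <= Cmod z ^ 2) ->
  is_sum_over OddRight (even_row_term p z) s1 -> is_sum_over OddLeft (odd_row_term p z) s2 ->
  (s1 + s2)%C <> 0.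
Proof.
intros Hy Hx Hp H1 H2 E.
assert (Hs := swap_sum p z s1 s2 H1 H2).
set (r := Cmod z ^ 2) in *; set (x := Re z) in *.
(* [L] |b d| bounds both squared row moduli below (arithmetic-geometric mean, minus 2 |b d| for the
   cross term). Then [c1] bounds the loss from each pair with |b d| = 1, [c2] the loss relative to 1
   / (b d)^2 from the others, and [Y] the loss from both axis pairs, whose main terms add up to
   2. *)
assert (HB : exists L c1 c2 Y : R, 0 < L /\ 1 <= L /\ 2 * / (2 * r) ^ p <= Y /\
   2 * / L ^ p <= c1 /\
   (forall t, 1 < t -> (exists n, t = IZR n) -> 2 * / (L * t) ^ p <= c2 * / t ^ 2) /\
   4 * c1 + c2 * (13 / 3) + Y < 2 /\ 0 <= c2 /\
   (forall b d : R, L * Rabs (b * d) <= 4 * b ^ 2 * r + 4 * b * d * x + d ^ 2) /\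
   (forall b d : R, L * Rabs (b * d) <= 2 * (d ^ 2 * r + 2 * d * b * x + b ^ 2))).
{ assert (Hq : forall b d, Rabs (4 * b * d * x) <= 2 * Rabs (b * d)).
  { intros b d; replace (4 * b * d * x) with (4 * x * (b * d)) by ring.
    rewrite Rabs_mult; apply Rmult_le_compat_r; [apply Rabs_pos |].
    apply Rabs_le; lra. }
  destruct Hp as [[-> Hr] | [Hp Hr]].
  - exists (7/2), (8/49), (8/49), (1/8).
    split; [lra|]; split; [lra|]; split; [|split; [|split; [|split; [|split; [|split]]]]].
    + assert (/ (2 * r) ^ 2 <= / 4 ^ 2) by (apply Rinv_pow_le; lra). lra.
    + lra.
    + intros t Ht _; right; field; lra.
    + lra.
    + lra.
    + intros b d; assert (A := Hq b d); apply Rabs_le_between in A.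
      assert (11/2 * Rabs (b * d) <= 8 * b ^ 2 + d ^ 2); [|nra].
      rewrite Rabs_mult, <- (pow2_abs b), <- (pow2_abs d).
      assert (B1 := Rabs_pos b); assert (B2 := Rabs_pos d).
      assert (B3 := pow2_ge_0 (28/10 * Rabs b - Rabs d)). nra.
    + intros b d; assert (A := Hq b d); apply Rabs_le_between in A.
      assert (11/2 * Rabs (b * d) <= 4 * d ^ 2 + 2 * b ^ 2); [|nra].
      rewrite Rabs_mult, <- (pow2_abs b), <- (pow2_abs d).
      assert (B1 := Rabs_pos b); assert (B2 := Rabs_pos d).
      assert (B3 := pow2_ge_0 (1414/1000 * Rabs b - 2 * Rabs d)). nra.
  - exists 2, (1/4), (1/8), (1/4).
    assert (H8 : 8 <= 2 ^ p).
    { replace 8 with (2 ^ 3) by ring; apply Rle_pow; [lra | lia]. }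
    split; [lra|]; split; [lra|]; split; [|split; [|split; [|split; [|split; [|split]]]]].
    + assert (/ (2 * r) ^ p <= / 2 ^ p) by (apply Rinv_pow_le; lra).
      assert (/ 2 ^ p <= / 8) by (apply Rinv_le_contravar; lra). lra.
    + assert (/ 2 ^ p <= / 8) by (apply Rinv_le_contravar; lra). lra.
    (* Here t = |b d| is an integer above 1, hence at least 2; this turns the cube available for p
       >= 3 into a square with an extra factor 1/2. *)
    + intros t Ht [n Hn].
      assert (Ht2 : 2 <= t).
      { rewrite Hn; apply IZR_le; rewrite Hn in Ht; apply lt_IZR in Ht; lia. }
      assert (A : 8 * t ^ 3 <= (2 * t) ^ p).
      { replace (8 * t ^ 3) with ((2 * t) ^ 3) by ring; apply Rle_pow; [lra | lia]. }
      assert (B1 : / (2 * t) ^ p <= / (8 * t ^ 3)).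
      { apply Rinv_le_contravar; auto; assert (0 < t ^ 3) by (apply pow_lt; lra); lra. }
      assert (B2 : / (8 * t ^ 3) <= / (16 * t ^ 2)).
      { apply Rinv_le_contravar; nra. }
      replace (1 / 8 * / t ^ 2) with (2 * / (16 * t ^ 2)) by (field; lra). lra.
    + lra.
    + lra.
    + intros b d; assert (A := Hq b d); apply Rabs_le_between in A.
      assert (4 * Rabs (b * d) <= 4 * b ^ 2 + d ^ 2); [|nra].
      rewrite Rabs_mult, <- (pow2_abs b), <- (pow2_abs d).
      assert (B3 := pow2_ge_0 (2 * Rabs b - Rabs d)). nra.
    + intros b d; assert (A := Hq b d); apply Rabs_le_between in A.
      assert (4 * Rabs (b * d) <= 2 * d ^ 2 + 2 * b ^ 2); [|nra].
      rewrite Rabs_mult, <- (pow2_abs b), <- (pow2_abs d).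
      assert (B3 := pow2_ge_0 (Rabs b - Rabs d)). nra. }
destruct HB as [L [c1 [c2 [Y [HL0 [HL [HY [Hc1 [Hc2 [Htot [Hc20 [Q1 Q2]]]]]]]]]]]].
set (f := fun u => (even_row_term p z u + odd_row_term p z (swap u))%C) in *.
assert (Hf : forall u, fst u <> 0%Z -> snd u <> 0%Z ->
   - (2 * / (L * Rabs (IZR (fst u * snd u))) ^ p) <= Re (f u)).
{ intros [b d] Hb Hd; cbn [fst snd] in *.
  assert (Hbd : 1 <= Rabs (IZR (b * d))) by (rewrite <- abs_IZR; apply IZR_le; nia).
  rewrite mult_IZR in *.
  assert (A1 : Cmod (even_row_term p z (b, d)) <= / (L * Rabs (IZR b * IZR d)) ^ p).
  { rewrite Cmod_even_row_term by auto; cbn [fst snd].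
    apply Rinv_pow_le; [nra |]; rewrite Cmod2_lin; fold r x.
    assert (A := Q1 (IZR b) (IZR d)); nra. }
  assert (A2 : Cmod (odd_row_term p z (swap (b, d))) <= / (L * Rabs (IZR b * IZR d)) ^ p).
  { unfold swap; cbn [fst snd]; rewrite Cmod_odd_row_term by auto; cbn [fst snd].
    apply Rinv_pow_le; [nra |]; rewrite Cmod2_lin; fold r x.
    assert (A := Q2 (IZR b) (IZR d)); nra. }
  unfold f; rewrite re_plus.
  assert (B1 := Re_ge_Cmod (even_row_term p z (b, d))).
  assert (B2 := Re_ge_Cmod (odd_row_term p z (swap (b, d)))). lra. }
assert (HR := Re_sum_ge OddRight f (s1 + s2)%C (axis_pairs ++ unit_pairs) (fun u => c2 * invsq u)
   (c2 * (13/3)) Hs NoDup_small OddRight_small).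
rewrite E in HR; change (Re 0) with 0 in HR.
assert (HR' : rsum (fun u => Re (f u)) (axis_pairs ++ unit_pairs) - c2 * (13 / 3) <= 0).
{ apply HR.
  - intros u HG Hu; destruct (rest_nonzero u HG Hu) as [Hb Hd].
    eapply Rle_trans; [apply Ropp_le_contravar | apply (Hf u Hb Hd)].
    replace (invsq u) with (/ Rabs (IZR (fst u * snd u)) ^ 2).
    + apply Hc2.
      * rewrite <- abs_IZR; apply IZR_lt.
        destruct u as [b d]; cbn [fst snd] in *.
        assert (Z.abs (b * d) <> 1%Z); [|nia].
        intros Hab; apply Hu; unfold axis_pairs, unit_pairs; simpl.
        assert (b = 1 \/ b = -1)%Z as [-> | ->] by nia;
        assert (d = 1 \/ d = -1)%Z as [-> | ->] by nia; tauto.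
      * exists (Z.abs (fst u * snd u)); now rewrite abs_IZR.
    + unfold invsq; rewrite pow2_abs, mult_IZR, Rpow_mult_distr, Rinv_mult; auto.
  - intros l Hn Hl; rewrite rsum_scal; apply Rmult_le_compat_l; auto.
    now apply rest_sum. }
rewrite rsum_app in HR'.
assert (Hun : forall u, In u unit_pairs -> - c1 <= Re (f u)).
{ intros u Hu; apply Rle_trans with (- (2 * / (L * Rabs (IZR (fst u * snd u))) ^ p)).
  - replace (Rabs (IZR (fst u * snd u))) with 1; [rewrite Rmult_1_r; lra |].
    simpl in Hu; rewrite <- abs_IZR; intuition subst; reflexivity.
  - apply Hf; simpl in Hu; intuition subst; discriminate. }
assert (Hax : forall u, In u axis_pairs -> 1 - Y / 2 <= Re (f u)).
{ intros u Hu.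
  assert (Hu' : fst u = 0%Z /\ (snd u = 1%Z \/ snd u = (-1)%Z))
    by (simpl in Hu; intuition subst; auto).
  destruct u as [b d]; cbn [fst snd] in Hu'; destruct Hu' as [-> Hd].
  assert (d <> 0)%Z by lia.
  assert (B2 := Re_ge_Cmod (odd_row_term p z (swap (0, d)%Z))).
  unfold swap in B2; cbn [fst snd] in B2; rewrite Cmod_odd_row_term in B2 by auto.
  cbn [fst snd] in B2; rewrite Cmod2_lin in B2; fold r x in B2.
  replace (2 * (IZR d ^ 2 * r + 2 * IZR d * 0 * x + 0 ^ 2)) with (2 * r) in B2
    by (destruct Hd as [-> | ->]; ring).
  unfold f; rewrite re_plus; replace (even_row_term p z (0, d)%Z) with (RtoC 1).
  - simpl (Re 1); unfold swap; cbn [fst snd]; lra.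
  - unfold even_row_term; cbn [fst snd].
    rewrite Rmult_0_r, Cmult_0_l, Cplus_0_l, Cpow_mult_r.
    destruct Hd as [-> | ->].
    + rewrite !Cpow_1_l; field; intros E'; injection E'; lra.
    + replace (RtoC (-1) ^ 2)%C with (RtoC 1) by (rewrite <- RtoC_pow; f_equal; ring).
      rewrite !Cpow_1_l; field; intros E'; injection E'; lra. }
assert (A1 := rsum_le (fun _ => 1 - Y / 2) _ axis_pairs Hax).
assert (A2 := rsum_le (fun _ => - c1) _ unit_pairs Hun).
replace (rsum (fun _ => 1 - Y / 2) axis_pairs) with (2 - Y) in A1 by (unfold rsum; simpl; lra).
replace (rsum (fun _ => - c1) unit_pairs) with (- (4 * c1)) in A2 by (unfold rsum; simpl; lra).
lra.
Qed.

(** * Points near the circle and away from the corner *)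

(** The polynomial (P^k - Q^k) / (P - Q), that is the sum of P^(k-1-i) Q^i. In this form a factor P
    - Q can be extracted from a difference of powers, also when P = Q. *)
Fixpoint hsum (k : nat) (P Q : R) : R :=
  match k with O => 0 | S k' => P * hsum k' P Q + Q ^ k' end.

Lemma hsum_ge0 k P Q : 0 <= P -> 0 <= Q -> 0 <= hsum k P Q.
Proof.
intros HP HQ; induction k as [|k IH]; simpl; [lra |].
assert (0 <= Q ^ k) by now apply pow_le. nra.
Qed.

Lemma Cmod_pow_sub (a b : C) (k : nat) :
  Cmod (a ^ k - b ^ k) <= Cmod (a - b) * hsum k (Cmod a) (Cmod b).
Proof.
induction k as [|k IH]; simpl.
- replace (1 - 1)%C with (RtoC 0) by ring; rewrite Cmod_0; lra.
- replace (a * a ^ k - b * b ^ k)%C with (a * (a ^ k - b ^ k) + (a - b) * b ^ k)%C by ring.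
  eapply Rle_trans; [apply Cmod_triangle |]; rewrite !Cmod_mult, Cmod_pow.
  assert (H := Cmod_ge_0 a). nra.
Qed.

Lemma hsum_le k P Q P' Q' : 0 <= P <= P' -> 0 <= Q <= Q' -> hsum k P Q <= hsum k P' Q'.
Proof.
intros HP HQ; induction k as [|k IH]; simpl; [lra |].
apply Rplus_le_compat; [|apply pow_incr; lra].
apply Rmult_le_compat; try lra; apply hsum_ge0; lra.
Qed.

Lemma hsum_scal k c P Q : hsum (S k) (c * P) (c * Q) = c ^ k * hsum (S k) P Q.
Proof.
induction k as [|k IH]; [simpl; ring |].
change (hsum (S (S k)) (c * P) (c * Q)) with (c * P * hsum (S k) (c * P) (c * Q) + (c * Q) ^ S k).
change (hsum (S (S k)) P Q) with (P * hsum (S k) P Q + Q ^ S k).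
rewrite IH, Rpow_mult_distr; simpl; ring.
Qed.

Lemma hsum_telescope k P Q : (P - Q) * hsum k P Q = P ^ k - Q ^ k.
Proof. induction k as [|k IH]; simpl; [ring |]. nra. Qed.

Lemma hsum_11 k : hsum k 1 1 = INR k.
Proof.
induction k as [|k IH]; [reflexivity |].
rewrite S_INR; simpl; rewrite IH, pow1; ring.
Qed.

Lemma hsum_rsum k P Q : hsum k P Q = rsum (fun i => P ^ (k - 1 - i) * Q ^ i) (seq 0 k).
Proof.
induction k as [|k IH]; [reflexivity |].
rewrite rsum_seq_S; simpl hsum; rewrite IH, <- rsum_scal.
replace (0 + k)%nat with k by lia; replace (S k - 1 - k)%nat with 0%nat by lia.
rewrite pow_O, Rmult_1_l; f_equal.
apply Rle_antisym; apply rsum_le; intros i Hi; apply in_seq in Hi;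
  replace (S k - 1 - i)%nat with (S (k - 1 - i)) by lia; simpl; lra.
Qed.

(** Adding an element h changes the difference of the two sides by the sum of (a h - a x) (b h - b
    x) over the old x, which is nonpositive for oppositely ordered families. *)
Lemma chebyshev_sum {T : Type} (a b : T -> R) (l : list T) :
  (forall x y, In x l -> In y l -> (a x - a y) * (b x - b y) <= 0) ->
  INR (length l) * rsum (fun x => a x * b x) l <= rsum a l * rsum b l.
Proof.
induction l as [|h t IH]; intros H; [unfold rsum; simpl; lra |].
assert (IH' := IH (fun x y Hx Hy => H x y (or_intror Hx) (or_intror Hy))).
assert (E : rsum (fun x => (a h - a x) * (b h - b x)) t <= rsum (fun _ => 0) t).
{ apply rsum_le; intros x Hx; apply H; simpl; auto. }
assert (E1 : rsum (fun x => (a h - a x) * (b h - b x)) t =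
   INR (length t) * (a h * b h) - a h * rsum b t - b h * rsum a t
   + rsum (fun x => a x * b x) t).
{ clear; induction t as [|c t IH]; [unfold rsum; simpl; ring |].
  change (length (c :: t)) with (S (length t)); rewrite S_INR.
  unfold rsum in *; simpl; rewrite IH; ring. }
assert (E2 : rsum (fun _ : T => 0) t = 0).
{ clear; induction t; unfold rsum in *; simpl; lra. }
change (length (h :: t)) with (S (length t)); rewrite S_INR.
unfold rsum in *; simpl; nra.
Qed.

Lemma pow_decr (P : R) (i j : nat) : 0 <= P <= 1 -> (i <= j)%nat -> P ^ j <= P ^ i.
Proof.
intros HP Hij; replace j with (i + (j - i))%nat by lia; rewrite pow_add.
assert (0 <= P ^ i) by (apply pow_le; lra).
assert (P ^ (j - i) <= 1 ^ (j - i)) by (apply pow_incr; lra).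
rewrite pow1 in *; nra.
Qed.

(** P^(k-1-i) increases and Q^i decreases in i. This separates P from Q and gains a factor 1 / k:
    with P = 1 / |2 z + 1| the first factor is a geometric sum, bounded uniformly in k, and the
    second is the one contained in 1 - beta^k. *)
Lemma hsum_chebyshev k P Q : 0 <= P <= 1 -> 0 <= Q <= 1 ->
  INR k * hsum k P Q <= hsum k P 1 * hsum k 1 Q.
Proof.
intros HP HQ; rewrite !hsum_rsum.
assert (H := chebyshev_sum (fun i => P ^ (k - 1 - i)) (fun i => Q ^ i) (seq 0 k)).
rewrite length_seq in H; eapply Rle_trans; [apply H |].
- intros i j _ _; destruct (Nat.le_ge_cases i j) as [Hij | Hij].
  + assert (P ^ (k - 1 - i) <= P ^ (k - 1 - j)) by (apply pow_decr; [lra | lia]).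
    assert (Q ^ j <= Q ^ i) by (apply pow_decr; [lra | lia]). nra.
  + assert (P ^ (k - 1 - j) <= P ^ (k - 1 - i)) by (apply pow_decr; [lra | lia]).
    assert (Q ^ i <= Q ^ j) by (apply pow_decr; [lra | lia]). nra.
- apply Req_le; f_equal; apply Rle_antisym; apply rsum_le; intros i _; rewrite pow1; lra.
Qed.

Lemma hsum_1_SS k Q : hsum (S (S k)) 1 Q = 1 + Q ^ S k + Q * hsum k 1 Q.
Proof.
assert (H : forall j, hsum (S j) 1 Q = 1 + Q * hsum j 1 Q).
{ induction j as [|j IH]; [simpl; ring |].
  change (hsum (S (S j)) 1 Q) with (1 * hsum (S j) 1 Q + Q ^ S j).
  rewrite IH at 1; simpl; ring. }
change (hsum (S (S k)) 1 Q) with (1 * hsum (S k) 1 Q + Q ^ S k).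
rewrite H; ring.
Qed.

(** The terms g^(2i) and g^(2(k-i)) add up to at least 2 g^k. Peeling off both extreme terms makes
    the induction advance by two. *)
Lemma hsum_amgm k g : 0 <= g -> INR (S k) * g ^ k <= hsum (S k) 1 (g ^ 2).
Proof.
intros Hg.
assert (H : forall j, INR (S j) * g ^ j <= hsum (S j) 1 (g ^ 2) /\
    INR (S (S j)) * g ^ (S j) <= hsum (S (S j)) 1 (g ^ 2)); [|apply H].
induction j as [|j [IH1 IH2]].
- assert (0 <= (g - 1) ^ 2) by apply pow2_ge_0; split; simpl in *; lra.
- split; [exact IH2 |].
  rewrite hsum_1_SS, (S_INR (S (S j))), (S_INR (S j)), <- pow_mult.
  replace (2 * S (S j))%nat with (S (S j) + S (S j))%nat by lia; rewrite pow_add.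
  replace (g ^ S (S j)) with (g ^ 2 * g ^ j) in * by (simpl; ring).
  assert (0 <= (g ^ 2 * g ^ j - 1) ^ 2) by apply pow2_ge_0.
  assert (0 <= g ^ 2) by apply pow2_ge_0.
  assert (g ^ 2 * (INR (S j) * g ^ j) <= g ^ 2 * hsum (S j) 1 (g ^ 2))
    by now apply Rmult_le_compat_l.
  nra.
Qed.

Lemma Re_sub_conj (a b : C) :
  Re (a - Cconj b) = Re (a - b).
Proof. unfold Cminus; now rewrite !re_plus, !re_opp, re_conj. Qed.

Lemma Cmod_inv_pow_sub (a b : C) (k : nat) : a <> 0 -> b <> 0 ->
  Cmod (/ a ^ k - / b ^ k) <=
    Cmod (a - b) / (Cmod a * Cmod b) * hsum k (/ Cmod a) (/ Cmod b).
Proof.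
intros Ha Hb.
assert (Ha' := proj1 (Cmod_gt_0 a) Ha); assert (Hb' := proj1 (Cmod_gt_0 b) Hb).
rewrite <- !Cpow_inv by auto.
eapply Rle_trans; [apply Cmod_pow_sub |]; rewrite !Cmod_inv by auto.
apply Req_le; f_equal.
replace (/ a - / b)%C with (- ((a - b) / (a * b)))%C by (field; auto).
rewrite Cmod_opp, Cmod_div, Cmod_mult; auto.
now apply Cmult_neq_0.
Qed.

Lemma Cconj_RtoC (r : R) : Cconj (RtoC r) = RtoC r.
Proof. unfold Cconj, RtoC; simpl; now rewrite Ropp_0. Qed.

(* The reflection in the circle [|z| = 1 / sqrt 2] exchanges, up to conjugation and the factor
   [2 ^ p * z ^ (2 * p)], the two rows of the pair; hence the factors [1 - beta]. *)
Lemma pair_bound (m : nat) (z : C) (b d : R) :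
  let p := S m in let k := (2 * p)%nat in
  let q := Cmod z in let beta := / (2 * q ^ 2) in let g := / (sqrt 2 * q) in
  let n := Cmod (RtoC (2 * b) * z + RtoC d) in
  let ns := Cmod (RtoC d * z + RtoC b) / q in
  0 < Im z -> 1 < 2 * q ^ 2 -> b <> 0 \/ d <> 0 ->
  - ((1 - beta) / (n * ns) * (Rabs d * hsum k (/ n) (beta / ns)
       + sqrt 2 * Rabs b * g ^ (k - 1) * hsum k (/ ns) (/ n))) <=
  Re ((/ (RtoC (2 * b) * z + RtoC d) ^ k + / (RtoC 2 ^ p * (RtoC d * z + RtoC b) ^ k)) *
      (1 - Cconj (/ (RtoC 2 ^ p * z ^ k)))).
Proof.
intros p k q beta g n ns Hy Hq Hbd.
set (a := (RtoC (2 * b) * z + RtoC d)%C) in *.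
set (a' := (RtoC d * z + RtoC b)%C) in *.
assert (Hz : z <> 0) by (intros ->; simpl in Hy; lra).
assert (Hqp : 0 < q) by now apply Cmod_gt_0.
assert (Hzc : Cconj z <> 0) by (apply Cmod_gt_0; rewrite Cmod_conj; exact Hqp).
assert (Ha : a <> 0) by (apply lin_neq0; auto; destruct Hbd; [left | right]; lra).
assert (Ha' : a' <> 0) by (apply lin_neq0; tauto).
assert (N2 : RtoC 2 <> 0) by (intros E; injection E; lra).
assert (N2p := Cpow2_R_neq0 p).
assert (Hzz : (z * Cconj z)%C = RtoC (q ^ 2)) by (unfold q; now rewrite Cmod2_conj).
(* These are the reflected rows. Expanding the product with the conjugate of F matches [a] with [b1]
   and [a'] with [b2], up to a conjugation that real parts ignore, so only differences of k-th
   powers remain. *)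
set (b1 := (RtoC 2 * z * Cconj a')%C); set (b2 := (z * Cconj a)%C).
assert (Hac : Cconj a <> 0) by (apply Cmod_gt_0; rewrite Cmod_conj; now apply Cmod_gt_0).
assert (Hac' : Cconj a' <> 0) by (apply Cmod_gt_0; rewrite Cmod_conj; now apply Cmod_gt_0).
assert (Hb1 : b1 <> 0) by (repeat apply Cmult_neq_0; auto).
assert (Hb2 : b2 <> 0) by (apply Cmult_neq_0; auto).
assert (Hn : 0 < n) by now apply Cmod_gt_0.
assert (Hns : Cmod a' = q * ns) by (unfold ns; field; lra).
assert (Hnsp : 0 < ns) by (apply Rdiv_lt_0_compat; auto; now apply Cmod_gt_0).
assert (E : ((/ a ^ k + / (RtoC 2 ^ p * a' ^ k)) * (1 - Cconj (/ (RtoC 2 ^ p * z ^ k))) =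
   (/ a ^ k - Cconj (/ b1 ^ k)) + RtoC (/ 2 ^ p) * (/ a' ^ k - Cconj (/ b2 ^ k)))%C).
{ rewrite !Cinv_conj, !Cmult_conj, !Cpow_conj by
    (repeat first [apply Cmult_neq_0 | apply Cpow_nz]; auto).
  unfold b1, b2; rewrite !Cmult_conj, !Cconj_conj, !Cconj_RtoC, !Cpow_mult_l.
  rewrite RtoC_inv, RtoC_pow by (apply pow_nonzero; lra).
  replace (RtoC 2 ^ k)%C with (RtoC 2 ^ p * RtoC 2 ^ p)%C
    by (rewrite <- Cpow_add_r; f_equal; unfold k; lia).
  field; repeat split; try apply Cpow_nz; auto. }
rewrite E, re_plus, re_scal_l, !Re_sub_conj.
assert (H1 := Cmod_inv_pow_sub a b1 k Ha Hb1).
assert (H2 := Cmod_inv_pow_sub a' b2 k Ha' Hb2).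
assert (G1 := Re_ge_Cmod (/ a ^ k - / b1 ^ k)).
assert (G2 := Re_ge_Cmod (/ a' ^ k - / b2 ^ k)).
(* A row minus its reflection is the real number d (1 - 2 |z|^2): this is where the factor vanishing
   on the circle appears. *)
assert (D1 : Cmod (a - b1) = Rabs d * (2 * q ^ 2 - 1)).
{ replace (a - b1)%C with (RtoC (d * (1 - 2 * q ^ 2))).
  - rewrite Cmod_R, Rabs_mult, (Rabs_left (1 - 2 * q ^ 2)) by lra; ring.
  - unfold a, b1, a'; rewrite Cplus_conj, Cmult_conj, !Cconj_RtoC.
    replace (RtoC 2 * z * (RtoC d * Cconj z + RtoC b))%C
      with (RtoC 2 * RtoC d * (z * Cconj z) + RtoC 2 * RtoC b * z)%C by ring.
    rewrite Hzz, !RtoC_mult, RtoC_minus, RtoC_mult; ring. }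
assert (D2 : Cmod (a' - b2) = Rabs b * (2 * q ^ 2 - 1)).
{ replace (a' - b2)%C with (RtoC (b * (1 - 2 * q ^ 2))).
  - rewrite Cmod_R, Rabs_mult, (Rabs_left (1 - 2 * q ^ 2)) by lra; ring.
  - unfold b2, a, a'; rewrite Cplus_conj, Cmult_conj, !Cconj_RtoC.
    replace (z * (RtoC (2 * b) * Cconj z + RtoC d))%C
      with (RtoC (2 * b) * (z * Cconj z) + RtoC d * z)%C by ring.
    rewrite Hzz, !RtoC_mult, RtoC_minus, RtoC_mult; ring. }
assert (M1 : Cmod b1 = 2 * q ^ 2 * ns).
{ unfold b1; rewrite !Cmod_mult, Cmod_conj, Hns, Cmod_R, Rabs_pos_eq by lra; fold q; ring. }
assert (M2 : Cmod b2 = q * n) by (unfold b2; now rewrite Cmod_mult, Cmod_conj).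
rewrite D1, M1 in H1; rewrite D2, M2, Hns in H2.
fold n in H1, H2.
assert (Hs2 : 0 < sqrt 2) by (apply sqrt_lt_R0; lra).
assert (Hss : sqrt 2 * sqrt 2 = 2) by (apply sqrt_sqrt; lra).
assert (T1 : Rabs d * (2 * q ^ 2 - 1) / (n * (2 * q ^ 2 * ns)) * hsum k (/ n) (/ (2 * q ^ 2 * ns))
   = (1 - beta) / (n * ns) * (Rabs d * hsum k (/ n) (beta / ns))).
{ replace (beta / ns) with (/ (2 * q ^ 2 * ns)) by (unfold beta; field; lra).
  unfold beta; field; lra. }
assert (T2 : / 2 ^ p * (Rabs b * (2 * q ^ 2 - 1) / (q * ns * (q * n)) *
     hsum k (/ (q * ns)) (/ (q * n))) =
   (1 - beta) / (n * ns) * (sqrt 2 * Rabs b * g ^ (k - 1) * hsum k (/ ns) (/ n))).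
{ rewrite !(Rinv_mult q).
  replace k with (S (k - 1)) at 1 by (unfold k, p; lia).
  rewrite hsum_scal.
  replace (S (k - 1)) with k by (unfold k, p; lia).
  assert (Eg : / 2 ^ p * (/ q) ^ (k - 1) = / sqrt 2 * g ^ (k - 1)).
  { unfold g; rewrite Rinv_mult, Rpow_mult_distr, <- Rmult_assoc; f_equal.
    rewrite pow_inv, <- Rinv_mult; f_equal.
    change (sqrt 2 * sqrt 2 ^ (k - 1)) with (sqrt 2 ^ (S (k - 1))).
    replace (S (k - 1)) with (2 * p)%nat by (unfold k, p; lia).
    rewrite pow_mult; f_equal; simpl; lra. }
  transitivity (/ 2 ^ p * (/ q) ^ (k - 1) *
    (Rabs b * (2 * q ^ 2 - 1) / (q * ns * (q * n)) * hsum k (/ ns) (/ n))); [ring |].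
  rewrite Eg; unfold beta.
  replace (sqrt 2 * Rabs b * g ^ (k - 1) * hsum k (/ ns) (/ n))
    with (/ sqrt 2 * g ^ (k - 1) * (2 * Rabs b * hsum k (/ ns) (/ n))).
  - field; lra.
  - assert (Hi : 2 * / sqrt 2 = sqrt 2) by (rewrite <- Hss at 1; field; lra).
    rewrite <- Hi at 2; ring. }
assert (H2p : 0 < / 2 ^ p) by (apply Rinv_0_lt_compat, pow_lt; lra).
assert (H2' := Rmult_le_compat_l _ _ _ (Rlt_le _ _ H2p) H2).
rewrite T2 in H2'; rewrite T1 in H1.
rewrite Rmult_plus_distr_l. nra.
Qed.

(** With both moduli at least m, powers of 1 / m factor out. [hsum_amgm] replaces k g^(k-1) in the
    second summand by [hsum k 1 (g ^ 2)], so that both summands carry this factor, which times 1 -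
    g^2 is 1 - beta^k. *)
Lemma weight_gen (k : nat) (g n ns m A D : R) :
  (1 <= k)%nat -> 0 <= g -> 0 < m -> m <= n -> m <= ns -> 0 <= A -> 0 <= D ->
  / (n * ns) * (D * hsum k (/ n) (g ^ 2 / ns) + sqrt 2 * A * g ^ (k - 1) * hsum k (/ ns) (/ n))
  <= (D + sqrt 2 * A) / m ^ (k + 1) * hsum k 1 (g ^ 2).
Proof.
intros Hk Hg Hm Hn Hns HA HD.
destruct k as [|k]; [lia |]; replace (S k - 1)%nat with k by lia.
assert (Hs2 := sqrt_pos 2).
assert (Hg2 : 0 <= g ^ 2) by apply pow2_ge_0.
assert (I0 : forall x, m <= x -> 0 < / x <= / m).
{ intros x Hx; split; [apply Rinv_0_lt_compat; lra | apply Rinv_le_contravar; lra]. }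
assert (In := I0 n Hn); assert (Ins := I0 ns Hns).
assert (Him : 0 < / m) by (apply Rinv_0_lt_compat; lra).
assert (Hmk : 0 <= (/ m) ^ k) by (apply pow_le; lra).
assert (H1 : hsum (S k) (/ n) (g ^ 2 / ns) <= (/ m) ^ k * hsum (S k) 1 (g ^ 2)).
{ rewrite <- hsum_scal; apply hsum_le; [lra |].
  unfold Rdiv; split; [apply Rmult_le_pos; lra |].
  rewrite Rmult_comm; apply Rmult_le_compat_r; lra. }
assert (H2 : hsum (S k) (/ ns) (/ n) <= (/ m) ^ k * INR (S k)).
{ rewrite <- hsum_11, <- hsum_scal; apply hsum_le; lra. }
assert (H3 := hsum_amgm k g Hg).
assert (HB : 0 <= hsum (S k) 1 (g ^ 2)) by (apply hsum_ge0; lra).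
assert (Hgk : 0 <= g ^ k) by now apply pow_le.
assert (H4 : g ^ k * hsum (S k) (/ ns) (/ n) <= (/ m) ^ k * hsum (S k) 1 (g ^ 2)).
{ apply Rle_trans with (g ^ k * ((/ m) ^ k * INR (S k))); [now apply Rmult_le_compat_l |].
  replace (g ^ k * ((/ m) ^ k * INR (S k))) with ((/ m) ^ k * (INR (S k) * g ^ k)) by ring.
  now apply Rmult_le_compat_l. }
assert (H5 : / (n * ns) <= / m * / m).
{ rewrite Rinv_mult; apply Rmult_le_compat; lra. }
assert (H6 : 0 <= / (n * ns)) by (rewrite Rinv_mult; apply Rmult_le_pos; lra).
replace ((D + sqrt 2 * A) / m ^ (S k + 1) * hsum (S k) 1 (g ^ 2)) with
  (/ m * / m * ((D + sqrt 2 * A) * ((/ m) ^ k * hsum (S k) 1 (g ^ 2)))).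
- apply Rmult_le_compat; auto.
  + assert (0 <= hsum (S k) (/ n) (g ^ 2 / ns)).
    { apply hsum_ge0; [lra|]; unfold Rdiv; apply Rmult_le_pos; lra. }
    assert (0 <= hsum (S k) (/ ns) (/ n)) by (apply hsum_ge0; lra).
    assert (0 <= sqrt 2 * A * g ^ k) by (repeat apply Rmult_le_pos; auto).
    nra.
  + assert (D * hsum (S k) (/ n) (g ^ 2 / ns) <= D * ((/ m) ^ k * hsum (S k) 1 (g ^ 2)))
      by now apply Rmult_le_compat_l.
    assert (sqrt 2 * A * (g ^ k * hsum (S k) (/ ns) (/ n)) <=
       sqrt 2 * A * ((/ m) ^ k * hsum (S k) 1 (g ^ 2))).
    { apply Rmult_le_compat_l; auto; now apply Rmult_le_pos. }
    lra.
- rewrite pow_inv, Nat.add_1_r; simpl; field.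
  split; [apply pow_nonzero |]; lra.
Qed.

(** Meant for the rows +-(1, 1), for which n = |2 z + 1| can be close to 1 and negative powers of n
    yield no decay. Chebyshev's inequality and the geometric series give 1 / (k (n - 1)) instead. *)
Lemma weight_main (k : nat) (g n ns : R) :
  (1 <= k)%nat -> 0 <= g <= 1 -> 1 < n -> 1 <= ns ->
  / (n * ns) * (1 * hsum k (/ n) (g ^ 2 / ns) + sqrt 2 * 1 * g ^ (k - 1) * hsum k (/ ns) (/ n))
  <= (1 + sqrt 2) / (INR k * (n - 1)) * hsum k 1 (g ^ 2).
Proof.
intros Hk Hg Hn Hns.
assert (Hk' : 0 < INR k) by (apply lt_0_INR; lia).
assert (Hs2 := sqrt_pos 2).
assert (Hg2 : 0 <= g ^ 2 <= 1) by (split; [apply pow2_ge_0 | nra]).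
assert (Hi : 0 < / n < 1).
{ split; [apply Rinv_0_lt_compat; lra |]. rewrite <- Rinv_1; apply Rinv_lt_contravar; lra. }
assert (Hj : 0 < / ns <= 1).
{ split; [apply Rinv_0_lt_compat; lra |]. rewrite <- Rinv_1; apply Rinv_le_contravar; lra. }
set (B := hsum k 1 (g ^ 2)).
assert (HB : 0 <= B) by (apply hsum_ge0; lra).
set (v := / (1 - / n)).
assert (Hv : 0 < v) by (apply Rinv_0_lt_compat; lra).
assert (Hpn : 0 <= (/ n) ^ k) by (apply pow_le; lra).
assert (V1 : hsum k (/ n) 1 <= v).
{ assert (T := hsum_telescope k (/ n) 1); rewrite pow1 in T.
  apply Rmult_le_reg_l with (1 - / n); [lra |].
  unfold v; rewrite Rinv_r by lra; lra. }
assert (V2 : hsum k 1 (/ n) <= v).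
{ assert (T := hsum_telescope k 1 (/ n)); rewrite pow1 in T.
  apply Rmult_le_reg_l with (1 - / n); [lra |].
  unfold v; rewrite Rinv_r by lra; lra. }
assert (C1 : INR k * hsum k (/ n) (g ^ 2 / ns) <= v * B).
{ apply Rle_trans with (INR k * hsum k (/ n) (g ^ 2)).
  - apply Rmult_le_compat_l; [lra |]; apply hsum_le; [lra |].
    unfold Rdiv; split; nra.
  - eapply Rle_trans; [apply hsum_chebyshev; lra |]. now apply Rmult_le_compat_r. }
assert (C2 : INR k * (g ^ (k - 1) * hsum k (/ ns) (/ n)) <= v * B).
{ assert (Hgk : 0 <= g ^ (k - 1)) by (apply pow_le; lra).
  assert (AG : INR k * g ^ (k - 1) <= B).
  { unfold B; destruct k as [|k]; [lia |]; replace (S k - 1)%nat with k by lia.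
    apply hsum_amgm; lra. }
  assert (hsum k (/ ns) (/ n) <= v).
  { eapply Rle_trans; [apply hsum_le with (P' := 1) (Q' := / n); lra | exact V2]. }
  assert (0 <= hsum k (/ ns) (/ n)) by (apply hsum_ge0; lra).
  replace (INR k * (g ^ (k - 1) * hsum k (/ ns) (/ n)))
    with ((INR k * g ^ (k - 1)) * hsum k (/ ns) (/ n)) by ring.
  rewrite (Rmult_comm v); apply Rmult_le_compat; auto.
  apply Rmult_le_pos; lra. }
apply Rmult_le_reg_l with (INR k); auto.
replace (INR k * ((1 + sqrt 2) / (INR k * (n - 1)) * B)) with
  (/ n * ((1 + sqrt 2) * (v * B))) by (unfold v; field; repeat split; lra).
rewrite Rinv_mult.
apply Rle_trans with (/ n * (/ ns * ((1 + sqrt 2) * (v * B)))).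
- replace (INR k * (/ n * / ns * (1 * hsum k (/ n) (g ^ 2 / ns) +
     sqrt 2 * 1 * g ^ (k - 1) * hsum k (/ ns) (/ n)))) with
   (/ n * (/ ns * (INR k * hsum k (/ n) (g ^ 2 / ns) +
     sqrt 2 * (INR k * (g ^ (k - 1) * hsum k (/ ns) (/ n)))))) by ring.
  do 2 (apply Rmult_le_compat_l; [lra |]).
  assert (sqrt 2 * (INR k * (g ^ (k - 1) * hsum k (/ ns) (/ n))) <= sqrt 2 * (v * B))
    by now apply Rmult_le_compat_l.
  lra.
- apply Rmult_le_compat_l; [lra |].
  assert (0 <= v * B) by (apply Rmult_le_pos; lra).
  assert (0 <= (1 + sqrt 2) * (v * B)) by (apply Rmult_le_pos; lra).
  nra.
Qed.

(** The exponent 9 is k + 1 for k = 8, the least weight treated near the arc, and 14143/10000 is a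
    rational above sqrt 2. One factor sqrt mu pays for the numerator; of the remaining mu^4, half is
    bounded by [C2] and half is compared with A^2 D^2. *)
Lemma weight_num (A D mu sc C1 C2 : R) : 0 < A -> 0 < D -> 0 < sc -> 0 < C1 -> 0 < C2 ->
  (D + 14143 / 10000 * A) ^ 2 <= sc ^ 2 * mu -> A ^ 2 * D ^ 2 <= C1 * mu ^ 2 -> C2 <= mu ->
  (D + sqrt 2 * A) / sqrt mu ^ 9 <= sc * C1 / C2 ^ 2 * (/ A ^ 2 * / D ^ 2).
Proof.
intros HA HD Hsc HC1 HC2 H1 H2 H3.
assert (Hs2 : sqrt 2 <= 14143 / 10000).
{ rewrite <- (sqrt_pow2 (14143 / 10000)) by lra; apply sqrt_le_1; lra. }
assert (Hs2' := sqrt_pos 2).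
assert (Hmu : 0 < mu) by lra.
assert (Hs := sqrt_lt_R0 mu Hmu).
assert (Hss : sqrt mu ^ 2 = mu) by (apply pow2_sqrt; lra).
set (s := sqrt mu) in *.
assert (H4 : D + sqrt 2 * A <= sc * s).
{ apply Rle_trans with (D + 14143 / 10000 * A); [nra |].
  apply Rsqr_incr_0_var; [|nra]. unfold Rsqr; nra. }
assert (Hs9 : 0 < s ^ 9) by now apply pow_lt.
apply Rmult_le_reg_r with (s ^ 9); auto.
replace ((D + sqrt 2 * A) / s ^ 9 * s ^ 9) with (D + sqrt 2 * A) by (field; lra).
eapply Rle_trans; [exact H4 |].
replace (sc * C1 / C2 ^ 2 * (/ A ^ 2 * / D ^ 2) * s ^ 9)
  with (sc * s * (C1 * (s ^ 2) ^ 4 / (C2 ^ 2 * (A ^ 2 * D ^ 2)))) by (field; lra).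
rewrite Hss.
rewrite <- (Rmult_1_r (sc * s)) at 1.
apply Rmult_le_compat_l; [nra |].
assert (HAD : 0 < A ^ 2 * D ^ 2) by (apply Rmult_lt_0_compat; apply pow_lt; auto).
assert (HC22 : 0 < C2 ^ 2) by now apply pow_lt.
assert (0 < C2 ^ 2 * (A ^ 2 * D ^ 2)) by now apply Rmult_lt_0_compat.
apply Rmult_le_reg_r with (C2 ^ 2 * (A ^ 2 * D ^ 2)); auto.
replace (C1 * mu ^ 4 / (C2 ^ 2 * (A ^ 2 * D ^ 2)) * (C2 ^ 2 * (A ^ 2 * D ^ 2)))
  with (mu ^ 2 * (C1 * mu ^ 2)) by (field; lra).
rewrite Rmult_1_l; apply Rmult_le_compat; try lra.
apply pow_incr; lra.
Qed.

(** * Weights of the pairs for 1/2 < |z|^2 <= 1 and -1/2 <= Re z <= 0 *)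

Lemma rest_sum_pos (l : list (Z * Z)) : NoDup l ->
  (forall u, In u l -> OddRight u /\ ~ In u (axis_pairs ++ unit_pairs) /\ (0 < fst u * snd u)%Z) ->
  rsum invsq l <= 13 / 6.
Proof.
intros Hn Hl.
(* Changing the sign of b keeps [invsq] and makes b d negative, so the list and its image are
   disjoint and share the total 13/3 equally. *)
set (h := fun u : Z * Z => (- fst u, snd u)%Z).
assert (Hh : forall u, h (h u) = u)
  by (intros [b d]; unfold h; simpl; now rewrite Z.opp_involutive).
assert (H : rsum invsq (l ++ map h l) <= 13 / 3).
{ apply rest_sum.
  - apply NoDup_app; auto.
    + apply FinFun.Injective_map_NoDup; auto.
      intros u v E; now rewrite <- (Hh u), E, Hh.
    + intros u Hu Hu'; apply in_map_iff in Hu'; destruct Hu' as [v [<- Hv]].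
      apply Hl in Hu, Hv; unfold h in Hu; simpl in Hu; lia.
  - apply Forall_forall; intros u Hu; apply in_app_iff in Hu; destruct Hu as [Hu | Hu].
    + apply Hl in Hu; tauto.
    + apply in_map_iff in Hu; destruct Hu as [v [<- Hv]].
      destruct (Hl v Hv) as [[Hg Ho] [Hv1 _]]; split.
      * split; [|exact Ho]; unfold coprime_pair, h; cbn [fst snd]; now rewrite Z.gcd_opp_l.
      * intros Hin; apply Hv1; rewrite <- (Hh v).
        simpl in Hin; repeat destruct Hin as [<- | Hin]; simpl; tauto. }
rewrite rsum_app, rsum_map in H.
assert (E : rsum (fun u => invsq (h u)) l = rsum invsq l); [|lra].
apply Rle_antisym; apply rsum_le; intros u _; apply Req_le; unfold invsq, h; cbn [fst snd];
  rewrite opp_IZR; do 2 f_equal; ring.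
Qed.

(** A lower bound, uniform in z, for |2 b z + d|^2 and for |d z + b|^2 / |z|^2. For b d > 0 the
    worst case is Re z = -1/2, and the two entries of the minimum belong to |z|^2 = 1/2 and |z|^2 =
    1; for b d <= 0 the cross term helps and is dropped. *)
Definition lune_form (b d : R) : R :=
  if Rlt_dec 0 (b * d) then Rmin (2 * b ^ 2 - 2 * b * d + d ^ 2) (b ^ 2 - b * d + d ^ 2)
  else b ^ 2 + d ^ 2.

Lemma lune_form_le (z : C) (b d : R) :
  0 < Im z -> 1 < 2 * Cmod z ^ 2 -> Cmod z ^ 2 <= 1 -> -1/2 <= Re z <= 0 ->
  lune_form b d <= Cmod (RtoC (2 * b) * z + RtoC d) ^ 2 /\
  lune_form b d <= (Cmod (RtoC d * z + RtoC b) / Cmod z) ^ 2.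
Proof.
intros Hy H1 H2 Hx; unfold lune_form.
assert (Hq : 0 < Cmod z) by (apply Cmod_gt_0; intros ->; simpl in Hy; lra).
unfold Rdiv; rewrite Rpow_mult_distr, !Cmod2_lin, pow_inv.
set (r := Cmod z ^ 2) in *; set (x := Re z) in *.
assert (Hi : 1 <= / r <= 2).
{ split; [rewrite <- Rinv_1; apply Rinv_le_contravar; lra |].
  replace 2 with (/ (1/2)) by field; apply Rinv_le_contravar; lra. }
replace ((d ^ 2 * r + 2 * d * b * x + b ^ 2) * / r)
  with (d ^ 2 + / r * (b ^ 2 + 2 * x * (b * d))) by (field; lra).
destruct (Rlt_dec 0 (b * d)) as [Hbd | Hbd].
- assert (M1 := Rmin_l (2 * b ^ 2 - 2 * b * d + d ^ 2) (b ^ 2 - b * d + d ^ 2)).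
  assert (M2 := Rmin_r (2 * b ^ 2 - 2 * b * d + d ^ 2) (b ^ 2 - b * d + d ^ 2)).
  set (mu := Rmin _ _) in *.
  assert (- (b * d) <= 2 * x * (b * d)) by nra.
  split.
  + assert (0 <= b ^ 2) by apply pow2_ge_0. nra.
  + assert (/ r * (b ^ 2 - b * d) <= / r * (b ^ 2 + 2 * x * (b * d)))
      by (apply Rmult_le_compat_l; lra).
    destruct (Rle_dec 0 (b ^ 2 - b * d)); nra.
- assert (0 <= x * (b * d)) by nra.
  assert (0 <= b ^ 2) by apply pow2_ge_0.
  split; [nra |].
  assert (1 * (b ^ 2 + 2 * x * (b * d)) <= / r * (b ^ 2 + 2 * x * (b * d)))
    by (apply Rmult_le_compat_r; lra).
  lra.
Qed.

(** Rows with b d > 0 are closer to zero and need 155/1000, the others only 2/100. Adding 135/1000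
    over half of the pairs gives 2/100 * 13/3 + 135/1000 * 13/6 < 380/1000. *)
Definition rest_weight (u : Z * Z) : R :=
  2 / 100 * invsq u + (if (0 <? fst u * snd u)%Z then 135 / 1000 * invsq u else 0).

Lemma lune_form_rest (u : Z * Z) : OddRight u -> ~ In u (axis_pairs ++ unit_pairs) ->
  let mu := lune_form (IZR (fst u)) (IZR (snd u)) in
  1 <= mu /\
  (Rabs (IZR (snd u)) + sqrt 2 * Rabs (IZR (fst u))) / sqrt mu ^ 9 <= rest_weight u.
Proof.
intros HG Hu mu.
destruct (rest_nonzero u HG Hu) as [Hb Hd].
assert (Hinv := invsq_ge0 u Hb Hd).
destruct u as [b d]; cbn [fst snd] in *.
set (A := Rabs (IZR b)) in *; set (D := Rabs (IZR d)) in *.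
assert (HA : 0 < A) by now apply Rabs_pos_lt, not_0_IZR.
assert (HD : 0 < D) by now apply Rabs_pos_lt, not_0_IZR.
assert (EA : A ^ 2 = IZR b ^ 2) by (unfold A; now rewrite pow2_abs).
assert (ED : D ^ 2 = IZR d ^ 2) by (unfold D; now rewrite pow2_abs).
destruct HG as [Hg [m Hm]]; unfold coprime_pair in Hg; cbn [fst snd] in *.
assert (Hsmall : ~ ((b = 1 \/ b = -1) /\ (d = 1 \/ d = -1))%Z).
{ intros [[-> | ->] [-> | ->]]; apply Hu; simpl; tauto. }
unfold rest_weight; cbn [fst snd]; unfold mu, lune_form; clear mu.
destruct (Rlt_dec 0 (IZR b * IZR d)) as [Hbd | Hbd].
- assert (HbdZ : (0 < b * d)%Z) by (apply lt_IZR; now rewrite mult_IZR).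
  replace (0 <? b * d)%Z with true by (symmetry; now apply Z.ltb_lt).
  assert (EAD : IZR b * IZR d = A * D).
  { unfold A, D; rewrite <- Rabs_mult, Rabs_pos_eq; lra. }
  replace (2 * IZR b ^ 2 - 2 * IZR b * IZR d + IZR d ^ 2)
    with (2 * A ^ 2 - 2 * (A * D) + D ^ 2) by (rewrite <- EAD, EA, ED; ring).
  replace (IZR b ^ 2 - IZR b * IZR d + IZR d ^ 2)
    with (A ^ 2 - A * D + D ^ 2) by (rewrite <- EAD, EA, ED; ring).
  set (mu := Rmin _ _).
  (* 26458/10000 is slightly above sqrt 7. In [S2], 828/1000 is just below 2 sqrt 2 - 2, the
     constant in 2 A^2 - 2 A D + D^2 >= (2 sqrt 2 - 2) A D, and 200/137 exceeds its inverse
     square. *)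
  assert (S1 : (D + 14143 / 10000 * A) ^ 2 <= (26458/10000) ^ 2 * mu).
  { unfold mu; apply Rmin_case.
    - assert (0 <= (A - 7/10 * D) ^ 2) by apply pow2_ge_0. nra.
    - assert (0 <= (A - D) ^ 2) by apply pow2_ge_0. nra. }
  assert (S2 : A ^ 2 * D ^ 2 <= 200/137 * mu ^ 2).
  { assert (828/1000 * (A * D) <= mu).
    { unfold mu; apply Rmin_case.
      - assert (0 <= (1414/1000 * A - D) ^ 2) by apply pow2_ge_0. nra.
      - assert (0 <= (A - D) ^ 2) by apply pow2_ge_0. nra. }
    assert (0 < A * D) by now apply Rmult_lt_0_compat.
    replace (A ^ 2 * D ^ 2) with ((A * D) ^ 2) by ring. nra. }
  assert (Hfin : forall c, c <= 155/1000 ->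
    c * (/ A ^ 2 * / D ^ 2) <= 2 / 100 * invsq (b, d) + 135 / 1000 * invsq (b, d)).
  { intros c Hc; rewrite EA, ED; change (/ IZR b ^ 2 * / IZR d ^ 2) with (invsq (b, d)). nra. }
  (* The rows +-(2, 1), where the form is 3, are treated apart because the general constants would
     need mu >= 5. *)
  assert (Hcase : (Z.abs b = 2 /\ Z.abs d = 1)%Z \/ 5 <= mu).
  { destruct (Z.eq_dec (Z.abs b) 2) as [B2 | B2];
      [destruct (Z.eq_dec (Z.abs d) 1) as [D1 | D1]; [now left |] |]; right.
    all: unfold mu; apply Rmin_case; rewrite EA, ED, <- EAD, !(pow_IZR _ 2);
      rewrite <- ?mult_IZR, <- ?minus_IZR, <- ?plus_IZR; apply IZR_le; change (Z.of_nat 2) with 2%Z.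
    all: assert (Hne : b = d -> Z.abs d = 1%Z) by
      (intros ->; rewrite Z.gcd_diag in Hg; exact Hg).
    all: destruct (Z_lt_le_dec 0 b); assert (0 < d \/ d < 0)%Z by lia.
    all: nia. }
  destruct Hcase as [[B2 D1] | Hmu].
  + assert (A2 : A = 2) by (unfold A; rewrite <- abs_IZR, B2; reflexivity).
    assert (D2 : D = 1) by (unfold D; rewrite <- abs_IZR, D1; reflexivity).
    assert (Emu : mu = 3).
    { unfold mu; rewrite A2, D2; rewrite Rmin_right; lra. }
    rewrite Emu in *; split; [lra |].
    eapply Rle_trans; [apply (weight_num A D 3 (26458/10000) (4/9) 3); try lra |].
    * rewrite A2, D2; lra.
    * apply Hfin; lra.
  + split; [lra |].
    eapply Rle_trans; [apply (weight_num A D mu (26458/10000) (200/137) 5); try lra |].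
    apply Hfin; lra.
- assert (HbdZ : ~ (0 < b * d)%Z) by (intros H; apply Hbd; rewrite <- mult_IZR; now apply IZR_lt).
  replace (0 <? b * d)%Z with false by (symmetry; apply Z.ltb_ge; lia).
  rewrite <- EA, <- ED.
  assert (Hmu : 5 <= A ^ 2 + D ^ 2).
  { rewrite EA, ED, !(pow_IZR _ 2), <- plus_IZR; apply IZR_le; change (Z.of_nat 2) with 2%Z. nia. }
  split; [lra |].
  eapply Rle_trans; [apply (weight_num A D (A ^ 2 + D ^ 2) (174/100) (1/4) 5); try lra |].
  + assert (0 <= (A - 14143/10000 * D) ^ 2) by apply pow2_ge_0. nra.
  + assert (0 <= (A ^ 2 - D ^ 2) ^ 2) by apply pow2_ge_0. nra.
  + rewrite EA, ED; change (/ IZR b ^ 2 * / IZR d ^ 2) with (invsq (b, d)). nra.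
Qed.

Lemma Cconj_neq0 (z : C) : z <> 0 -> Cconj z <> 0.
Proof. rewrite !Cmod_gt_0, Cmod_conj; auto. Qed.

Lemma even_row_term_axis (p : nat) (z : C) (u : Z * Z) : In u axis_pairs -> even_row_term p z u = RtoC 1.
Proof.
intros Hu; unfold even_row_term; rewrite Cpow_mult_r.
assert (E : ((RtoC (2 * IZR (fst u)) * z + RtoC (IZR (snd u))) ^ 2)%C = RtoC 1).
{ simpl in Hu; destruct Hu as [<- | [<- | []]]; cbn [fst snd];
  rewrite Rmult_0_r, Cmult_0_l, Cplus_0_l, <- RtoC_pow; f_equal; ring. }
rewrite E, Cpow_1_l; field; intros H; injection H; lra.
Qed.

Lemma odd_row_term_axis (p : nat) (z : C) (u : Z * Z) : In u axis_pairs ->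
  odd_row_term p z (swap u) = (/ (RtoC 2 ^ p * z ^ (2 * p)))%C.
Proof.
intros Hu; unfold odd_row_term; do 2 f_equal; rewrite !Cpow_mult_r; f_equal.
simpl in Hu; destruct Hu as [<- | [<- | []]]; unfold swap; cbn [fst snd]; simpl; ring.
Qed.

Lemma near_arc_nonzero (p : nat) (z : C) (s1 s2 : C) :
  (4 <= p)%nat -> 0 < Im z -> 1 < 2 * Cmod z ^ 2 -> Cmod z ^ 2 <= 1 -> -1/2 <= Re z <= 0 ->
  4 <= INR (2 * p) * (Cmod (RtoC 2 * z + 1) - 1) ->
  is_sum_over OddRight (even_row_term p z) s1 -> is_sum_over OddLeft (odd_row_term p z) s2 ->
  (s1 + s2)%C <> 0.
Proof.
intros Hp Hy Hq Hq1 Hx Hn H1 H2 E.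
assert (Hs := swap_sum p z s1 s2 H1 H2).
set (k := (2 * p)%nat) in *; set (q := Cmod z) in *.
(* The conjugate of F, because 2^p z^k = (sqrt 2 z)^k. *)
set (Phi := (1 - Cconj (/ (RtoC 2 ^ p * z ^ k)))%C).
apply (is_sum_over_scal _ Phi) in Hs; rewrite E, Cmult_0_r in Hs.
set (f := fun u => (Phi * (even_row_term p z u + odd_row_term p z (swap u)))%C) in Hs.
assert (Hz : z <> 0) by (intros ->; simpl in Hy; lra).
assert (Hqp : 0 < q) by now apply Cmod_gt_0.
assert (Hs2 : 0 < sqrt 2) by (apply sqrt_lt_R0; lra).
assert (Hss : sqrt 2 * sqrt 2 = 2) by (apply sqrt_sqrt; lra).
set (g := / (sqrt 2 * q)).
assert (Hg0 : 0 < g) by (apply Rinv_0_lt_compat; nra).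
assert (Hbeta : / (2 * q ^ 2) = g ^ 2).
{ unfold g; rewrite <- Hss at 1; field; lra. }
assert (Hb1 : g ^ 2 < 1).
{ rewrite <- Hbeta, <- Rinv_1; apply Rinv_lt_contravar; lra. }
assert (Hg1 : g <= 1) by nra.
(* This is 1 - beta^k with beta = g^2, the common factor against which every row is measured. *)
set (delta := (1 - g ^ 2) * hsum k 1 (g ^ 2)).
assert (Hdelta : delta = 1 - (g ^ 2) ^ k) by (unfold delta; rewrite hsum_telescope, pow1; ring).
assert (Hd0 : 0 < delta).
{ rewrite Hdelta; assert ((g ^ 2) ^ k < 1); [|lra].
  apply pow_lt_1_compat; [split; [apply pow2_ge_0 | lra] | unfold k; lia]. }
assert (Hrow : forall u, fst u <> 0%Z \/ snd u <> 0%Z -> forall w,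
   (let b := IZR (fst u) in let d := IZR (snd u) in
    let n := Cmod (RtoC (2 * b) * z + RtoC d) in
    let ns := Cmod (RtoC d * z + RtoC b) / q in
    / (n * ns) * (Rabs d * hsum k (/ n) (g ^ 2 / ns)
       + sqrt 2 * Rabs b * g ^ (k - 1) * hsum k (/ ns) (/ n)) <= w * hsum k 1 (g ^ 2)) ->
   - (delta * w) <= Re (f u)).
{ intros u Hu w Hw; cbv zeta in Hw.
  set (b := IZR (fst u)) in *; set (d := IZR (snd u)) in *.
  assert (Hbd : b <> 0 \/ d <> 0)
    by (destruct Hu as [Hu | Hu]; apply not_0_IZR in Hu; auto).
  destruct p as [|m]; [lia |].
  assert (P := pair_bound m z b d Hy Hq Hbd); cbv zeta in P.
  fold q in P; rewrite Hbeta in P; fold g in P; fold k in P.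
  unfold f, even_row_term, odd_row_term, swap, Phi; cbn [fst snd]; fold k b d.
  rewrite Cmult_comm; eapply Rle_trans; [apply Ropp_le_contravar | exact P].
  unfold delta; unfold Rdiv at 1; rewrite !Rmult_assoc.
  apply Rmult_le_compat_l; [lra |].
  rewrite <- Rmult_assoc, (Rmult_comm (hsum k 1 (g ^ 2))). rewrite <- !Rmult_assoc in *. exact Hw. }
set (W := fun u : Z * Z => (Rabs (IZR (snd u)) + sqrt 2 * Rabs (IZR (fst u)))).
assert (Hgen : forall u mu c, fst u <> 0%Z -> snd u <> 0%Z -> 1 <= mu ->
   mu <= lune_form (IZR (fst u)) (IZR (snd u)) -> W u / sqrt mu ^ 9 <= c ->
   - (delta * c) <= Re (f u)).
{ intros u mu c Hb Hd Hmu1 Hmu Hc.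
  destruct (lune_form_le z (IZR (fst u)) (IZR (snd u)) Hy Hq Hq1 Hx) as [L1 L2]; fold q in L2.
  assert (Hm1 : 1 <= sqrt mu) by (rewrite <- sqrt_1; apply sqrt_le_1; lra).
  apply Rle_trans with (- (delta * (W u / sqrt mu ^ (k + 1)))).
  { apply Ropp_le_contravar, Rmult_le_compat_l; [lra |].
    eapply Rle_trans; [| exact Hc]; unfold Rdiv; apply Rmult_le_compat_l.
    - unfold W; assert (P1 := Rabs_pos (IZR (fst u))); assert (P2 := Rabs_pos (IZR (snd u))); nra.
    - apply Rinv_le_contravar; [apply pow_lt; lra | apply Rle_pow; auto; unfold k; lia]. }
  apply Hrow; auto; cbv zeta; unfold W.
  apply weight_gen; try apply Rabs_pos; try lra; [unfold k; lia | |].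
  - rewrite <- (sqrt_pow2 (Cmod _)) by apply Cmod_ge_0; apply sqrt_le_1_alt; lra.
  - rewrite <- (sqrt_pow2 (Cmod _ / q)); [apply sqrt_le_1_alt; lra |].
    apply Rmult_le_pos; [apply Cmod_ge_0 | left; now apply Rinv_0_lt_compat]. }
assert (Hrest : forall u, OddRight u -> ~ In u (axis_pairs ++ unit_pairs) -> - (delta * rest_weight u) <= Re (f u)).
{ intros u HG Hu; destruct (rest_nonzero u HG Hu) as [Hb Hd].
  destruct (lune_form_rest u HG Hu) as [M1 M2].
  eapply Hgen; eauto; apply Rle_refl. }
assert (Hm1 : forall u, u = (1, -1)%Z \/ u = (-1, 1)%Z -> - (delta * (109/1000)) <= Re (f u)).
{ intros u Hu.
  assert (HA : Rabs (IZR (fst u)) = 1) by (rewrite <- abs_IZR; destruct Hu; subst; reflexivity).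
  assert (HD : Rabs (IZR (snd u)) = 1) by (rewrite <- abs_IZR; destruct Hu; subst; reflexivity).
  apply (Hgen u 2); try lra; try (destruct Hu; subst; discriminate).
  - unfold lune_form; destruct Hu; subst; cbn [fst snd];
      destruct (Rlt_dec 0 _); lra.
  - unfold W; rewrite HA, HD; eapply Rle_trans;
      [apply (weight_num 1 1 2 (174/100) (1/4) 2); lra | lra]. }
(* The only use of the cut k (|2 z + 1| - 1) >= 4: it fixes the weight at (1 + sqrt 2) / 4. *)
assert (Hcorner : forall u, u = (1, 1)%Z \/ u = (-1, -1)%Z ->
   - (delta * ((1 + sqrt 2) / 4)) <= Re (f u)).
{ intros u Hu.
  assert (HA : Rabs (IZR (fst u)) = 1) by (rewrite <- abs_IZR; destruct Hu; subst; reflexivity).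
  assert (HD : Rabs (IZR (snd u)) = 1) by (rewrite <- abs_IZR; destruct Hu; subst; reflexivity).
  apply Hrow; [left; destruct Hu; subst; discriminate |]; cbv zeta; rewrite HA, HD.
  set (n := Cmod (RtoC 2 * z + 1)) in *.
  assert (En : Cmod (RtoC (2 * IZR (fst u)) * z + RtoC (IZR (snd u))) = n).
  { unfold n; destruct Hu; subst; cbn [fst snd].
    - now rewrite Rmult_1_r.
    - rewrite <- Cmod_opp; f_equal; rewrite !RtoC_mult; ring. }
  rewrite En.
  assert (Hk : 0 < INR k) by (apply lt_0_INR; unfold k; lia).
  assert (Hn1 : 1 < n) by nra.
  eapply Rle_trans; [apply weight_main; try lra; [unfold k; lia |] |].
  - apply Rsqr_incr_0_var; [|apply Rmult_le_pos; [apply Cmod_ge_0 | left; now apply Rinv_0_lt_compat]].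
    rewrite !Rsqr_pow2; unfold Rdiv; rewrite Rpow_mult_distr, Cmod2_lin, pow_inv; fold q.
    replace ((IZR (snd u) ^ 2 * q ^ 2 + 2 * IZR (snd u) * IZR (fst u) * Re z + IZR (fst u) ^ 2) * / q ^ 2)
      with (1 + (1 + 2 * Re z) / q ^ 2)
      by (destruct Hu; subst; cbn [fst snd]; field; lra).
    assert (0 <= (1 + 2 * Re z) / q ^ 2)
      by (apply Rmult_le_pos; [lra | left; apply Rinv_0_lt_compat; nra]).
    lra.
  - apply Rmult_le_compat_r; [apply hsum_ge0; [lra | apply pow2_ge_0] |].
    unfold Rdiv; apply Rmult_le_compat_l; [lra |]; apply Rinv_le_contravar; lra. }
assert (Haxis : forall u, In u axis_pairs -> Re (f u) = delta).
{ intros u Hu; unfold f, Phi; rewrite even_row_term_axis, odd_row_term_axis by auto; fold k.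
  set (Y := (/ (RtoC 2 ^ p * z ^ k))%C).
  (* The second bracket is purely imaginary and the first is 1 - |Y|^2 = 1 - beta^k. *)
  replace ((1 - Cconj Y) * (1 + Y))%C with ((1 - Y * Cconj Y) + (Y - Cconj Y))%C by ring.
  rewrite <- Cmod2_conj, im_alt', Hdelta.
  assert (EY : Cmod Y ^ 2 = (g ^ 2) ^ k).
  { unfold Y; rewrite Cmod_inv, Cmod_mult, !Cmod_pow, Cmod_R, Rabs_pos_eq by
      (try (apply Cmult_neq_0; [apply Cpow2_R_neq0 | now apply Cpow_nz]); lra).
    fold q; rewrite <- Hbeta, pow_inv, pow_inv; f_equal.
    rewrite !Rpow_mult_distr, <- !pow_mult; f_equal; f_equal; unfold k; lia. }
  rewrite EY; destruct Y as [y1 y2]; simpl; ring. }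
assert (HR := Re_sum_ge OddRight f 0 (axis_pairs ++ unit_pairs) (fun u => delta * rest_weight u)
   (delta * (380/1000)) Hs NoDup_small OddRight_small Hrest).
assert (HR' : rsum (fun u => Re (f u)) (axis_pairs ++ unit_pairs) - delta * (380 / 1000) <= 0).
{ apply HR; intros l Hl1 Hl2; rewrite rsum_scal; apply Rmult_le_compat_l; [lra |].
  unfold rest_weight; rewrite rsum_plus, rsum_scal.
  assert (R1 := rest_sum l Hl1 Hl2).
  set (h := fun u : Z * Z => (0 <? fst u * snd u)%Z).
  assert (R2 : rsum invsq (filter h l) <= 13 / 6).
  { apply rest_sum_pos; [now apply NoDup_filter |].
    intros u Hu; apply filter_In in Hu; destruct Hu as [Hu Hh].
    rewrite Forall_forall in Hl2; destruct (Hl2 u Hu).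
    repeat split; try apply H; auto; now apply Z.ltb_lt. }
  assert (R3 : rsum (fun u => if (0 <? fst u * snd u)%Z then 135 / 1000 * invsq u else 0) l
     = 135 / 1000 * rsum invsq (filter h l)).
  { clear; induction l as [|u l IH]; [unfold rsum; simpl; ring |].
    unfold rsum in *; cbn [map fold_right filter]; rewrite IH; unfold h at 2.
    destruct (0 <? fst u * snd u)%Z; cbn [map fold_right]; ring. }
  rewrite R3; lra. }
rewrite rsum_app in HR'; unfold axis_pairs, unit_pairs, rsum in HR'; cbn [map fold_right] in HR'.
rewrite !Haxis in HR' by (simpl; auto).
assert (C1 := Hcorner (1, 1)%Z (or_introl eq_refl)).
assert (C2 := Hcorner (-1, -1)%Z (or_intror eq_refl)).
assert (C3 := Hm1 (1, -1)%Z (or_introl eq_refl)).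
assert (C4 := Hm1 (-1, 1)%Z (or_intror eq_refl)).
(* In units of [delta]: 2 from the axis pairs against 2 (1 + sqrt 2) / 4 <= 5/4, 2 * 109/1000 and
   380/1000, which leaves a positive remainder. *)
assert (sqrt 2 <= 3/2).
{ rewrite <- (sqrt_pow2 (3/2)) by lra; apply sqrt_le_1; lra. }
assert (delta * sqrt 2 <= delta * (3/2)) by (apply Rmult_le_compat_l; lra).
lra.
Qed.

(** * Points near the corner *)

(* [multichoose k n] is the coefficient of [t ^ n] in [(1 - t) ^ (- k)]. *)
Fixpoint multichoose (k n : nat) : R :=
  match n with O => 1 | S n' => multichoose k n' * (INR n' + INR k) / (INR n' + 1) end.

Lemma multichoose_ge0 k n : 0 <= multichoose k n.
Proof.
induction n as [|n IH]; simpl; [lra |].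
assert (H1 := pos_INR n); assert (H2 := pos_INR k).
apply Rmult_le_pos; [nra | left; apply Rinv_0_lt_compat; lra].
Qed.

Lemma multichoose_absorb k n : multichoose k (S n) * (INR n + 1) = INR k * multichoose (S k) n.
Proof.
induction n as [|n IH]; [simpl; field |].
change (multichoose k (S (S n))) with (multichoose k (S n) * (INR (S n) + INR k) / (INR (S n) + 1)).
change (multichoose (S k) (S n)) with (multichoose (S k) n * (INR n + INR (S k)) / (INR n + 1)).
assert (H1 := pos_INR n).
rewrite !S_INR in *.
transitivity (multichoose k (S n) * (INR n + 1) * (INR n + 1 + INR k) / (INR n + 1)); [field; lra |].
rewrite IH; field; lra.
Qed.

Lemma multichoose_pascal k n : multichoose (S k) (S n) = multichoose (S k) n + multichoose k (S n).
Proof.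
assert (H := multichoose_absorb k n); assert (H1 := pos_INR n).
change (multichoose (S k) (S n)) with (multichoose (S k) n * (INR n + INR (S k)) / (INR n + 1)).
apply Rmult_eq_reg_r with (INR n + 1); [|lra].
rewrite Rmult_plus_distr_r, H, S_INR; field; lra.
Qed.

Fixpoint csum (f : nat -> C) (N : nat) : C :=
  match N with O => RtoC 0 | S N' => (csum f N' + f N')%C end.

(** Multiplication by 1 - t lowers the order k + 1 of the binomial series to k, up to one boundary
    term; this drives the induction on k in [binomial_series]. *)
Lemma csum_telescope k (t : C) N :
  ((1 - t) * csum (fun n => RtoC (multichoose (S k) n) * t ^ n) (S N))%C =
  (csum (fun n => RtoC (multichoose k n) * t ^ n) (S N) - RtoC (multichoose (S k) N) * t ^ (S N))%C.
Proof.
induction N as [|N IH]; [simpl; ring |].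
change (csum (fun n => RtoC (multichoose (S k) n) * t ^ n)%C (S (S N))) with
  (csum (fun n => RtoC (multichoose (S k) n) * t ^ n) (S N) + RtoC (multichoose (S k) (S N)) * t ^ (S N))%C.
change (csum (fun n => RtoC (multichoose k n) * t ^ n)%C (S (S N))) with
  (csum (fun n => RtoC (multichoose k n) * t ^ n) (S N) + RtoC (multichoose k (S N)) * t ^ (S N))%C.
rewrite Cmult_plus_distr_l, IH, multichoose_pascal, RtoC_plus; simpl; ring.
Qed.

(** The real version of the same telescoping bounds all partial sums by (1 - rho)^(-k), hence each
    nonnegative term. *)
Lemma multichoose_pow_bounded k rho : 0 <= rho < 1 ->
  exists B, forall n, multichoose k n * rho ^ n <= B.
Proof.
intros Hr.
assert (H : forall j N, rsum (fun n => multichoose j n * rho ^ n) (seq 0 (S N)) <= (/ (1 - rho)) ^ j).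
{ assert (Hinv : 0 < / (1 - rho)) by (apply Rinv_0_lt_compat; lra).
  induction j as [|j IH]; intros N.
  - induction N as [|N IHN]; [unfold rsum; simpl; lra |].
    rewrite rsum_seq_S; replace (multichoose 0 (0 + S N)) with 0; [lra |].
    assert (A := multichoose_absorb 0 N); assert (P := pos_INR N); simpl INR in A.
    rewrite Rmult_0_l in A; destruct (Rmult_integral _ _ A); [auto | lra].
  - assert (T : (1 - rho) * rsum (fun n => multichoose (S j) n * rho ^ n) (seq 0 (S N)) =
        rsum (fun n => multichoose j n * rho ^ n) (seq 0 (S N)) - multichoose (S j) N * rho ^ (S N)).
    { clear IH; induction N as [|N IHN]; [unfold rsum; simpl; ring |].
      rewrite (rsum_seq_S _ _ (S N)), (rsum_seq_S (fun n => multichoose j n * rho ^ n) _ (S N)),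
        Rmult_plus_distr_l, IHN; change (0 + S N)%nat with (S N); rewrite multichoose_pascal; cbn [pow]. ring. }
    assert (P : 0 <= multichoose (S j) N * rho ^ S N).
    { apply Rmult_le_pos; [apply multichoose_ge0 | apply pow_le; lra]. }
    apply Rmult_le_reg_l with (1 - rho); [lra |].
    rewrite T; cbn [pow]; rewrite <- (Rmult_assoc (1 - rho)), Rinv_r, Rmult_1_l by lra; cbn [pow] in P.
    assert (I := IH N); lra. }
exists ((/ (1 - rho)) ^ k); intros n.
eapply Rle_trans; [| apply (H k n)].
rewrite rsum_seq_S; change (0 + n)%nat with n.
assert (0 <= rsum (fun n => multichoose k n * rho ^ n) (seq 0 n)); [|lra].
apply rsum_ge0; intros i _; apply Rmult_le_pos; [apply multichoose_ge0 | apply pow_le; lra].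
Qed.

Lemma multichoose_pow_lim k rho : 0 <= rho < 1 -> is_lim_seq (fun n => multichoose k n * rho ^ n) 0.
Proof.
intros Hr.
(* Any radius strictly between [rho] and 1 serves: boundedness there gives geometric decay at
   [rho]. *)
set (rho' := (1 + rho) / 2).
destruct (multichoose_pow_bounded k rho') as [B HB]; [unfold rho'; lra |].
assert (Hq : 0 <= rho / rho' < 1).
{ unfold rho'; split; [apply Rmult_le_pos; [lra | left; apply Rinv_0_lt_compat; lra] |].
  apply Rmult_lt_reg_r with ((1 + rho) / 2); [lra |]. unfold Rdiv at 1.
  rewrite Rmult_assoc, Rinv_l; lra. }
apply is_lim_seq_le_le with (u := fun _ => 0) (w := fun n => B * (rho / rho') ^ n).
- intros n; split.
  + apply Rmult_le_pos; [apply multichoose_ge0 | apply pow_le; lra].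
  + replace (rho ^ n) with (rho' ^ n * (rho / rho') ^ n).
    * rewrite <- Rmult_assoc; apply Rmult_le_compat_r; [apply pow_le; lra | apply HB].
    * rewrite <- Rpow_mult_distr; f_equal; field; unfold rho'; lra.
- apply is_lim_seq_const.
- replace (Finite 0) with (Rbar_mult B 0) by (simpl; f_equal; ring).
  apply is_lim_seq_scal_l, is_lim_seq_geom; rewrite Rabs_pos_eq; lra.
Qed.

Lemma one_minus_neq0 (t : C) : Cmod t < 1 -> (1 - t)%C <> 0.
Proof.
intros Ht E; assert (t = 1) by (replace t with (1 - (1 - t))%C by ring; rewrite E; ring).
subst t; rewrite Cmod_1 in Ht; lra.
Qed.

Lemma binomial_series k (t : C) : Cmod t < 1 ->
  is_lim_seq (fun N => Cmod (csum (fun n => RtoC (multichoose k n) * t ^ n) N - (/ (1 - t)) ^ k)%C) 0.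
Proof.
intros Ht.
assert (H1 := one_minus_neq0 t Ht).
apply is_lim_seq_incr_1.
induction k as [|k IH].
- apply is_lim_seq_ext with (u := fun _ => 0); [|apply is_lim_seq_const].
  intros N; simpl Cpow.
  replace (csum (fun n : nat => RtoC (multichoose 0 n) * t ^ n)%C (S N)) with (RtoC 1).
  + replace (1 - 1)%C with (RtoC 0) by ring; now rewrite Cmod_0.
  + induction N as [|N IHN]; [simpl; ring |].
    change (RtoC 1 = csum (fun n => RtoC (multichoose 0 n) * t ^ n) (S N) + RtoC (multichoose 0 (S N)) * t ^ (S N))%C.
    rewrite <- IHN; replace (multichoose 0 (S N)) with 0; [ring |].
    assert (A := multichoose_absorb 0 N); assert (P := pos_INR N); simpl INR in A.
    rewrite Rmult_0_l in A; destruct (Rmult_integral _ _ A); [auto | lra].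
- set (c := Cmod (/ (1 - t))).
  apply is_lim_seq_le_le with (u := fun _ => 0) (w := fun N =>
    c * (Cmod (csum (fun n => RtoC (multichoose k n) * t ^ n) (S N) - (/ (1 - t)) ^ k)%C
     + Cmod t * (multichoose (S k) N * Cmod t ^ N))).
  + intros N; split; [apply Cmod_ge_0 |].
    replace (csum (fun n => RtoC (multichoose (S k) n) * t ^ n) (S N) - (/ (1 - t)) ^ S k)%C with
      (/ (1 - t) * ((csum (fun n => RtoC (multichoose k n) * t ^ n) (S N) - (/ (1 - t)) ^ k)
        - RtoC (multichoose (S k) N) * t ^ (S N)))%C.
    * rewrite Cmod_mult; apply Rmult_le_compat_l; [apply Cmod_ge_0 |].
      unfold Cminus at 1; eapply Rle_trans; [apply Cmod_triangle |].
      rewrite Cmod_opp, !Cmod_mult, Cmod_pow, Cmod_R, Rabs_pos_eq by apply multichoose_ge0.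
      simpl pow; apply Req_le; ring.
    * assert (T := csum_telescope k t N).
      set (X := csum _ (S N)) in T |- *; set (Y := csum _ (S N)) in T |- *.
      set (I := (/ (1 - t))%C).
      assert (T' : X = (I * (Y - RtoC (multichoose (S k) N) * t ^ S N))%C)
        by (rewrite <- T; unfold I; field; auto).
      rewrite T', !Cpow_S; ring.
  + apply is_lim_seq_const.
  + replace (Finite 0) with (Rbar_mult c (Finite (0 + Cmod t * 0)))
      by (simpl; f_equal; ring).
    apply is_lim_seq_scal_l, is_lim_seq_plus'; [exact IH |].
    apply (is_lim_seq_scal_l _ (Cmod t) 0), multichoose_pow_lim; split; [apply Cmod_ge_0 | auto].
Qed.

(** * Limits of complex sequences and the four-section of the binomial series *)

Definition ccv (x : nat -> C) (l : C) : Prop := is_lim_seq (fun N => Cmod (x N - l)%C) 0.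

Lemma ccv_plus x y l m : ccv x l -> ccv y m -> ccv (fun N => (x N + y N)%C) (l + m)%C.
Proof.
intros Hx Hy; apply is_lim_seq_le_le with (u := fun _ => 0)
  (w := fun N => Cmod (x N - l) + Cmod (y N - m)).
- intros N; split; [apply Cmod_ge_0 |].
  replace (x N + y N - (l + m))%C with ((x N - l) + (y N - m))%C by ring.
  apply Cmod_triangle.
- apply is_lim_seq_const.
- replace (Finite 0) with (Finite (0 + 0)) by (f_equal; ring).
  now apply is_lim_seq_plus'.
Qed.

Lemma ccv_scal c x l : ccv x l -> ccv (fun N => (c * x N)%C) (c * l)%C.
Proof.
intros Hx; apply is_lim_seq_ext with (u := fun N => Cmod c * Cmod (x N - l)).
- intros N; rewrite <- Cmod_mult; f_equal; ring.
- replace (Finite 0) with (Rbar_mult (Cmod c) 0) by (simpl; f_equal; ring).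
  now apply is_lim_seq_scal_l.
Qed.

Lemma ccv_subseq phi x l : (forall n, (phi n < phi (S n))%nat) -> ccv x l ->
  ccv (fun N => x (phi N)) l.
Proof.
intros Hphi Hx.
apply (is_lim_seq_subseq (fun N => Cmod (x N - l)%C) 0 phi); auto.
now apply eventually_subseq.
Qed.

Lemma ccv_ext x y l : (forall N, x N = y N) -> ccv x l -> ccv y l.
Proof. intros E; apply is_lim_seq_ext; intros N; now rewrite E. Qed.

(** The bound is asked only from index 2 on, because the partial sums it is meant for must already
    contain their two dominant terms. *)
Lemma ccv_Re_ge x l B : ccv x l -> (forall N, B <= Re (x (S (S N)))) -> B <= Re l.
Proof.
intros Hx HB; apply Rnot_lt_le; intros Hlt.
do 2 apply is_lim_seq_incr_1 in Hx.
apply is_lim_seq_spec in Hx.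
assert (Hpos : 0 < B - Re l) by lra.
destruct (Hx (mkposreal _ Hpos)) as [N HN]; simpl in HN.
assert (H := HN N (Nat.le_refl N)); rewrite Rminus_0_r, Rabs_pos_eq in H by apply Cmod_ge_0.
assert (E := re_le_Cmod (x (S (S N)) - l)).
unfold Cminus in E; rewrite re_plus, re_opp in E; apply Rabs_le_between in E.
assert (H2 := HB N); unfold Cminus in H; lra.
Qed.

Definition minus_i : C := (- Ci)%C.

Lemma minus_i_pow4 : (minus_i ^ 4)%C = RtoC 1.
Proof. unfold minus_i, Ci; apply injective_projections; simpl; ring. Qed.

Definition minus_i_sum (n : nat) : C := (1 + minus_i ^ n + (minus_i ^ n) ^ 2 + (minus_i ^ n) ^ 3)%C.

Lemma minus_i_sum_4 q : minus_i_sum (4 * q) = RtoC 4.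
Proof.
unfold minus_i_sum; rewrite Cpow_mult_r, minus_i_pow4, !Cpow_1_l.
apply injective_projections; simpl; ring.
Qed.

Lemma minus_i_sum_0 q r : (1 <= r <= 3)%nat -> minus_i_sum (4 * q + r) = RtoC 0.
Proof.
intros Hr; unfold minus_i_sum; rewrite Cpow_add_r, Cpow_mult_r, minus_i_pow4, Cpow_1_l, Cmult_1_l.
assert (r = 1 \/ r = 2 \/ r = 3)%nat as [-> | [-> | ->]] by lia;
  unfold minus_i, Ci; apply injective_projections; simpl; ring.
Qed.

(* The term [/ (a - conj a * t) ^ (2 p)] summed over the rotations of order 4 of the [t]-disc,
   with their automorphy factors [minus_i ^ (j p)]. *)
Definition h_orbit (p : nat) (a t : C) : C :=
  let tau := (Cconj a * t / a)%C in
  (/ a ^ (2 * p) * ((/ (1 - tau)) ^ (2 * p) + minus_i ^ p * (/ (1 - minus_i * tau)) ^ (2 * p)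
    + (minus_i ^ 2) ^ p * (/ (1 - minus_i ^ 2 * tau)) ^ (2 * p)
    + (minus_i ^ 3) ^ p * (/ (1 - minus_i ^ 3 * tau)) ^ (2 * p)))%C.

Lemma Cmod_minus_i : Cmod minus_i = 1.
Proof. unfold minus_i; now rewrite Cmod_opp, Cmod_Ci. Qed.

(** A roots of unity filter: the coefficient of tau^n is multiplied by the sum of the powers of
    (-i)^(p + n), which is 4 when 4 divides p + n and 0 otherwise. Working in blocks of four terms
    leaves exactly one survivor per block. *)
Lemma four_section (k p n0 m : nat) (tau : C) (I : nat) :
  (n0 < 4)%nat -> (p + n0 = 4 * m)%nat ->
  let P := fun t => csum (fun n => RtoC (multichoose k n) * t ^ n)%C (4 * I) in
  (P tau + minus_i ^ p * P (minus_i * tau) + (minus_i ^ 2) ^ p * P (minus_i ^ 2 * tau) + (minus_i ^ 3) ^ p * P (minus_i ^ 3 * tau))%C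
  = (4 * csum (fun i => RtoC (multichoose k (n0 + 4 * i)) * tau ^ (n0 + 4 * i)) I)%C.
Proof.
intros Hn0 Hm; induction I as [|I IH]; intros P.
{ unfold P; simpl; ring. }
cbv zeta in IH.
assert (T : forall n, (RtoC (multichoose k n) * tau ^ n + minus_i ^ p * (RtoC (multichoose k n) * (minus_i * tau) ^ n)
  + (minus_i ^ 2) ^ p * (RtoC (multichoose k n) * (minus_i ^ 2 * tau) ^ n)
  + (minus_i ^ 3) ^ p * (RtoC (multichoose k n) * (minus_i ^ 3 * tau) ^ n))%C =
  (RtoC (multichoose k n) * tau ^ n * minus_i_sum (p + n))%C).
{ intros n; unfold minus_i_sum; rewrite !Cpow_mult_l, Cpow_add_r.
  rewrite <- !Cpow_mult_r, (Nat.mul_comm 2 p), (Nat.mul_comm 2 n),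
    (Nat.mul_comm 3 p), (Nat.mul_comm 3 n), !Cpow_mult_r; ring. }
assert (ES : forall t, P t = (csum (fun n => RtoC (multichoose k n) * t ^ n) (4 * I)
  + RtoC (multichoose k (4 * I)) * t ^ (4 * I) + RtoC (multichoose k (4 * I + 1)) * t ^ (4 * I + 1)
  + RtoC (multichoose k (4 * I + 2)) * t ^ (4 * I + 2) + RtoC (multichoose k (4 * I + 3)) * t ^ (4 * I + 3))%C).
{ intros t; unfold P; replace (4 * S I)%nat with (S (S (S (S (4 * I))))) by lia.
  replace (4 * I + 1)%nat with (S (4 * I)) by lia.
  replace (4 * I + 2)%nat with (S (S (4 * I))) by lia.
  replace (4 * I + 3)%nat with (S (S (S (4 * I)))) by lia.
  reflexivity. }
rewrite !ES; clear ES P.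
assert (T0 := T (4 * I)%nat); assert (T1 := T (4 * I + 1)%nat);
assert (T2 := T (4 * I + 2)%nat); assert (T3 := T (4 * I + 3)%nat); clear T.
cbn [csum]; rewrite (Cmult_plus_distr_l (RtoC 4)), <- IH; clear IH.
match type of T0 with ?l = _ => match type of T1 with ?l1 = _ =>
match type of T2 with ?l2 = _ => match type of T3 with ?l3 = _ =>
match goal with |- _ = (?g + _)%C => transitivity (g + (l + l1 + l2 + l3))%C; [ring |] end end end end end.
rewrite T0, T1, T2, T3; f_equal; clear T0 T1 T2 T3.
assert (n0 = 0 \/ n0 = 1 \/ n0 = 2 \/ n0 = 3)%nat as [-> | [-> | [-> | ->]]] by lia.
- replace (p + 4 * I)%nat with (4 * (m + I))%nat by lia.
  replace (p + (4 * I + 1))%nat with (4 * (m + I) + 1)%nat by lia.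
  replace (p + (4 * I + 2))%nat with (4 * (m + I) + 2)%nat by lia.
  replace (p + (4 * I + 3))%nat with (4 * (m + I) + 3)%nat by lia.
  rewrite minus_i_sum_4, !minus_i_sum_0 by lia; change (0 + 4 * I)%nat with (4 * I)%nat; ring.
- replace (p + 4 * I)%nat with (4 * (m + I - 1) + 3)%nat by lia.
  replace (p + (4 * I + 1))%nat with (4 * (m + I))%nat by lia.
  replace (p + (4 * I + 2))%nat with (4 * (m + I) + 1)%nat by lia.
  replace (p + (4 * I + 3))%nat with (4 * (m + I) + 2)%nat by lia.
  rewrite minus_i_sum_4, !minus_i_sum_0 by lia; rewrite (Nat.add_comm 1 (4 * I)); ring.
- replace (p + 4 * I)%nat with (4 * (m + I - 1) + 2)%nat by lia.
  replace (p + (4 * I + 1))%nat with (4 * (m + I - 1) + 3)%nat by lia.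
  replace (p + (4 * I + 2))%nat with (4 * (m + I))%nat by lia.
  replace (p + (4 * I + 3))%nat with (4 * (m + I) + 1)%nat by lia.
  rewrite minus_i_sum_4, !minus_i_sum_0 by lia; rewrite (Nat.add_comm 2 (4 * I)); ring.
- replace (p + 4 * I)%nat with (4 * (m + I - 1) + 1)%nat by lia.
  replace (p + (4 * I + 1))%nat with (4 * (m + I - 1) + 2)%nat by lia.
  replace (p + (4 * I + 2))%nat with (4 * (m + I - 1) + 3)%nat by lia.
  replace (p + (4 * I + 3))%nat with (4 * (m + I))%nat by lia.
  rewrite minus_i_sum_4, !minus_i_sum_0 by lia; rewrite (Nat.add_comm 3 (4 * I)); ring.
Qed.

Lemma h_orbit_series (p n0 m : nat) (a t : C) :
  (n0 < 4)%nat -> (p + n0 = 4 * m)%nat -> a <> 0 -> Cmod t < 1 ->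
  ccv (fun I => / a ^ (2 * p) * (4 * csum (fun i => RtoC (multichoose (2 * p) (n0 + 4 * i))
    * (Cconj a * t / a) ^ (n0 + 4 * i)) I))%C (h_orbit p a t).
Proof.
intros Hn0 Hm Ha Ht; unfold h_orbit; apply ccv_scal.
set (tau := (Cconj a * t / a)%C).
assert (Htau : Cmod tau < 1).
{ unfold tau; rewrite Cmod_div, Cmod_mult, Cmod_conj by auto.
  apply Cmod_gt_0 in Ha; replace (Cmod a * Cmod t / Cmod a) with (Cmod t) by (field; lra); auto. }
apply ccv_ext with (fun I => let P := fun t => csum (fun n => RtoC (multichoose (2 * p) n) * t ^ n)%C (4 * I) in
  (P tau + minus_i ^ p * P (minus_i * tau) + (minus_i ^ 2) ^ p * P (minus_i ^ 2 * tau) + (minus_i ^ 3) ^ p * P (minus_i ^ 3 * tau))%C).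
{ intros I; now apply four_section with (m := m). }
cbv zeta.
assert (S : forall t, Cmod t < 1 -> ccv (fun I => csum (fun n => RtoC (multichoose (2 * p) n) * t ^ n)%C (4 * I))
   ((/ (1 - t)) ^ (2 * p))%C).
{ intros t' Ht'; apply (ccv_subseq (fun I => 4 * I)%nat
    (fun N => csum (fun n => RtoC (multichoose (2 * p) n) * t' ^ n)%C N)); [intros; lia |].
  now apply binomial_series. }
repeat apply ccv_plus; [| apply ccv_scal | apply ccv_scal | apply ccv_scal]; apply S; auto;
  rewrite Cmod_mult, ?Cmod_pow, Cmod_minus_i, ?pow1, Rmult_1_l; auto.
Qed.

(** The bound |cos ((2 m + 1) theta)| <= (2 m + 1) |cos theta| in disguise. Each further factor s^2
    costs only a multiple of Re s, because Im (s^2) = 2 Re s Im s. *)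
Lemma Re_odd_pow (s : C) (m : nat) :
  Rabs (Re (s ^ (2 * m + 1))) <= (2 * INR m + 1) * Cmod s ^ (2 * m) * Rabs (Re s).
Proof.
induction m as [|m IH]; [change (2 * 0 + 1)%nat with 1%nat; rewrite Cpow_1_r; simpl INR; simpl pow; lra |].
replace (2 * S m + 1)%nat with ((2 * m + 1) + 2)%nat by lia.
replace (2 * S m)%nat with (2 * m + 2)%nat by lia.
rewrite Cpow_add_r, re_mult, S_INR, (pow_add _ _ 2).
set (w := (s ^ (2 * m + 1))%C) in *.
assert (Hw : Cmod w = Cmod s ^ (2 * m) * Cmod s)
  by (unfold w; rewrite Cmod_pow, pow_add, pow_1; reflexivity).
assert (H1 : Rabs (Re (s ^ 2)%C) <= Cmod s ^ 2) by (rewrite <- Cmod_pow; apply re_le_Cmod).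
assert (H2 : Rabs (Im (s ^ 2)%C) <= 2 * Rabs (Re s) * Cmod s).
{ replace (Im (s ^ 2)%C) with (2 * (Re s * Im s)) by (destruct s; simpl; ring).
  rewrite !Rabs_mult, (Rabs_pos_eq 2), Rmult_assoc by lra.
  apply Rmult_le_compat_l; [lra |]; apply Rmult_le_compat_l; [apply Rabs_pos |].
  eapply Rle_trans; [| apply Rmax_Cmod]; apply Rmax_r. }
assert (H3 : Rabs (Im w) <= Cmod w).
{ eapply Rle_trans; [| apply Rmax_Cmod]; apply Rmax_r. }
set (S := Cmod s) in *.
assert (HS : 0 <= S) by apply Cmod_ge_0.
assert (HSm : 0 <= S ^ (2 * m)) by now apply pow_le.
unfold Rminus; eapply Rle_trans; [apply Rabs_triang |].
rewrite Rabs_Ropp, !Rabs_mult.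
assert (A1 : Rabs (Re w) * Rabs (Re (s ^ 2)%C) <=
   ((2 * INR m + 1) * S ^ (2 * m) * Rabs (Re s)) * S ^ 2)
  by (apply Rmult_le_compat; auto using Rabs_pos).
assert (A2 : Rabs (Im w) * Rabs (Im (s ^ 2)%C) <= (S ^ (2 * m) * S) * (2 * Rabs (Re s) * S)).
{ rewrite Hw in H3; apply Rmult_le_compat; auto using Rabs_pos. }
lra.
Qed.

Lemma Re_csum f N : Re (csum f N) = rsum (fun i => Re (f i)) (seq 0 N).
Proof.
induction N as [|N IH]; [reflexivity |].
rewrite rsum_seq_S; simpl csum; now rewrite re_plus, IH.
Qed.

Lemma csum_scal c f N : csum (fun i => (c * f i)%C) N = (c * csum f N)%C.
Proof. induction N as [|N IH]; simpl; [ring | rewrite IH; ring]. Qed.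

Lemma csum_plus f g N : csum (fun i => (f i + g i)%C) N = (csum f N + csum g N)%C.
Proof. induction N as [|N IH]; simpl; [ring | rewrite IH; ring]. Qed.

(** Adding the orbit of conj a makes the coefficients real, namely 2 [g i]; with the 4 of the
    section this explains the factor 8. The exponents i = 0 and i = 1 contribute exact multiples of
    Re (t^2), whose sign depends on a and is left to [L]; [E2] bounds the rest. *)
Lemma h_orbit_sym_ge (p n0 m : nat) (a t : C) (E2 L : R) :
  (n0 < 4)%nat -> (p + n0 = 4 * m)%nat -> a <> 0 -> Cmod t < 1 -> 0 < Re (t ^ 2) ->
  let e := fun i => multichoose (2 * p) (n0 + 4 * i) in
  let g := fun i => Re (/ a ^ (2 * p) * (Cconj a / a) ^ (n0 + 4 * i))%C in
  let u := Cmod t ^ 4 in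
  (forall I, rsum (fun i => (2 * INR i - 1) * (e i * u ^ i)) (seq 2 I) <= E2) ->
  L <= e 0%nat * g 0%nat + e 1%nat * g 1%nat * u ->
  8 * Cmod t ^ (2 * n0) * Re (t ^ 2) * (L - / Cmod a ^ (2 * p) * E2) <=
  Re ((h_orbit p a t + h_orbit p (Cconj a) t) * Cconj t ^ (n0 + 2)).
Proof.
intros Hn0 Hm Ha Ht HX e g u HE2 HL.
assert (Hac := Cconj_neq0 a Ha).
assert (H1 := h_orbit_series p n0 m a t Hn0 Hm Ha Ht).
assert (H2 := h_orbit_series p n0 m (Cconj a) t Hn0 Hm Hac Ht).
rewrite Cconj_conj in H2.
assert (H3 := ccv_scal (Cconj t ^ (n0 + 2))%C _ _ (ccv_plus _ _ _ _ H1 H2)).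
rewrite (Cmult_comm (h_orbit p a t + _)).
set (s := (t ^ 2)%C) in *; set (X := Re s) in *.
set (rho := Cmod t) in *.
assert (Hrho : 0 <= rho) by apply Cmod_ge_0.
(* t^(n0 + 4 i) times the conjugate of t^(n0 + 2) is |t|^(2 n0) s^(2 i) conj s, and for i >= 1 this
   is a positive multiple of the odd power s^(2 i - 1). *)
set (th := fun i => Re (s ^ (2 * i) * Cconj s)%C).
set (M := / Cmod a ^ (2 * p)).
assert (HM : 0 < M) by (apply Rinv_0_lt_compat, pow_lt; now apply Cmod_gt_0).
assert (Hcc : (t * Cconj t)%C = RtoC (rho ^ 2)) by (unfold rho; now rewrite Cmod2_conj).
eapply ccv_Re_ge; [exact H3 |].
intros N.
cbv beta.
apply Rle_trans with (rsum (fun i => 8 * rho ^ (2 * n0) * (e i * g i * th i)) (seq 0 (S (S N)))).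
2:{ apply Req_le; symmetry; rewrite <- !csum_scal, <- csum_plus, <- csum_scal, Re_csum.
  apply Rle_antisym; apply rsum_le; intros i _; apply Req_le; [| symmetry].
  all: transitivity (Re (RtoC (4 * e i * (2 * g i) * rho ^ (2 * n0)) * (s ^ (2 * i) * Cconj s))%C);
    [| rewrite re_scal_l; unfold th; ring].
  all: f_equal; set (n := (n0 + 4 * i)%nat).
  all: transitivity (4 * RtoC (e i) * (/ a ^ (2 * p) * (Cconj a / a) ^ n + / Cconj a ^ (2 * p) * (a / Cconj a) ^ n)
    * (t ^ n * Cconj t ^ (n0 + 2)))%C;
   [unfold e; fold n; replace (Cconj a * t / a)%C with (Cconj a / a * t)%C by (field; auto);
    replace (a * t / Cconj a)%C with (a / Cconj a * t)%C by (field; auto);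
    rewrite !Cpow_mult_l; ring |].
  all: assert (EG : (/ a ^ (2 * p) * (Cconj a / a) ^ n + / Cconj a ^ (2 * p) * (a / Cconj a) ^ n)%C
     = RtoC (2 * g i)) by
   (unfold g; fold n; set (c := (/ a ^ (2 * p) * (Cconj a / a) ^ n)%C);
    replace (/ Cconj a ^ (2 * p) * (a / Cconj a) ^ n)%C with (Cconj c) by
     (unfold c; rewrite Cmult_conj, Cinv_conj, !Cpow_conj, Cdiv_conj, Cconj_conj by
       (try apply Cpow_nz; auto); reflexivity);
    destruct c as [c1 c2]; apply injective_projections; simpl; ring).
  all: rewrite EG; clear EG.
  all: assert (ET : (t ^ n * Cconj t ^ (n0 + 2))%C = (RtoC (rho ^ (2 * n0)) * (s ^ (2 * i) * Cconj s))%C) by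
   (unfold n, s; rewrite !Cpow_add_r, Cpow_conj, <- Cpow_mult_r;
    replace (2 * (2 * i))%nat with (4 * i)%nat by lia;
    replace (RtoC (rho ^ (2 * n0))) with (t ^ n0 * Cconj t ^ n0)%C by
     (rewrite <- Cpow_mult_l, Hcc, <- RtoC_pow, <- pow_mult; reflexivity); ring).
  all: rewrite ET, !RtoC_mult; ring. }
assert (Hs : Cmod s = rho ^ 2) by (unfold s; now rewrite Cmod_pow).
assert (Hth : forall i, th (S i) = Cmod s ^ 2 * Re (s ^ (2 * i + 1))%C).
{ intros i; unfold th; replace (2 * S i)%nat with ((2 * i + 1) + 1)%nat by lia.
  rewrite (Cpow_add_r s (2 * i + 1)), Cpow_1_r, <- Cmult_assoc, <- Cmod2_conj, re_scal_r; ring. }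
assert (Hg : forall i, Rabs (g i) <= M).
{ intros i; unfold g; eapply Rle_trans; [apply re_le_Cmod |].
  rewrite Cmod_mult, Cmod_inv, !Cmod_pow, Cmod_div, Cmod_conj by (try apply Cpow_nz; auto).
  apply Cmod_gt_0 in Ha; unfold Rdiv; rewrite Rinv_r, pow1, Rmult_1_r by lra; apply Rle_refl. }
assert (He : forall i, 0 <= e i) by (intros i; apply multichoose_ge0).
assert (Hu : 0 <= u) by now apply pow_le.
assert (Hb : forall i, (1 <= i)%nat -> Rabs (th i) <= (2 * INR i - 1) * u ^ i * X).
{ intros [|i] Hi; [lia |]; rewrite Hth, Rabs_mult, Rabs_pos_eq by apply pow2_ge_0.
  assert (P := Re_odd_pow s i); rewrite (Rabs_pos_eq (Re s)) in P by (unfold X in HX; lra).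
  fold X in P; rewrite S_INR.
  replace ((2 * (INR i + 1) - 1) * u ^ S i * X) with
    (Cmod s ^ 2 * ((2 * INR i + 1) * Cmod s ^ (2 * i) * X)).
  - apply Rmult_le_compat_l; [apply pow2_ge_0 | exact P].
  - assert (Eu : u = Cmod s ^ 2) by (rewrite Hs, <- pow_mult; reflexivity).
    rewrite Eu, pow_mult; simpl; ring. }
rewrite (rsum_scal (8 * rho ^ (2 * n0)) (fun i => e i * g i * th i)).
rewrite (Rmult_assoc (8 * rho ^ (2 * n0))).
apply Rmult_le_compat_l.
{ apply Rmult_le_pos; [lra | now apply pow_le]. }
change (seq 0 (S (S N))) with (0%nat :: 1%nat :: seq 2 N).
unfold rsum; cbn [map fold_right]; fold (rsum (fun i => e i * g i * th i) (seq 2 N)).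
assert (Eth0 : th 0%nat = X) by (unfold th; change (s ^ (2 * 0))%C with (RtoC 1); now rewrite Cmult_1_l, re_conj).
assert (Eth1 : th 1%nat = u * X).
{ rewrite Hth; change (2 * 0 + 1)%nat with 1%nat; rewrite Cpow_1_r; fold X; unfold u; rewrite Hs; ring. }
rewrite Eth0, Eth1.
assert (Hrem : - (M * X) * rsum (fun i => (2 * INR i - 1) * (e i * u ^ i)) (seq 2 N)
   <= rsum (fun i => e i * g i * th i) (seq 2 N)).
{ rewrite <- rsum_scal; apply rsum_le; intros i Hi; apply in_seq in Hi.
  assert (B1 := Hb i ltac:(lia)); assert (B2 := Hg i).
  assert (B3 : Rabs (g i * th i) <= M * ((2 * INR i - 1) * u ^ i * X))
    by (rewrite Rabs_mult; apply Rmult_le_compat; auto using Rabs_pos).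
  apply Rabs_le_between in B3.
  assert (e i * - (M * ((2 * INR i - 1) * u ^ i * X)) <= e i * (g i * th i))
    by (apply Rmult_le_compat_l; [apply He | lra]).
  lra. }
assert (HMX : 0 < M * X) by now apply Rmult_lt_0_compat.
assert (A1 := HE2 N).
assert (A2 : M * X * rsum (fun i => (2 * INR i - 1) * (e i * u ^ i)) (seq 2 N) <= M * X * E2)
  by (apply Rmult_le_compat_l; lra).
assert (A3 : X * L <= X * (e 0%nat * g 0%nat + e 1%nat * g 1%nat * u))
  by (apply Rmult_le_compat_l; lra).
lra.
Qed.

(* [corner_t] is the Cayley coordinate at the corner [(-1 + i) / 2], and [alpha (b, d)] is the
   value at this corner of the row [2 b z + d]: that row is
   [(alpha - conj alpha * t) / (1 - t)]. *)
Definition alpha (u : Z * Z) : C := (IZR (snd u) - IZR (fst u), IZR (fst u)).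

Definition corner_t (z : C) : C := ((RtoC 2 * z + 1 - Ci) / (RtoC 2 * z + 1 + Ci))%C.

Lemma corner_den (z : C) : 0 < Im z -> (RtoC 2 * z + 1 + Ci)%C <> 0.
Proof.
intros Hy E; apply (f_equal Im) in E; destruct z as [x y]; simpl in *; lra.
Qed.

(** W is |2 z + 1 + i|^2, the denominator left after rationalising. *)
Lemma corner_t_coords (z : C) : 0 < Im z ->
  let r := Cmod z ^ 2 in let x := Re z in let y := Im z in
  let W := 4 * r + 4 * x + 2 + 4 * y in
  0 < W /\ corner_t z = (4 * (r + x) / W, - (4 * x + 2) / W).
Proof.
intros Hy r x y W.
assert (Er : r = x ^ 2 + y ^ 2) by apply Cmod2_alt.
assert (HW : 0 < W).
{ unfold W; rewrite Er; assert (0 <= (2 * x + 1) ^ 2) by apply pow2_ge_0.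
  assert (0 < y) by exact Hy. nra. }
split; [exact HW |].
unfold corner_t; assert (Hd := corner_den z Hy).
assert (E : (RtoC 2 * z + 1 - Ci)%C =
   ((4 * (r + x) / W, - (4 * x + 2) / W)%R * (RtoC 2 * z + 1 + Ci))%C).
{ destruct z as [x' y']; unfold x, y, Re, Im in *; simpl fst in *; simpl snd in *.
  apply injective_projections; simpl.
  - apply Rmult_eq_reg_r with W; [|lra]. field_simplify; [|lra]. unfold W; rewrite Er; ring.
  - apply Rmult_eq_reg_r with W; [|lra]. field_simplify; [|lra]. unfold W; rewrite Er; ring. }
rewrite E; field; auto.
Qed.

Lemma corner_row (z a : C) : 0 < Im z ->
  (1 - corner_t z)%C <> 0 /\
  ((a - Cconj a * corner_t z) / (1 - corner_t z) =
    RtoC (2 * Im a) * z + RtoC (Re a + Im a))%C.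
Proof.
intros Hy; assert (Hd := corner_den z Hy); unfold corner_t.
set (w := (RtoC 2 * z + 1 + Ci)%C) in *.
assert (HCi : Ci <> 0) by (intros E; injection E; lra).
assert (N2 : RtoC 2 <> 0) by (intros E; injection E; lra).
replace (RtoC 2 * z + 1 - Ci)%C with (w - RtoC 2 * Ci)%C by (unfold w; ring).
assert (E1 : (1 - (w - RtoC 2 * Ci) / w)%C = (RtoC 2 * Ci / w)%C) by (field; auto).
rewrite E1; split.
{ unfold Cdiv; repeat apply Cmult_neq_0; auto.
  intros E; assert ((w * / w)%C = 0) by (rewrite E; ring).
  rewrite Cinv_r in H; auto; injection H; lra. }
transitivity (((a - Cconj a) * w / (RtoC 2 * Ci)) + Cconj a)%C; [field; auto |].
rewrite im_alt'.
transitivity (RtoC (Im a) * w + Cconj a)%C; [field; auto |].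
unfold w; destruct a as [a1 a2], z as [x y]; unfold Ci, Cconj.
apply injective_projections; simpl; ring.
Qed.

(** The orbit of the row (b, d) under the stabiliser of the corner: once the odd rows are scaled by
    sqrt 2, the values at the corner are [alpha] times the powers 0 to 3 of the eighth root of unity
    (1 + i) / sqrt 2. *)
Definition four_rows (p : nat) (z : C) (u : Z * Z) : C :=
  let b := fst u in let d := snd u in
  (even_row_term p z (b, d) + odd_row_term p z (d, d - b)%Z + even_row_term p z (d - b, d - 2 * b)%Z
   + odd_row_term p z (d - 2 * b, - b)%Z)%C.

Lemma alpha_neq0 (u : Z * Z) : fst u <> 0%Z \/ snd u <> 0%Z -> alpha u <> 0.
Proof.
destruct u as [b d]; intros H E; unfold alpha in E; simpl in *; injection E; intros E1 E2.
rewrite <- minus_IZR in E2; apply eq_IZR in E1; apply eq_IZR in E2; lia.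
Qed.

Lemma Cmod_corner_t_lt1 (z : C) : 0 < Im z -> Cmod (corner_t z) < 1.
Proof.
intros Hy; assert (Hd := corner_den z Hy); unfold corner_t; rewrite Cmod_div by auto.
apply Cmod_gt_0 in Hd.
apply Rmult_lt_reg_r with (Cmod (RtoC 2 * z + 1 + Ci)); auto.
unfold Rdiv; rewrite Rmult_assoc, Rinv_l, Rmult_1_l, Rmult_1_r by lra.
apply Rsqr_incrst_0; try apply Cmod_ge_0.
rewrite !Rsqr_pow2, !Cmod2_alt; destruct z as [x y]; simpl in *; nra.
Qed.

Lemma Cinv_pow2 (x : C) (p : nat) : x <> 0 -> (/ x ^ (2 * p))%C = ((/ (x * x)) ^ p)%C.
Proof.
intros Hx; rewrite Cpow_mult_r, <- Cpow_inv by (apply Cpow_nz; auto).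
do 2 f_equal; simpl; ring.
Qed.

Lemma four_rows_orbit (p : nat) (z : C) (u : Z * Z) : 0 < Im z ->
  fst u <> 0%Z \/ snd u <> 0%Z ->
  four_rows p z u = ((1 - corner_t z) ^ (2 * p) * h_orbit p (alpha u) (corner_t z))%C.
Proof.
intros Hy Hu.
assert (Ha := alpha_neq0 u Hu).
assert (Ht := Cmod_corner_t_lt1 z Hy).
assert (Hrow := fun a => proj2 (corner_row z a Hy)).
assert (H1t := proj1 (corner_row z 0 Hy)).
set (t := corner_t z) in *.
unfold h_orbit; set (a := alpha u) in *; set (tau := (Cconj a * t / a)%C).
assert (Htau : Cmod tau < 1).
{ unfold tau; rewrite Cmod_div, Cmod_mult, Cmod_conj by auto.
  apply Cmod_gt_0 in Ha; replace (Cmod a * Cmod t / Cmod a) with (Cmod t) by (field; lra); auto. }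
assert (K0 : (1 - tau)%C <> 0) by now apply one_minus_neq0.
assert (K1 : (1 - minus_i * tau)%C <> 0).
{ apply one_minus_neq0; now rewrite Cmod_mult, Cmod_minus_i, Rmult_1_l. }
assert (K2 : (1 - minus_i ^ 2 * tau)%C <> 0).
{ apply one_minus_neq0; now rewrite Cmod_mult, Cmod_pow, Cmod_minus_i, pow1, Rmult_1_l. }
assert (K3 : (1 - minus_i ^ 3 * tau)%C <> 0).
{ apply one_minus_neq0; now rewrite Cmod_mult, Cmod_pow, Cmod_minus_i, pow1, Rmult_1_l. }
assert (N2 : RtoC 2 <> 0) by (intros E; injection E; lra).
assert (HCi : Ci <> 0) by (intros E; injection E; lra).
assert (HCi2 : (Ci * Ci)%C = (- (1))%C) by (unfold Ci; apply injective_projections; simpl; ring).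
assert (Hv : (/ Ci)%C = minus_i).
{ transitivity (Ci / (Ci * Ci))%C; [field; auto |]; rewrite HCi2; unfold minus_i.
  field; intros E; injection E; lra. }
assert (Hatau : (Cconj a * t)%C = (a * tau)%C) by (unfold tau; field; auto).
(* Each row comes from [corner_row] applied to c a with c = 1, i, 1 + i or (1 + i) i. The quotient
   conj c / c is a power of -i and rotates [tau], while 1 / c^2, or 2 / c^2 for the odd rows, yields
   the automorphy factor. *)
assert (R0 : (RtoC (2 * IZR (fst u)) * z + RtoC (IZR (snd u)))%C = (a * (1 - tau) / (1 - t))%C).
{ transitivity ((a - Cconj a * t) / (1 - t))%C; [|rewrite Hatau; field; auto].
  rewrite Hrow; unfold a, alpha; simpl Im; simpl Re; do 2 f_equal; ring. }
assert (R2 : (RtoC (2 * (IZR (snd u) - IZR (fst u))) * z + RtoC (IZR (snd u) - 2 * IZR (fst u)))%C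
   = (Ci * a * (1 - minus_i ^ 2 * tau) / (1 - t))%C).
{ transitivity ((Ci * a - Cconj (Ci * a) * t) / (1 - t))%C.
  - rewrite Hrow; unfold a, alpha, Ci; simpl Im; simpl Re; f_equal; [f_equal|]; f_equal; ring.
  - rewrite Cmult_conj, <- (Cmult_assoc _ (Cconj a) t), Hatau.
    replace (Cconj Ci) with (- Ci)%C by (unfold Ci, Cconj; apply injective_projections; simpl; ring).
    replace (minus_i ^ 2)%C with (- (1))%C by (rewrite <- HCi2; unfold minus_i; ring).
    field; auto. }
assert (R1 : (RtoC 2 * (RtoC (IZR (snd u)) * z + RtoC (IZR (snd u) - IZR (fst u))))%C
   = ((1 + Ci) * a * (1 - minus_i * tau) / (1 - t))%C).
{ transitivity (((1 + Ci) * a - Cconj ((1 + Ci) * a) * t) / (1 - t))%C.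
  - rewrite Hrow; unfold a, alpha, Ci; destruct z as [x y];
    apply injective_projections; simpl; ring.
  - rewrite Cmult_conj, <- (Cmult_assoc _ (Cconj a) t), Hatau.
    replace (Cconj (1 + Ci)) with ((1 + Ci) * minus_i)%C
      by (unfold minus_i, Ci, Cconj; apply injective_projections; simpl; ring).
    field; auto. }
assert (R3 : (RtoC 2 * (RtoC (IZR (snd u) - 2 * IZR (fst u)) * z + RtoC (- IZR (fst u))))%C
   = ((1 + Ci) * Ci * a * (1 - minus_i ^ 3 * tau) / (1 - t))%C).
{ transitivity (((1 + Ci) * Ci * a - Cconj ((1 + Ci) * Ci * a) * t) / (1 - t))%C.
  - rewrite Hrow; unfold a, alpha, Ci; destruct z as [x y];
    apply injective_projections; simpl; ring.
  - rewrite (Cmult_conj _ a), <- (Cmult_assoc _ (Cconj a) t), Hatau.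
    replace (Cconj ((1 + Ci) * Ci)) with ((1 + Ci) * Ci * minus_i ^ 3)%C
      by (unfold minus_i, Ci, Cconj; apply injective_projections; simpl; ring).
    field; auto. }
assert (H2i : ((1 + Ci) * (1 + Ci))%C = (RtoC 2 * Ci)%C)
  by (unfold Ci; apply injective_projections; simpl; ring).
assert (H1i : (1 + Ci)%C <> 0) by (intros E; apply (f_equal Re) in E; simpl in E; lra).
assert (Hhalf : forall X Y, (RtoC 2 * X)%C = Y -> X = (Y / RtoC 2)%C)
  by (intros X Y <-; field; auto).
apply Hhalf in R1; apply Hhalf in R3.
unfold four_rows, even_row_term, odd_row_term; cbn [fst snd].
rewrite !minus_IZR, mult_IZR, opp_IZR, R0, R1, R2, R3.
rewrite <- (Cpow_inv a) by auto.
assert (Q : forall c x : C, c <> 0 -> x <> 0 ->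
  (/ (c * a * x / (1 - t)) ^ (2 * p))%C =
    ((/ (c * c)) ^ p * ((1 - t) ^ (2 * p) * ((/ a) ^ (2 * p) * (/ x) ^ (2 * p))))%C).
{ intros c x Hc Hx.
  rewrite Cinv_pow2 by (unfold Cdiv; repeat apply Cmult_neq_0; auto;
    intros E; assert (Z : ((1 - t) * / (1 - t))%C = 0) by (rewrite E; ring);
    rewrite Cinv_r in Z; auto; injection Z; lra).
  rewrite !Cpow_mult_r, <- !Cpow_mult_l; f_equal; simpl; field; auto. }
assert (Q2 : forall c x : C, c <> 0 -> x <> 0 ->
  (/ (RtoC 2 ^ p * (c * a * x / (1 - t) / RtoC 2) ^ (2 * p)))%C =
    ((RtoC 2 / (c * c)) ^ p * ((1 - t) ^ (2 * p) * ((/ a) ^ (2 * p) * (/ x) ^ (2 * p))))%C).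
{ intros c x Hc Hx.
  replace (c * a * x / (1 - t) / RtoC 2)%C with ((c / RtoC 2) * a * x / (1 - t))%C by (field; auto).
  assert (Hc2 : (c / RtoC 2)%C <> 0).
  { intros E; apply Hc; transitivity (RtoC 2 * (c / RtoC 2))%C; [field; auto | rewrite E; ring]. }
  assert (N2p := Cpow2_R_neq0 p).
  assert (Hrow0 : (c / RtoC 2 * a * x / (1 - t))%C <> 0).
  { intros E; apply (Cmult_neq_0 _ _ (Cmult_neq_0 _ _ Hc2 Ha) Hx).
    transitivity ((c / RtoC 2 * a * x / (1 - t)) * (1 - t))%C; [field; auto | rewrite E; ring]. }
  transitivity (/ RtoC 2 ^ p * / (c / RtoC 2 * a * x / (1 - t)) ^ (2 * p))%C.
  { field; split; auto; now apply Cpow_nz. }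
  rewrite Q by auto.
  rewrite !Cmult_assoc, <- Cpow_inv by auto; do 3 f_equal.
  rewrite <- Cpow_mult_l; f_equal; field; auto. }
replace (a * (1 - tau) / (1 - t))%C with (1 * a * (1 - tau) / (1 - t))%C by (field; auto).
rewrite !Q, !Q2 by (try apply Cmult_neq_0; auto; intros E; injection E; lra).
replace (/ (1 * 1))%C with (RtoC 1) by (field; intros E; injection E; lra).
replace (RtoC 2 / ((1 + Ci) * (1 + Ci)))%C with minus_i by (rewrite H2i, <- Hv; field; auto).
replace (/ (Ci * Ci))%C with (minus_i ^ 2)%C by (rewrite <- Hv; field; auto).
replace (RtoC 2 / ((1 + Ci) * Ci * ((1 + Ci) * Ci)))%C with (minus_i ^ 3)%C.
2:{ replace ((1 + Ci) * Ci * ((1 + Ci) * Ci))%C with (((1 + Ci) * (1 + Ci)) * (Ci * Ci))%C by ring.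
    rewrite H2i, <- Hv; field; auto. }
rewrite Cpow_1_l; ring.
Qed.

(** * Symmetries of the set of rows and the estimate in the disc around the corner *)

Lemma coprime_lin (b d b' d' i j k l : Z) : Z.gcd b d = 1%Z ->
  (b = i * b' + j * d')%Z -> (d = k * b' + l * d')%Z -> Z.gcd b' d' = 1%Z.
Proof.
intros Hg Hb Hd; apply Z.gcd_bezout in Hg; destruct Hg as [x [y Hxy]].
apply Z.bezout_1_gcd; exists (x * i + y * k)%Z, (x * j + y * l)%Z; rewrite Hb, Hd in Hxy; lia.
Qed.

(** The action on rows of the reflection z -> -1 - conj z, which fixes the corner; it conjugates
    [alpha]. *)
Definition conj_row (u : Z * Z) : Z * Z := (- fst u, snd u - 2 * fst u)%Z.

Lemma conj_row_bij (u : Z * Z) : OddRight u -> OddRight (conj_row u) /\ conj_row (conj_row u) = u.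
Proof.
destruct u as [b d]; intros [Hg [m Hm]]; unfold conj_row; cbn [fst snd] in *; split.
- split; unfold coprime_pair in *; cbn [fst snd] in *.
  + apply (coprime_lin b d _ _ (-1) 0 (-2) 1); auto; lia.
  + exists (m - b)%Z; lia.
- f_equal; lia.
Qed.

(** Each of the four rows runs bijectively through its whole family, two through the even rows and
    two through the odd ones, so each series is counted twice. *)
Lemma four_rows_sum (p : nat) (z : C) (s1 s2 : C) :
  is_sum_over OddRight (even_row_term p z) s1 -> is_sum_over OddLeft (odd_row_term p z) s2 ->
  is_sum_over OddRight (four_rows p z) (RtoC 2 * (s1 + s2))%C.
Proof.
intros H1 H2; replace (RtoC 2 * (s1 + s2))%C with (s1 + s2 + s1 + s2)%C
  by (apply injective_projections; simpl; ring).
unfold four_rows; apply is_sum_over_plus;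
  [apply is_sum_over_plus; [apply is_sum_over_plus |] |].
- apply is_sum_over_ext with (even_row_term p z); auto; now intros [b d] _.
- apply (is_sum_over_bij OddRight OddLeft (fun u => (snd u, snd u - fst u)%Z)
    (fun u => (fst u - snd u, fst u)%Z)); auto.
  + intros [b d] [Hg [m Hm]]; unfold coprime_pair in *; cbn [fst snd] in *.
    split; [split; [unfold coprime_pair; cbn [fst snd] |exists m; cbn [fst]; lia] | f_equal; lia].
    apply (coprime_lin b d _ _ 1 (-1) 1 0); auto; lia.
  + intros [b d] [Hg [m Hm]]; unfold coprime_pair in *; cbn [fst snd] in *.
    split; [split; [unfold coprime_pair; cbn [fst snd] |exists m; cbn [snd]; lia] | f_equal; lia].
    apply (coprime_lin b d _ _ 0 1 (-1) 1); auto; lia.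
- apply (is_sum_over_bij OddRight OddRight (fun u => (snd u - fst u, snd u - 2 * fst u)%Z)
    (fun u => (fst u - snd u, 2 * fst u - snd u)%Z)); auto.
  + intros [b d] [Hg [m Hm]]; unfold coprime_pair in *; cbn [fst snd] in *.
    split; [split; [unfold coprime_pair; cbn [fst snd] |exists (m - b)%Z; cbn [snd]; lia] | f_equal; lia].
    apply (coprime_lin b d _ _ 1 (-1) 2 (-1)); auto; lia.
  + intros [b d] [Hg [m Hm]]; unfold coprime_pair in *; cbn [fst snd] in *.
    split; [split; [unfold coprime_pair; cbn [fst snd] |exists (b - m - 1)%Z; cbn [snd]; lia] | f_equal; lia].
    apply (coprime_lin b d _ _ (-1) 1 (-2) 1); auto; lia.
- apply (is_sum_over_bij OddRight OddLeft (fun u => (snd u - 2 * fst u, - fst u)%Z)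
    (fun u => (- snd u, fst u - 2 * snd u)%Z)); auto.
  + intros [b d] [Hg [m Hm]]; unfold coprime_pair in *; cbn [fst snd] in *.
    split; [split; [unfold coprime_pair; cbn [fst snd] |exists (m - b)%Z; cbn [fst]; lia] | f_equal; lia].
    apply (coprime_lin b d _ _ 0 (-1) 1 (-2)); auto; lia.
  + intros [b d] [Hg [m Hm]]; unfold coprime_pair in *; cbn [fst snd] in *.
    split; [split; [unfold coprime_pair; cbn [fst snd] |exists (m - d)%Z; cbn [snd]; lia] | f_equal; lia].
    apply (coprime_lin b d _ _ (-2) 1 (-1) 0); auto; lia.
Qed.

(** The pairs for which [alpha] is a unit of Z[i]. For every other pair in [OddRight], [alpha] has
    odd norm and coprime nonzero parts, hence norm at least 5. *)
Definition gauss_units : list (Z * Z) := ((0, 1) :: (0, -1) :: (1, 1) :: (-1, -1) :: nil)%Z.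

Lemma gauss_rest (u : Z * Z) : OddRight u -> ~ In u gauss_units ->
  fst u <> 0%Z /\ (snd u - fst u <> 0)%Z.
Proof.
intros HG Hu; split; intros E; apply Hu.
- assert (H := OddRight_axis u HG E); simpl in *; tauto.
- destruct u as [b d]; destruct HG as [Hg _]; unfold coprime_pair in Hg; cbn [fst snd] in *.
  assert (d = b) by lia; subst d; rewrite Z.gcd_diag in Hg.
  assert (b = 1 \/ b = -1)%Z as [-> | ->] by lia; simpl; tauto.
Qed.

Lemma Cmod2_alpha (u : Z * Z) :
  Cmod (alpha u) ^ 2 = IZR (snd u - fst u) ^ 2 + IZR (fst u) ^ 2.
Proof. rewrite Cmod2_alt; unfold alpha; simpl Re; simpl Im; now rewrite minus_IZR. Qed.

(** With parts A and B the norm satisfies N^p >= 5^(p-2) N^2 >= 5^(p-2) * 4 A^2 B^2. One of A and B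
    is even and the other odd, so the sum of inverse squares is at most 2 * 5/6 * 5/2 = 25/6. *)
Lemma alpha_sum (p : nat) (l : list (Z * Z)) : (2 <= p)%nat -> NoDup l ->
  Forall (fun u => OddRight u /\ ~ In u gauss_units) l ->
  rsum (fun u => / Cmod (alpha u) ^ (2 * p)) l <= 25 / 24 * / 5 ^ (p - 2).
Proof.
intros Hp Hn Hl; rewrite Forall_forall in Hl.
assert (H5 : 0 < 5 ^ (p - 2)) by (apply pow_lt; lra).
set (c := / 4 * / 5 ^ (p - 2)).
assert (Hc : 0 < c) by (unfold c; apply Rmult_lt_0_compat; [lra | now apply Rinv_0_lt_compat]).
set (h := fun u : Z * Z => (snd u - fst u, fst u)%Z).
apply Rle_trans with (c * rsum invsq (map h l)).
{ rewrite rsum_map, <- rsum_scal; apply rsum_le; intros u Hu.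
  destruct (Hl u Hu) as [HG Hnu]; destruct (gauss_rest u HG Hnu) as [Hb Ha].
  rewrite pow_mult, Cmod2_alpha; unfold invsq, h; cbn [fst snd].
  assert (H5' : 5 <= IZR (snd u - fst u) ^ 2 + IZR (fst u) ^ 2).
  { rewrite !(pow_IZR _ 2), <- plus_IZR; apply IZR_le; change (Z.of_nat 2) with 2%Z.
    destruct u as [b d], HG as [_ [m Hm]]; cbn [fst snd] in *.
    assert (sq : forall i, i <> 0%Z -> (i = 1 \/ i = -1 \/ 4 <= i ^ 2)%Z).
    { intros i Hi; assert (i <= -2 \/ i = -1 \/ i = 1 \/ 2 <= i)%Z as [?|[?|[?|?]]] by lia;
        auto; right; right; nia. }
    destruct (sq b Hb) as [B | [B | B]], (sq (d - b)%Z Ha) as [A | [A | A]]; try lia;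
      rewrite ?A, ?B; try lia. }
  set (A := IZR (snd u - fst u)) in *; set (B := IZR (fst u)) in *.
  assert (HA : A <> 0) by now apply not_0_IZR.
  assert (HB : B <> 0) by now apply not_0_IZR.
  replace (c * (/ A ^ 2 * / B ^ 2)) with (/ (5 ^ (p - 2) * (4 * (A ^ 2 * B ^ 2))))
    by (unfold c; field; lra).
  assert (HA2 : 0 < A ^ 2) by now apply pow2_gt_0.
  assert (HB2 : 0 < B ^ 2) by now apply pow2_gt_0.
  assert (HAB : 0 < A ^ 2 * B ^ 2) by now apply Rmult_lt_0_compat.
  apply Rinv_le_contravar; [apply Rmult_lt_0_compat; lra |].
  replace p with ((p - 2) + 2)%nat at 2 by lia; rewrite pow_add.
  apply Rmult_le_compat; try lra.
  - apply pow_incr; lra.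
  - assert (0 <= (A ^ 2 - B ^ 2) ^ 2) by apply pow2_ge_0. nra. }
assert (Hh : NoDup (map h l)).
{ apply FinFun.Injective_map_NoDup; auto; intros [b d] [b' d'] E; unfold h in E; cbn [fst snd] in E.
  injection E; intros; f_equal; lia. }
assert (Hm : forall u, In u (map h l) -> fst u <> 0%Z /\ snd u <> 0%Z /\ Z.Odd (fst u + snd u)).
{ intros u Hu; apply in_map_iff in Hu; destruct Hu as [u' [<- Hu]].
  destruct (Hl u' Hu) as [HG Hnu]; destruct (gauss_rest u' HG Hnu) as [Hb Ha].
  unfold h; cbn [fst snd]; repeat split; auto.
  replace (snd u' - fst u' + fst u')%Z with (snd u') by lia; apply HG. }
set (g := fun u : Z * Z => Z.even (fst u)).
set (l' := map h l) in *.
assert (Hperm := permutation_filter g l').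
rewrite (rsum_perm _ _ _ Hperm), rsum_app.
assert (Hpos : forall b : Z, Z.Odd b -> 0 <= / IZR b ^ 2).
{ intros b Hb; apply Odd_neq0, not_0_IZR in Hb; left; now apply Rinv_0_lt_compat, pow2_gt_0. }
assert (Hpos' : forall b : Z, Z.Even b /\ b <> 0%Z -> 0 <= / IZR b ^ 2).
{ intros b [_ Hb]; apply not_0_IZR in Hb; left; now apply Rinv_0_lt_compat, pow2_gt_0. }
assert (S1 : rsum invsq (filter g l') <= 5 / 6 * (5 / 2)).
{ apply (rsum_prod_le (fun b => Z.Even b /\ b <> 0%Z) Z.Odd (fun b => / IZR b ^ 2)
    (fun b => / IZR b ^ 2)); auto using inv_sq_sum_even, inv_sq_sum_odd, NoDup_filter.
  intros u Hu; apply filter_In in Hu; destruct Hu as [Hu Hg]; unfold g in Hg.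
  apply Z.even_spec in Hg; destruct (Hm u Hu) as [M1 [M2 [j Hj]]]; repeat split; auto.
  destruct Hg as [i Hi]; exists (j - i)%Z; lia. }
assert (S2 : rsum invsq (filter (fun b => negb (g b)) l') <= 5 / 2 * (5 / 6)).
{ apply (rsum_prod_le Z.Odd (fun b => Z.Even b /\ b <> 0%Z) (fun b => / IZR b ^ 2)
    (fun b => / IZR b ^ 2)); auto using inv_sq_sum_even, inv_sq_sum_odd, NoDup_filter.
  intros u Hu; apply filter_In in Hu; destruct Hu as [Hu Hg]; unfold g in Hg.
  rewrite Z.negb_even in Hg; apply Z.odd_spec in Hg.
  destruct (Hm u Hu) as [M1 [M2 [j Hj]]]; repeat split; auto.
  destruct Hg as [i Hi]; exists (j - i)%Z; lia. }
apply Rle_trans with (c * (25 / 6)); [apply Rmult_le_compat_l; lra |].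
unfold c; lra.
Qed.

(** Up to a common positive factor, each of the four unit pairs gives at least e0 + e1 u - E2, and
    all the others together lose at most 4 eps (e0 + e1 u + E2), where 4 eps is the bound of
    [alpha_sum]; the hypothesis compares the two. *)
Lemma corner_nonzero (p n0 m : nat) (z : C) (s1 s2 : C) (E2 : R) :
  (2 <= p)%nat -> (n0 < 4)%nat -> (p + n0 = 4 * m)%nat ->
  0 < Im z -> 1 < 2 * Cmod z ^ 2 -> -1/2 <= Re z ->
  let e := fun i => multichoose (2 * p) (n0 + 4 * i) in
  let u := Cmod (corner_t z) ^ 4 in
  let eps := 25 / 96 * / 5 ^ (p - 2) in
  (forall I, rsum (fun i => (2 * INR i - 1) * (e i * u ^ i)) (seq 2 I) <= E2) ->
  (1 + eps) * E2 < (1 - eps) * (e 0%nat + e 1%nat * u) ->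
  is_sum_over OddRight (even_row_term p z) s1 -> is_sum_over OddLeft (odd_row_term p z) s2 ->
  (s1 + s2)%C <> 0.
Proof.
intros Hp Hn0 Hm Hy Hr Hx e u eps HE2 Hmain H1 H2 E.
assert (Ht := Cmod_corner_t_lt1 z Hy).
assert (H1t := proj1 (corner_row z 0 Hy)).
(* The numerator factors as (|z|^2 - 1/2) (|z + 1|^2 - 1/2), the equations of the two circles that
   meet at the corner. *)
assert (HX : 0 < Re (corner_t z ^ 2)).
{ destruct (corner_t_coords z Hy) as [HW ->].
  set (r := Cmod z ^ 2) in *; set (x := Re z) in *.
  set (W := 4 * r + 4 * x + 2 + 4 * Im z) in *.
  replace (Re ((4 * (r + x) / W, - (4 * x + 2) / W)%R ^ 2)%C)
    with ((16 * ((r - 1/2) * (r + 2 * x + 1/2))) / W ^ 2) by (simpl; field; lra).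
  apply Rdiv_lt_0_compat; [|apply pow_lt; lra].
  apply Rmult_lt_0_compat; [lra |]; apply Rmult_lt_0_compat; [lra |].
  assert (Er : r = x ^ 2 + Im z ^ 2) by apply Cmod2_alt. lra. }
set (t := corner_t z) in *.
assert (Hrho : 0 < Cmod t).
{ apply Cmod_gt_0; intros E0; rewrite E0 in HX; simpl in HX; lra. }
set (c0 := 8 * Cmod t ^ (2 * n0) * Re (t ^ 2)).
assert (Hc0 : 0 < c0).
{ unfold c0; apply Rmult_lt_0_compat; auto; apply Rmult_lt_0_compat; [lra | now apply pow_lt]. }
(* The first factor removes the automorphy factor common to all orbits; the second is the conjugate
   of t^(n0 + 2). *)
set (Phi := ((/ (1 - t)) ^ (2 * p) * Cconj t ^ (n0 + 2))%C).
set (f := fun w => (Phi * (four_rows p z w + four_rows p z (conj_row w)))%C).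
assert (Hs : is_sum_over OddRight f 0).
{ replace (RtoC 0) with (Phi * (RtoC 2 * (s1 + s2) + RtoC 2 * (s1 + s2)))%C
    by (rewrite E; ring).
  apply is_sum_over_scal, is_sum_over_plus; [now apply four_rows_sum |].
  apply (is_sum_over_bij OddRight OddRight conj_row conj_row); auto using conj_row_bij.
  now apply four_rows_sum. }
assert (Hf : forall w, OddRight w -> Re (f w) =
   Re ((h_orbit p (alpha w) t + h_orbit p (Cconj (alpha w)) t) * Cconj t ^ (n0 + 2))).
{ intros w HG; f_equal; unfold f, Phi.
  assert (Hw := Odd_neq0 _ (proj2 HG)).
  assert (Hw' := Odd_neq0 _ (proj2 (proj1 (conj_row_bij w HG)))).
  rewrite !four_rows_orbit by auto; fold t.
  replace (alpha (conj_row w)) with (Cconj (alpha w)).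
  - rewrite Cpow_inv by auto; field; now apply Cpow_nz.
  - unfold alpha, conj_row, Cconj; cbn [fst snd].
    rewrite minus_IZR, mult_IZR, opp_IZR; apply injective_projections; simpl; ring. }
assert (He : forall i, 0 <= e i) by (intros i; apply multichoose_ge0).
assert (Hu : 0 <= u) by (apply pow_le, Cmod_ge_0).
assert (He1u : 0 <= e 1%nat * u) by (apply Rmult_le_pos; auto).
set (M := fun w => / Cmod (alpha w) ^ (2 * p)).
assert (Hcoef : forall w i, OddRight w -> Rabs (Re (/ alpha w ^ (2 * p) *
    (Cconj (alpha w) / alpha w) ^ (n0 + 4 * i))%C) <= M w).
{ intros w i HG; assert (Ha := alpha_neq0 w (or_intror (Odd_neq0 _ (proj2 HG)))).
  eapply Rle_trans; [apply re_le_Cmod |].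
  rewrite Cmod_mult, Cmod_inv, !Cmod_pow, Cmod_div, Cmod_conj by (try apply Cpow_nz; auto).
  apply Cmod_gt_0 in Ha; unfold Rdiv; rewrite Rinv_r, pow1, Rmult_1_r by lra; apply Rle_refl. }
assert (Hrest : forall w, OddRight w -> ~ In w gauss_units ->
  - (c0 * (e 0%nat + e 1%nat * u + E2) * M w) <= Re (f w)).
{ intros w HG _; rewrite Hf by auto.
  assert (Ha := alpha_neq0 w (or_intror (Odd_neq0 _ (proj2 HG)))).
  eapply Rle_trans; [| apply (h_orbit_sym_ge p n0 m (alpha w) t E2
    (- (M w * (e 0%nat + e 1%nat * u)))); auto].
  - fold c0; fold (M w); apply Req_le; ring.
  - assert (A0 := Hcoef w 0%nat HG); assert (A1 := Hcoef w 1%nat HG).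
    apply Rabs_le_between in A0; apply Rabs_le_between in A1.
    fold (e 0%nat) (e 1%nat); fold u.
    set (g0 := Re _) in A0 |- *; set (g1 := Re _) in A1 |- *.
    assert (e 0%nat * - M w <= e 0%nat * g0) by (apply Rmult_le_compat_l; auto; lra).
    assert (e 1%nat * u * - M w <= e 1%nat * u * g1) by (apply Rmult_le_compat_l; auto; lra).
    lra. }
assert (Hunit : forall w, In w gauss_units ->
  c0 * (e 0%nat + e 1%nat * u - E2) <= Re (f w)).
{ intros w Hw.
  assert (HG : OddRight w).
  { assert (S := OddRight_small); rewrite Forall_forall in S; apply S; simpl in *; tauto. }
  rewrite Hf by auto.
  assert (Ha := alpha_neq0 w (or_intror (Odd_neq0 _ (proj2 HG)))).
  assert (HM : M w = 1).
  { unfold M; rewrite pow_mult, Cmod2_alpha.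
    replace (IZR (snd w - fst w) ^ 2 + IZR (fst w) ^ 2) with 1
      by (simpl in Hw; intuition subst; simpl; ring).
    rewrite pow1; field. }
  (* For a unit both bases, 1 / alpha^2 and conj alpha / alpha, are the same sign, raised in total
     to p + n0 + 4 i, a multiple of 4: all units reinforce each other. *)
  assert (Hc : forall i, (/ alpha w ^ (2 * p) * (Cconj (alpha w) / alpha w) ^ (n0 + 4 * i))%C = RtoC 1).
  { intros i.
    assert (Hcase : (alpha w * alpha w = 1 /\ Cconj (alpha w) = alpha w)%C \/
       (alpha w * alpha w = - (1) /\ Cconj (alpha w) = - alpha w)%C).
    { simpl in Hw; unfold alpha; destruct Hw as [<- | [<- | [<- | [<- | []]]]]; cbn [fst snd];
      [left | left | right | right]; split; apply injective_projections; simpl; ring. }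
    rewrite Cinv_pow2 by auto.
    destruct Hcase as [[-> ->] | [-> ->]].
    - replace (alpha w / alpha w)%C with (RtoC 1) by (field; auto).
      replace (/ RtoC 1)%C with (RtoC 1) by (field; intros E'; injection E'; lra).
      now rewrite !Cpow_1_l, Cmult_1_l.
    - replace (- alpha w / alpha w)%C with (- (1))%C by (field; auto).
      replace (/ - (1))%C with (- (1))%C by (field; intros E'; injection E'; lra).
      rewrite <- Cpow_add_r; replace (p + (n0 + 4 * i))%nat with (2 * (2 * (m + i)))%nat by lia.
      rewrite Cpow_mult_r; replace ((- (1)) ^ 2)%C with (RtoC 1) by (simpl; ring).
      apply Cpow_1_l. }
  eapply Rle_trans; [| apply (h_orbit_sym_ge p n0 m (alpha w) t E2 (e 0%nat + e 1%nat * u)); auto].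
  - fold c0; fold (M w); rewrite HM; apply Req_le; ring.
  - rewrite !Hc; fold (e 0%nat) (e 1%nat); fold u; simpl Re; lra. }
assert (HR := Re_sum_ge OddRight f 0 gauss_units
  (fun w => c0 * (e 0%nat + e 1%nat * u + E2) * M w)
  (c0 * (e 0%nat + e 1%nat * u + E2) * (4 * eps)) Hs).
assert (HE20 : 0 <= E2) by (assert (H0 := HE2 0%nat); unfold rsum in H0; simpl in H0; lra).
assert (HR' : rsum (fun w => Re (f w)) gauss_units -
   c0 * (e 0%nat + e 1%nat * u + E2) * (4 * eps) <= 0).
{ apply HR; auto.
  - repeat constructor; simpl; intuition congruence.
  - assert (S := OddRight_small); rewrite Forall_forall in *; intros w Hw; apply S; simpl in *; tauto.
  - intros l Hl1 Hl2; rewrite rsum_scal; apply Rmult_le_compat_l.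
    + apply Rmult_le_pos; [lra |]; assert (H0 := He 0%nat); lra.
    + replace (4 * eps) with (25 / 24 * / 5 ^ (p - 2)) by (unfold eps; lra).
      now apply alpha_sum. }
assert (A := rsum_le (fun _ => c0 * (e 0%nat + e 1%nat * u - E2)) _ gauss_units Hunit).
replace (rsum (fun _ => c0 * (e 0%nat + e 1%nat * u - E2)) gauss_units)
  with (4 * (c0 * (e 0%nat + e 1%nat * u - E2))) in A by (unfold rsum; simpl; ring).
assert (B : c0 * ((1 + eps) * E2) < c0 * ((1 - eps) * (e 0%nat + e 1%nat * u)))
  by now apply Rmult_lt_compat_l.
lra.
Qed.

(** * Size of the tail: coefficient ratios and bounds for the Cayley coordinate *)

Lemma geometric_tail (e : nat -> R) (u r : R) :
  0 <= u -> 0 <= r < 1 -> (forall i, 0 <= e i) ->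
  (forall i, (2 <= i)%nat -> e (S i) * u <= r * e i) ->
  forall I, rsum (fun i => (2 * INR i - 1) * (e i * u ^ i)) (seq 2 I) <=
    e 2%nat * u ^ 2 * ((3 - r) / (1 - r) ^ 2).
Proof.
intros Hu Hr He Hrat I.
set (E := e 2%nat * u ^ 2).
assert (HE : 0 <= E) by (apply Rmult_le_pos; [apply He | now apply pow_le]).
assert (Hterm : forall j, e (2 + j)%nat * u ^ (2 + j) <= E * r ^ j).
{ induction j as [|j IH]; [unfold E; simpl; lra |].
  replace (2 + S j)%nat with (S (2 + j)) by lia.
  assert (A := Hrat (2 + j)%nat ltac:(lia)).
  assert (Huj : 0 <= u ^ (2 + j)) by now apply pow_le.
  assert (B := Rmult_le_compat_r _ _ _ Huj A).
  assert (D := Rmult_le_compat_l r _ _ (proj1 Hr) IH).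
  cbn [pow]; simpl pow in B, D |- *; lra. }
(* The closed form of the sum of (2 j + 3) r^j over j < I, with j = i - 2; its limit is (3 - r) / (1
   - r)^2. *)
assert (H : rsum (fun i => (2 * INR i - 1) * (e i * u ^ i)) (seq 2 I) <=
  E * (((3 - r) - r ^ I * (2 * INR I + 3 - (2 * INR I + 1) * r)) / (1 - r) ^ 2)).
{ induction I as [|I IH].
  - unfold rsum; simpl; apply Req_le; field; lra.
  - rewrite rsum_seq_S.
    assert (P := pos_INR I).
    assert (T : (2 * INR (2 + I) - 1) * (e (2 + I)%nat * u ^ (2 + I)) <= (2 * INR I + 3) * (E * r ^ I)).
    { rewrite plus_INR; replace (2 * (INR 2 + INR I) - 1) with (2 * INR I + 3) by (simpl; ring).
      apply Rmult_le_compat_l; [lra | apply Hterm]. }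
    eapply Rle_trans; [apply Rplus_le_compat; [exact IH | exact T] |].
    rewrite S_INR; apply Req_le; cbn [pow]; field; lra. }
eapply Rle_trans; [exact H |]; apply Rmult_le_compat_l; auto.
unfold Rdiv; apply Rmult_le_compat_r; [left; apply Rinv_0_lt_compat, pow_lt; lra |].
assert (P := pos_INR I); assert (0 <= r ^ I) by (apply pow_le; lra).
assert (0 <= 2 * INR I + 3 - (2 * INR I + 1) * r) by nra.
assert (0 <= r ^ I * (2 * INR I + 3 - (2 * INR I + 1) * r)) by now apply Rmult_le_pos.
lra.
Qed.

Lemma multichoose_step4 (k n : nat) :
  multichoose k (n + 4) * ((INR n + 1) * (INR n + 2) * (INR n + 3) * (INR n + 4)) =
  multichoose k n * ((INR n + INR k) * (INR n + INR k + 1) * (INR n + INR k + 2) * (INR n + INR k + 3)).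
Proof.
replace (n + 4)%nat with (S (S (S (S n)))) by lia.
assert (P := pos_INR n); cbn [multichoose]; rewrite !S_INR; field; lra.
Qed.

Lemma multichoose_ratio (k n : nat) (u r : R) :
  u * ((INR n + INR k) * (INR n + INR k + 1) * (INR n + INR k + 2) * (INR n + INR k + 3))
   <= r * ((INR n + 1) * (INR n + 2) * (INR n + 3) * (INR n + 4)) ->
  multichoose k (n + 4) * u <= r * multichoose k n.
Proof.
intros H; assert (P := pos_INR n); assert (A := multichoose_step4 k n).
set (D := (INR n + 1) * (INR n + 2) * (INR n + 3) * (INR n + 4)) in *.
assert (HD : 0 < D) by (unfold D; repeat apply Rmult_lt_0_compat; lra).
apply Rmult_le_reg_r with D; auto.
replace (multichoose k (n + 4) * u * D) with (multichoose k (n + 4) * D * u) by ring.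
rewrite A; assert (M := multichoose_ge0 k n).
assert (B := Rmult_le_compat_l _ _ _ M H). lra.
Qed.

Lemma multichoose_gt0 k n : (1 <= k)%nat -> 0 < multichoose k n.
Proof.
intros Hk; apply (le_INR 1) in Hk; simpl in Hk.
induction n as [|n IH]; simpl; [lra |].
assert (P := pos_INR n).
apply Rmult_lt_0_compat; [nra | apply Rinv_0_lt_compat; lra].
Qed.

(** Numerator and denominator are |2 z + 1 - i|^2 / 4 and |2 z + 1 + i|^2 / 4. *)
Lemma Cmod2_corner_t (z : C) : 0 < Im z ->
  let s := Cmod z ^ 2 + Re z + 1/2 in
  0 < s + Im z /\ Cmod (corner_t z) ^ 2 = (s - Im z) / (s + Im z).
Proof.
intros Hy s; destruct (corner_t_coords z Hy) as [HW ET].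
assert (Er := Cmod2_alt z); unfold s in *; clear s.
set (r := Cmod z ^ 2) in *; set (x := Re z) in *; set (y := Im z) in *.
rewrite ET, Cmod2_alt; simpl Re; simpl Im.
assert (Hs : 0 < r + x + 1/2 + y) by lra.
split; [exact Hs |].
replace (4 * r + 4 * x + 2 + 4 * y) with (4 * (r + x + 1/2 + y)) by field.
apply Rmult_eq_reg_r with ((r + x + 1/2 + y) ^ 2); [|apply pow_nonzero; lra].
transitivity ((r + x) ^ 2 + (x + 1/2) ^ 2); [field; lra |].
transitivity ((r + x + 1/2) ^ 2 - y ^ 2); [|field; lra].
replace (y ^ 2) with (r - x ^ 2) by lra; field.
Qed.

(** |t|^2 <= c means (1 - c) s <= (1 + c) Im z; squaring removes Im z and leaves a polynomial
    condition in |z|^2 and Re z. *)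
Lemma Cmod_corner_t_le (z : C) (c : R) : 0 < Im z -> 0 <= c < 1 ->
  0 <= Cmod z ^ 2 + Re z + 1/2 ->
  ((1 - c) * (Cmod z ^ 2 + Re z + 1/2)) ^ 2 <= (1 + c) ^ 2 * (Cmod z ^ 2 - Re z ^ 2) ->
  Cmod (corner_t z) ^ 4 <= c ^ 2.
Proof.
intros Hy Hc Hs H; destruct (Cmod2_corner_t z Hy) as [HW E].
assert (Er := Cmod2_alt z).
set (s := Cmod z ^ 2 + Re z + 1/2) in *.
replace (Cmod (corner_t z) ^ 4) with ((Cmod (corner_t z) ^ 2) ^ 2) by ring.
apply pow_incr; split; [apply pow2_ge_0 |]; rewrite E.
apply Rmult_le_reg_r with (s + Im z); auto.
unfold Rdiv; rewrite Rmult_assoc, Rinv_l, Rmult_1_r by lra.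
assert ((1 - c) * s <= (1 + c) * Im z); [|lra].
apply Rsqr_incr_0_var; [|nra]; rewrite !Rsqr_pow2.
replace (((1 + c) * Im z) ^ 2) with ((1 + c) ^ 2 * (Cmod z ^ 2 - Re z ^ 2)) by (rewrite Er; ring).
exact H.
Qed.

Lemma corner_nonzero_geometric (p n0 m : nat) (z : C) (s1 s2 : C) (r : R) :
  (2 <= p)%nat -> (n0 < 4)%nat -> (p + n0 = 4 * m)%nat ->
  0 < Im z -> 1 < 2 * Cmod z ^ 2 -> -1/2 <= Re z ->
  let e := fun i => multichoose (2 * p) (n0 + 4 * i) in
  let u := Cmod (corner_t z) ^ 4 in
  let eps := 25 / 96 * / 5 ^ (p - 2) in
  0 <= r < 1 -> (forall i, (2 <= i)%nat -> e (S i) * u <= r * e i) ->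
  (1 + eps) * (e 2%nat * u ^ 2 * ((3 - r) / (1 - r) ^ 2)) <
    (1 - eps) * (e 0%nat + e 1%nat * u) ->
  is_sum_over OddRight (even_row_term p z) s1 -> is_sum_over OddLeft (odd_row_term p z) s2 ->
  (s1 + s2)%C <> 0.
Proof.
intros Hp Hn0 Hm Hy Hr Hx e u eps Hr1 Hrat Hmain H1 H2.
eapply corner_nonzero; eauto.
apply geometric_tail; auto; [apply pow_le, Cmod_ge_0 | intros i; apply multichoose_ge0].
Qed.

Lemma weight4_nonzero (z s1 s2 : C) :
  0 < Im z -> 1 < 2 * Cmod z ^ 2 -> Cmod z ^ 2 <= 2 -> -1/2 <= Re z <= 0 ->
  is_sum_over OddRight (even_row_term 2 z) s1 -> is_sum_over OddLeft (odd_row_term 2 z) s2 -> (s1 + s2)%C <> 0.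
Proof.
intros Hy Hr Hr2 Hx H1 H2.
assert (Hu : Cmod (corner_t z) ^ 4 <= (28/100) ^ 2).
(* 28/100 is just above the value of |t|^2 at |z|^2 = 2, Re z = 0. The ratio 19/100 of the tail then
   holds from exponent 10, that is i = 2. *)
{ apply Cmod_corner_t_le; try lra. nra. }
assert (Hu0 : 0 <= Cmod (corner_t z) ^ 4) by apply pow_le, Cmod_ge_0.
set (u := Cmod (corner_t z) ^ 4) in *.
apply (corner_nonzero_geometric 2 2 1 z s1 s2 (19/100)); auto; try lra; try lia; fold u.
- intros i Hi; replace (2 + 4 * S i)%nat with ((2 + 4 * i) + 4)%nat by lia.
  apply multichoose_ratio; rewrite plus_INR, mult_INR; simpl INR.
  assert (Hi' : 2 <= INR i) by (apply (le_INR 2) in Hi; simpl in Hi; lra).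
  set (n := 1 + 1 + (1 + 1 + 1 + 1) * INR i) in *.
  assert (Hn : 10 <= n) by (unfold n; lra).
  set (P := (n + 4) * (n + 5) * (n + 6) * (n + 7)).
  assert (HP : 0 <= P) by (unfold P; repeat apply Rmult_le_pos; lra).
  apply Rle_trans with (784/10000 * P).
  + match goal with |- _ * ?X <= _ => replace X with P by (unfold P; ring) end.
    apply Rmult_le_compat_r; lra.
  + unfold P; set (j := n - 10); replace n with (j + 10) by (unfold j; ring).
    assert (0 <= j) by (unfold j; lra); assert (0 <= j ^ 2) by apply pow2_ge_0.
    assert (0 <= j ^ 3) by now apply pow_le. assert (0 <= j ^ 4) by now apply pow_le. nra.
- replace (multichoose (2 * 2) (2 + 4 * 0)) with 10 by (simpl; field).
  replace (multichoose (2 * 2) (2 + 4 * 1)) with 84 by (simpl; field).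
  replace (multichoose (2 * 2) (2 + 4 * 2)) with 286 by (simpl; field).
  simpl pow; nra.
Qed.

Lemma weight6_nonzero (z s1 s2 : C) :
  0 < Im z -> 1 < 2 * Cmod z ^ 2 -> Cmod z ^ 2 <= 1 -> -1/2 <= Re z <= 0 ->
  is_sum_over OddRight (even_row_term 3 z) s1 -> is_sum_over OddLeft (odd_row_term 3 z) s2 -> (s1 + s2)%C <> 0.
Proof.
intros Hy Hr Hr2 Hx H1 H2.
assert (Hu : Cmod (corner_t z) ^ 4 <= (2/10) ^ 2).
(* 2/10 is exactly |t|^2 at z = i, the extreme point of the region. *)
{ apply Cmod_corner_t_le; try lra. nra. }
assert (Hu0 : 0 <= Cmod (corner_t z) ^ 4) by apply pow_le, Cmod_ge_0.
set (u := Cmod (corner_t z) ^ 4) in *.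
apply (corner_nonzero_geometric 3 1 1 z s1 s2 (1712/10000)); auto; try lra; try lia; fold u.
- intros i Hi; replace (1 + 4 * S i)%nat with ((1 + 4 * i) + 4)%nat by lia.
  apply multichoose_ratio; rewrite plus_INR, mult_INR; simpl INR.
  assert (Hi' : 2 <= INR i) by (apply (le_INR 2) in Hi; simpl in Hi; lra).
  set (n := 1 + (1 + 1 + 1 + 1) * INR i) in *.
  assert (Hn : 9 <= n) by (unfold n; lra).
  set (P := (n + 6) * (n + 7) * (n + 8) * (n + 9)).
  assert (HP : 0 <= P) by (unfold P; repeat apply Rmult_le_pos; lra).
  apply Rle_trans with (4/100 * P).
  + match goal with |- _ * ?X <= _ => replace X with P by (unfold P; ring) end.
    apply Rmult_le_compat_r; lra.
  + unfold P; set (j := n - 9); replace n with (j + 9) by (unfold j; ring).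
    assert (0 <= j) by (unfold j; lra); assert (0 <= j ^ 2) by apply pow2_ge_0.
    assert (0 <= j ^ 3) by now apply pow_le. assert (0 <= j ^ 4) by now apply pow_le. nra.
- replace (multichoose (2 * 3) (1 + 4 * 0)) with 6 by (simpl; field).
  replace (multichoose (2 * 3) (1 + 4 * 1)) with 252 by (simpl; field).
  replace (multichoose (2 * 3) (1 + 4 * 2)) with 2002 by (simpl; field).
  simpl pow; nra.
Qed.

(** With h = |z|^2 + Re z one has |2 z + 1|^2 = 1 + 4 h, so the cut becomes h k^2 <= 2 k + 4.
    Moreover |t|^2 is at most 2 (h / (1 + h))^2, since Im z >= 1/2 and Re z + 1/2 <= h. *)
Lemma corner_t_small (z : C) (k : R) : 8 <= k -> 0 < Im z ->
  1 < 2 * Cmod z ^ 2 -> -1/2 <= Re z <= 0 -> k * (Cmod (RtoC 2 * z + 1) - 1) < 4 ->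
  Cmod (corner_t z) ^ 2 <= 8 * ((k + 2) / (k ^ 2 + 2 * k + 4)) ^ 2.
Proof.
intros Hk Hy Hr Hx Hn.
destruct (Cmod2_corner_t z Hy) as [HW E]; rewrite E; clear E.
assert (En := Cmod2_lin z 2 1).
assert (Hn0 := Cmod_ge_0 (RtoC 2 * z + 1)).
set (n := Cmod (RtoC 2 * z + 1)) in *.
assert (Er := Cmod2_alt z).
set (r := Cmod z ^ 2) in *; set (x := Re z) in *; set (y := Im z) in *.
set (h := r + x).
assert (Hh0 : 0 <= h) by (unfold h; lra).
assert (Hh : h * k ^ 2 <= 2 * k + 4).
{ assert (k * n <= k + 4) by lra.
  assert ((k * n) ^ 2 <= (k + 4) ^ 2) by (apply pow_incr; split; [nra | lra]).
  rewrite Rpow_mult_distr, En in H0; unfold h; nra. }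
assert (Hy2 : 1/2 <= y).
{ apply Rsqr_incr_0_var; [|lra]; rewrite !Rsqr_pow2; nra. }
assert (Hfrac : h / (1 + h) <= 2 * ((k + 2) / (k ^ 2 + 2 * k + 4))).
{ apply Rmult_le_reg_r with ((1 + h) * (k ^ 2 + 2 * k + 4)); [apply Rmult_lt_0_compat; nra |].
  replace (h / (1 + h) * ((1 + h) * (k ^ 2 + 2 * k + 4))) with (h * (k ^ 2 + 2 * k + 4))
    by (field; lra).
  replace (2 * ((k + 2) / (k ^ 2 + 2 * k + 4)) * ((1 + h) * (k ^ 2 + 2 * k + 4)))
    with (2 * (k + 2) * (1 + h)) by (field; nra).
  nra. }
assert (Hf0 : 0 <= h / (1 + h)).
{ apply Rmult_le_pos; [lra | left; apply Rinv_0_lt_compat; lra]. }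
apply Rle_trans with (2 * (h / (1 + h)) ^ 2).
- assert (Hs : h + 1/2 + y = r + x + 1/2 + y) by (unfold h; ring).
  replace (r + x + 1 / 2 - y) with (h + 1/2 - y) by (unfold h; ring).
  replace (r + x + 1 / 2 + y) with (h + 1/2 + y) in * by (unfold h; ring).
  replace ((h + 1 / 2 - y) / (h + 1 / 2 + y)) with
    ((h ^ 2 + (x + 1/2) ^ 2) * (/ (h + 1 / 2 + y)) ^ 2).
  2:{ replace (h ^ 2 + (x + 1/2) ^ 2) with ((h + 1/2) ^ 2 - y ^ 2)
        by (replace (y ^ 2) with (r - x ^ 2) by lra; unfold h; field).
      field; lra. }
  replace (2 * (h / (1 + h)) ^ 2) with (2 * h ^ 2 * (/ (1 + h)) ^ 2) by (field; lra).
  apply Rmult_le_compat; try (apply pow2_ge_0).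
  + apply Rplus_le_le_0_compat; apply pow2_ge_0.
  + assert (0 <= x + 1/2 <= h) by (unfold h; lra). nra.
  + apply pow_incr; split; [left; apply Rinv_0_lt_compat; lra |].
    apply Rinv_le_contravar; lra.
- assert ((h / (1 + h)) ^ 2 <= (2 * ((k + 2) / (k ^ 2 + 2 * k + 4))) ^ 2)
    by (apply pow_incr; lra).
  rewrite Rpow_mult_distr in H. lra.
Qed.

(** 1680 = 5*6*7*8 and 11880 = 9*10*11*12 are the denominators of the ratio of coefficients at n = 4
    and n = 8. A product of four consecutive numbers is a square minus 1, so it suffices to compare
    square roots. *)
Lemma multichoose_ratio_bounds (k u : R) : 8 <= k -> 0 <= u ->
  u <= (8 * ((k + 2) / (k ^ 2 + 2 * k + 4)) ^ 2) ^ 2 ->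
  u * ((k + 4) * (k + 5) * (k + 6) * (k + 7)) <= 26/100 * 1680 /\
  u * ((k + 8) * (k + 9) * (k + 10) * (k + 11)) <= 11/100 * 11880.
Proof.
intros Hk Hu H.
assert (HD : 0 < k ^ 2 + 2 * k + 4) by nra.
set (D := k ^ 2 + 2 * k + 4) in *.
set (A := ((k + 2) / D) ^ 2) in *.
assert (HA : 0 <= A) by apply pow2_ge_0.
assert (EA : A * D ^ 2 = (k + 2) ^ 2) by (unfold A; field; lra).
assert (HD2 : 0 < D ^ 2) by now apply pow_lt.
set (j := k - 8); assert (Hj : 0 <= j) by (unfold j; lra).
assert (Hj2 : 0 <= j ^ 2) by now apply pow_le.
assert (Hj3 : 0 <= j ^ 3) by now apply pow_le.
assert (Hj4 : 0 <= j ^ 4) by now apply pow_le.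
assert (B1 : A * (k ^ 2 + 11 * k + 29) <= 26/10).
{ apply Rmult_le_reg_r with (D ^ 2); auto.
  replace (A * (k ^ 2 + 11 * k + 29) * D ^ 2) with (A * D ^ 2 * (k ^ 2 + 11 * k + 29)) by ring.
  rewrite EA; unfold D; replace k with (j + 8) by (unfold j; ring). nra. }
assert (B2 : A * (k ^ 2 + 19 * k + 89) <= 44/10).
{ apply Rmult_le_reg_r with (D ^ 2); auto.
  replace (A * (k ^ 2 + 19 * k + 89) * D ^ 2) with (A * D ^ 2 * (k ^ 2 + 19 * k + 89)) by ring.
  rewrite EA; unfold D; replace k with (j + 8) by (unfold j; ring). nra. }
assert (Hu' : u <= 64 * A ^ 2) by lra.
split.
- apply Rle_trans with (64 * A ^ 2 * (k ^ 2 + 11 * k + 29) ^ 2).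
  + apply Rmult_le_compat; auto; [repeat apply Rmult_le_pos; lra |].
    assert ((k + 4) * (k + 5) * (k + 6) * (k + 7) = (k ^ 2 + 11 * k + 29) ^ 2 - 1) by ring. lra.
  + assert (S := pow_incr _ _ 2 (conj (Rmult_le_pos _ (k ^ 2 + 11 * k + 29) HA ltac:(nra)) B1)).
    rewrite Rpow_mult_distr in S; lra.
- apply Rle_trans with (64 * A ^ 2 * (k ^ 2 + 19 * k + 89) ^ 2).
  + apply Rmult_le_compat; auto; [repeat apply Rmult_le_pos; lra |].
    assert ((k + 8) * (k + 9) * (k + 10) * (k + 11) = (k ^ 2 + 19 * k + 89) ^ 2 - 1) by ring. lra.
  + assert (S := pow_incr _ _ 2 (conj (Rmult_le_pos _ (k ^ 2 + 19 * k + 89) HA ltac:(nra)) B2)).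
    rewrite Rpow_mult_distr in S; lra.
Qed.

(* [(n + k + l) / (n + 1 + l)] decreases in [n]. *)
Lemma multichoose_ratio_from (k n : nat) (u r n1 : R) : (1 <= k)%nat -> 0 <= n1 <= INR n -> 0 <= u ->
  u * ((n1 + INR k) * (n1 + INR k + 1) * (n1 + INR k + 2) * (n1 + INR k + 3))
   <= r * ((n1 + 1) * (n1 + 2) * (n1 + 3) * (n1 + 4)) ->
  multichoose k (n + 4) * u <= r * multichoose k n.
Proof.
intros Hk Hn Hu H; apply multichoose_ratio; apply (le_INR 1) in Hk; simpl in Hk.
set (N := INR n) in *; set (K := INR k) in *.
assert (R1 : forall l, 0 <= l -> 0 <= (N + K + l) / (N + 1 + l) <= (n1 + K + l) / (n1 + 1 + l)).
{ intros l Hl; split; [apply Rmult_le_pos; [lra | left; apply Rinv_0_lt_compat; lra] |].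
  apply Rmult_le_reg_r with ((N + 1 + l) * (n1 + 1 + l)); [apply Rmult_lt_0_compat; lra |].
  replace ((N + K + l) / (N + 1 + l) * ((N + 1 + l) * (n1 + 1 + l)))
    with ((N + K + l) * (n1 + 1 + l)) by (field; lra).
  replace ((n1 + K + l) / (n1 + 1 + l) * ((N + 1 + l) * (n1 + 1 + l)))
    with ((n1 + K + l) * (N + 1 + l)) by (field; lra).
  nra. }
assert (Q0 := R1 0 ltac:(lra)); assert (Q1 := R1 1 ltac:(lra));
assert (Q2 := R1 2 ltac:(lra)); assert (Q3 := R1 3 ltac:(lra)).
set (D1 := (n1 + 1) * (n1 + 2) * (n1 + 3) * (n1 + 4)) in *.
assert (HD1 : 0 < D1) by (unfold D1; repeat apply Rmult_lt_0_compat; lra).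
set (D := (N + 1) * (N + 2) * (N + 3) * (N + 4)) in *.
assert (HD : 0 < D) by (unfold D; repeat apply Rmult_lt_0_compat; lra).
assert (HP : (N + K) * (N + K + 1) * (N + K + 2) * (N + K + 3) / D <=
  (n1 + K) * (n1 + K + 1) * (n1 + K + 2) * (n1 + K + 3) / D1).
{ replace ((N + K) * (N + K + 1) * (N + K + 2) * (N + K + 3) / D) with
   (((N + K + 0) / (N + 1 + 0) * ((N + K + 1) / (N + 1 + 1))) *
    ((N + K + 2) / (N + 1 + 2) * ((N + K + 3) / (N + 1 + 3)))) by (unfold D; field; lra).
  replace ((n1 + K) * (n1 + K + 1) * (n1 + K + 2) * (n1 + K + 3) / D1) with
   (((n1 + K + 0) / (n1 + 1 + 0) * ((n1 + K + 1) / (n1 + 1 + 1))) *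
    ((n1 + K + 2) / (n1 + 1 + 2) * ((n1 + K + 3) / (n1 + 1 + 3)))) by (unfold D1; field; lra).
  apply Rmult_le_compat; try (apply Rmult_le_pos; lra); apply Rmult_le_compat; lra. }
apply (Rmult_le_compat_l u) in HP; auto.
apply Rmult_le_reg_r with (/ D); [now apply Rinv_0_lt_compat |].
replace (r * D * / D) with r by (field; lra).
unfold Rdiv in HP; rewrite <- Rmult_assoc in HP; eapply Rle_trans; [exact HP |].
rewrite <- Rmult_assoc; apply Rmult_le_reg_r with D1; auto.
rewrite Rmult_assoc, Rinv_l; lra.
Qed.

Lemma weight_ge8_corner (p : nat) (z s1 s2 : C) :
  (4 <= p)%nat -> 0 < Im z -> 1 < 2 * Cmod z ^ 2 -> -1/2 <= Re z <= 0 ->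
  INR (2 * p) * (Cmod (RtoC 2 * z + 1) - 1) < 4 ->
  is_sum_over OddRight (even_row_term p z) s1 -> is_sum_over OddLeft (odd_row_term p z) s2 -> (s1 + s2)%C <> 0.
Proof.
intros Hp Hy Hr Hx Hn H1 H2.
set (k := (2 * p)%nat) in *.
assert (Hk : 8 <= INR k) by (replace 8 with (INR 8) by (simpl; ring); apply le_INR; unfold k; lia).
assert (Hu : Cmod (corner_t z) ^ 4 <= (8 * ((INR k + 2) / (INR k ^ 2 + 2 * INR k + 4)) ^ 2) ^ 2).
{ replace (Cmod (corner_t z) ^ 4) with ((Cmod (corner_t z) ^ 2) ^ 2) by ring.
  apply pow_incr; split; [apply pow2_ge_0 | now apply corner_t_small]. }
assert (Hu0 : 0 <= Cmod (corner_t z) ^ 4) by apply pow_le, Cmod_ge_0.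
assert (Hn0 : exists n0 m, (n0 < 4)%nat /\ (p + n0 = 4 * m)%nat).
{ assert (Hdiv := Nat.div_mod p 4 ltac:(lia)).
  assert (Hmod := Nat.mod_upper_bound p 4 ltac:(lia)).
  destruct (Nat.eq_dec (p mod 4) 0).
  - exists 0%nat, (p / 4)%nat; lia.
  - exists (4 - p mod 4)%nat, (S (p / 4)); lia. }
destruct Hn0 as [n0 [m [Hn0 Hm]]].
destruct (multichoose_ratio_bounds _ _ Hk Hu0 Hu) as [B1 B2].
apply (corner_nonzero_geometric p n0 m z s1 s2 (11/100)); auto; try lra; try lia; fold k.
all: set (u := Cmod (corner_t z) ^ 4) in *.
- intros i Hi; replace (n0 + 4 * S i)%nat with ((n0 + 4 * i) + 4)%nat by lia.
  apply multichoose_ratio_from with (n1 := 8); auto; [unfold k; lia | | lra].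
  split; [lra |]; replace 8 with (INR 8) by (simpl; ring); apply le_INR; lia.
- assert (E1 : multichoose k (n0 + 4 * 2) * u <= 26/100 * multichoose k (n0 + 4 * 1)).
  { replace (n0 + 4 * 2)%nat with ((n0 + 4 * 1) + 4)%nat by lia.
    apply multichoose_ratio_from with (n1 := 4); auto; [unfold k; lia | | lra].
    split; [lra |]; replace 4 with (INR 4) by (simpl; ring); apply le_INR; lia. }
  assert (E0 : 0 < multichoose k (n0 + 4 * 0)) by (apply multichoose_gt0; unfold k; lia).
  assert (G1 : 0 <= multichoose k (n0 + 4 * 1)) by apply multichoose_ge0.
  set (e0 := multichoose k (n0 + 4 * 0)) in *; set (e1 := multichoose k (n0 + 4 * 1)) in *.
  set (e2 := multichoose k (n0 + 4 * 2)) in *.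
  assert (E2 : e2 * u ^ 2 <= 26/100 * (e1 * u)).
  { replace (e2 * u ^ 2) with (e2 * u * u) by ring.
    replace (26/100 * (e1 * u)) with (26/100 * e1 * u) by ring.
    now apply Rmult_le_compat_r. }
  assert (H25 : 0 < / 5 ^ (p - 2) <= / 25).
  { split; [apply Rinv_0_lt_compat, pow_lt; lra |].
    apply Rinv_le_contravar; [lra |]; replace 25 with (5 ^ 2) by ring.
    apply Rle_pow; [lra | lia]. }
  set (eps := 25 / 96 * / 5 ^ (p - 2)).
  assert (He : 0 < eps <= 11/1000) by (unfold eps; lra).
  assert (P1 : 0 <= e1 * u) by now apply Rmult_le_pos.
  set (X := e2 * u ^ 2) in *; set (Y := e1 * u) in *.
  (* The second term alone beats the tail: 26/100 * 28900/7921 is below 0.95, while (1 - eps) / (1 +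
     eps) exceeds 0.97. The positive first term makes the inequality strict even when u = 0. *)
  replace ((3 - 11/100) / (1 - 11/100) ^ 2) with (28900/7921) by field.
  apply Rle_lt_trans with ((1 + eps) * (26/100 * Y * (28900/7921))).
  { apply Rmult_le_compat_l; lra. }
  nra.
Qed.

(** * Conclusion *)

Lemma left_half_nonzero (p : nat) (z s1 s2 : C) :
  (2 <= p)%nat -> 0 < Im z -> 1 < 2 * Cmod z ^ 2 -> -1/2 <= Re z <= 0 ->
  is_sum_over OddRight (even_row_term p z) s1 -> is_sum_over OddLeft (odd_row_term p z) s2 -> (s1 + s2)%C <> 0.
Proof.
intros Hp Hy Hr Hx H1 H2.
destruct (Nat.eq_dec p 2) as [-> | Hp2].
{ destruct (Rle_dec 2 (Cmod z ^ 2)).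
  - apply (far_nonzero 2 z); auto; lra.
  - apply (weight4_nonzero z); auto; lra. }
destruct (Rle_dec 1 (Cmod z ^ 2)).
{ apply (far_nonzero p z); auto; [lra | right; split; [lia | lra]]. }
destruct (Nat.eq_dec p 3) as [-> | Hp3].
{ apply (weight6_nonzero z); auto; lra. }
destruct (Rle_dec 4 (INR (2 * p) * (Cmod (RtoC 2 * z + 1) - 1))).
- apply (near_arc_nonzero p z); auto; [lia | lra].
- apply (weight_ge8_corner p z); auto; [lia | lra].
Qed.

Lemma reflect_sums (p : nat) (z s1 s2 : C) : 0 < Im z ->
  is_sum_over OddRight (even_row_term p z) s1 -> is_sum_over OddLeft (odd_row_term p z) s2 ->
  is_sum_over OddRight (even_row_term p (- Cconj z)) (Cconj s1) /\
  is_sum_over OddLeft (odd_row_term p (- Cconj z)) (Cconj s2).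
Proof.
intros Hy H1 H2.
assert (N2 := Cpow2_R_neq0 p).
assert (Hop : forall u, coprime_pair u -> coprime_pair (- fst u, snd u)%Z)
  by (intros [b d] Hg; unfold coprime_pair in *; cbn [fst snd] in *; now rewrite Z.gcd_opp_l).
assert (Hinv : forall u : Z * Z, (- fst (- fst u, snd u), snd (- fst u, snd u))%Z = u)
  by (intros [b d]; cbn [fst snd]; now rewrite Z.opp_involutive).
split.
- apply is_sum_over_ext with (fun u => Cconj (even_row_term p z ((fun u => (- fst u, snd u)%Z) u))).
  + intros [b d] [_ Ho]; apply Odd_neq0, not_0_IZR in Ho; unfold even_row_term; cbn [fst snd] in *.
    rewrite Cinv_conj, Cpow_conj by (apply Cpow_nz, lin_neq0; auto).
    rewrite Cplus_conj, Cmult_conj, !Cconj_RtoC, opp_IZR.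
    do 2 f_equal; destruct z; apply injective_projections; simpl; ring.
  + apply is_sum_over_conj, (is_sum_over_bij OddRight OddRight _ (fun u => (- fst u, snd u)%Z)); auto.
    * intros u [Hg Ho]; split; [split; auto | apply Hinv].
    * intros u [Hg Ho]; split; [split; auto | apply Hinv].
- apply is_sum_over_ext with (fun u => Cconj (odd_row_term p z ((fun u => (- fst u, snd u)%Z) u))).
  + intros [b d] [_ Ho]; apply Odd_neq0 in Ho; unfold odd_row_term; cbn [fst snd] in *.
    assert (Hb : IZR (- b) <> 0) by (apply not_0_IZR; lia).
    rewrite Cinv_conj, Cmult_conj, !Cpow_conj
      by (apply Cmult_neq_0; auto; apply Cpow_nz, lin_neq0; auto).
    rewrite Cplus_conj, Cmult_conj, !Cconj_RtoC, opp_IZR.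
    do 3 f_equal; destruct z; apply injective_projections; simpl; ring.
  + assert (Hodd : forall b, Z.Odd b -> Z.Odd (- b))
      by (intros b [j Hj]; exists (- j - 1)%Z; lia).
    apply is_sum_over_conj, (is_sum_over_bij OddLeft OddLeft _ (fun u => (- fst u, snd u)%Z)); auto.
    * intros u [Hg Ho]; split; [split; [auto | now apply Hodd] | apply Hinv].
    * intros u [Hg Ho]; split; [split; [auto | now apply Hodd] | apply Hinv].
Qed.

Lemma Estar2_nonzero (p : nat) (z : C) :
  (2 <= p)%nat -> 0 < Im z -> 1 < 2 * Cmod z ^ 2 -> -1/2 <= Re z <= 1/2 ->
  Estar2 (2 * p) z <> 0.
Proof.
intros Hp Hy Hr Hx.
destruct (Estar2_sums p z Hp Hy) as [s1 [s2 [H1 [H2 ->]]]].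
assert (Hs : (s1 + s2)%C <> 0).
{ destruct (Rle_dec (Re z) 0) as [Hx0 | Hx0].
  - apply (left_half_nonzero p z); auto; lra.
  - destruct (reflect_sums p z s1 s2 Hy H1 H2) as [H1' H2'].
    intros E; apply (left_half_nonzero p (- Cconj z) (Cconj s1) (Cconj s2)); auto.
    + destruct z; simpl in *; lra.
    + rewrite Cmod_opp, Cmod_conj; exact Hr.
    + destruct z; simpl in *; lra.
    + rewrite <- Cplus_conj, E; apply Cconj_RtoC. }
apply Cmult_neq_0; auto.
intros E; assert (Z : (RtoC 2 * / RtoC 2)%C = 0) by (rewrite E; ring).
rewrite Cinv_r in Z; [injection Z; lra | intros E2; injection E2; lra].
Qed.

Theorem theorem1 (k : nat) (hk4 : (4 <= k)%nat) (hk : Nat.Even k) (z : C)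
  (hz : Fstar2 z) (hzero : Estar2 k z = RtoC 0) : closed_arc_A2 z.
Proof.
destruct hk as [p ->].
assert (Hs2 : 0 < sqrt 2) by (apply sqrt_lt_R0; lra).
assert (Hss : sqrt 2 * sqrt 2 = 2) by (apply sqrt_sqrt; lra).
assert (Hi : (1 / sqrt 2) ^ 2 = 1 / 2).
{ replace ((1 / sqrt 2) ^ 2) with (1 / (sqrt 2 * sqrt 2)) by (field; lra); now rewrite Hss. }
assert (Hi0 : 0 < 1 / sqrt 2) by (apply Rdiv_lt_0_compat; lra).
assert (Hon : forall z', 0 < Im z' -> -1/2 <= Re z' <= 1/2 -> Estar2 (2 * p) z' = RtoC 0 ->
  Cmod z' <= 1 / sqrt 2).
{ intros z' Hy Hx E; apply Rnot_lt_le; intros Hlt.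
  apply (Estar2_nonzero p z'); auto; [lia |]; nra. }
(* The right half of the domain lies strictly outside the circle and contains no zero; in the left
   half the modulus must be 1 / sqrt 2, and the bounds on Re z translate into bounds on the
   argument. *)
unfold Fstar2, upper_half_plane in hz; destruct hz as [[Hy [Hm Hx]] | [Hy [Hm Hx]]];
  assert (Hle := Hon z Hy ltac:(lra) hzero); [|lra].
assert (EM : Cmod z = 1 / sqrt 2) by lra.
split; [exact EM |].
assert (Hz : z <> 0) by (intros ->; simpl in Hy; lra).
destruct (Arg_correct z Hz) as [A1 [A2 A3]].
assert (HP := PI_RGT_0).
assert (Hpos : 0 < Arg z).
{ apply Rnot_le_lt; intros Hneg.
  assert (0 <= sin (- Arg z)) by (apply sin_ge_0; lra).
  rewrite sin_neg in H; rewrite EM in A3; nra. }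
rewrite EM in A2.
split; apply Rnot_lt_le; intros Hlt.
- assert (0 < cos (Arg z)) by (apply cos_gt_0; lra). nra.
(* A larger argument would give Re z < -(1 / sqrt 2)^2 = -1/2. *)
- assert (Hc : cos (Arg z) < cos (3 * PI / 4)) by (apply cos_decreasing_1; lra).
  replace (3 * PI / 4) with (3 * (PI / 4)) in Hc by field; rewrite cos_3PI4 in Hc.
  assert (1 / sqrt 2 * cos (Arg z) < 1 / sqrt 2 * (-1 / sqrt 2))
    by now apply Rmult_lt_compat_l.
  replace (1 / sqrt 2 * (-1 / sqrt 2)) with (- (1 / sqrt 2) ^ 2) in H by (field; lra).
  lra.
Qed.
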